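(* Let $\Gamma=\Gamma_\rho(\zeta)$ be the spherical cap with center $\zeta\in\Omega$ and radius $\rho\in(0,2)$. For $\xi\in\Gamma_\rho(\zeta)$ set $$\check{r}=-\frac{1+2(\xi\cdot\zeta)(\rho-1)+(\rho-1)^2}{\rho(\rho-2)},\qquad \check{\xi}=\frac{1}{\check{r}}\,\xi-\frac{\check{r}-1}{\check{r}(\rho-1)}\,\zeta,$$ where for $\rho=1$ the quotient $\frac{\check r-1}{\rho-1}$ is understood as its continuous extension $2\,\xi\cdot\zeta$. Then a Neumann Green function for $\Gamma_\rho(\zeta)$ with respect to the Beltrami operator is given by $$G_N(\Delta^*;\xi,\eta)=\frac{1}{4\pi}\ln(1-\xi\cdot\eta)+\frac{1}{4\pi}\ln\big(\check{r}(1-\check{\xi}\cdot\eta)\big)+\frac{1-\rho}{2\pi\rho}\ln(1+\zeta\cdot\eta).$$ Moreover, if $F\in C^{(0)}(\partial\Gamma_\rho(\zeta))$ and $U\in C^{(2)}(\overline{\Gamma_\rho(\zeta)})$ is a solution of the Neumann problem $\Delta^*U=0$ in $\Gamma_\rho(\zeta)$, $\frac{\partial}{\partial\nu}U=F$ on $\partial\Gamma_\rho(\zeta)$, then for all $\xi\in\Gamma_\rho(\zeta)$ $$U(\xi)=\frac{1}{2\pi\rho}\int_{\Gamma_\rho(\zeta)}U(\eta)\,d\omega(\eta)-\int_{\partial\Gamma_\rho(\zeta)}\left(\frac{1}{2\pi}\ln(1-\xi\cdot\eta)+\frac{1-\rho}{2\pi\rho}\ln(2-\rho)\right)F(\eta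)\,d\sigma(\eta).$$
   Context: $\Omega=\{x\in\mathbb{R}^3:|x|=1\}$ is the unit sphere, $\nabla^*$ the surface gradient and $\Delta^*=\nabla^*\cdot\nabla^*$ the Beltrami operator (Laplace–Beltrami operator) on $\Omega$; $d\omega$ is the surface element on $\Omega$ and $d\sigma$ the line element on boundary curves. The spherical cap with center $\zeta\in\Omega$ and radius $\rho\in(0,2)$ is $\Gamma_\rho(\zeta)=\{\eta\in\Omega:1-\zeta\cdot\eta<\rho\}$. For a region $\Gamma\subset\Omega$ with smooth boundary, $\nu(\eta)$ is the unit normal at $\eta\in\partial\Gamma$, tangential to $\Omega$, perpendicular to $\partial\Gamma$, and pointing out of $\Gamma$; $\frac{\partial}{\partial\nu}F=\nu\cdot\nabla^*F$; $\|\Gamma\|$ is the surface area of $\Gamma$. The fundamental solution for the Beltrami operator is $$G(\Delta^*;t)=\frac{1}{4\pi}\ln(1-t)+\frac{1}{4\pi}(1-\ln 2),\quad t\in[-1,1).$$ A function $G_N(\Delta^*;\cdot,\cdot)$ is called a Neumann Green function (with respect to the Beltrami operator) for $\Gamma$ if $$G_N(\Delta^*;\xi,\eta)=G(\Delta^*;\xi\cdot\eta)-\Phi_N(\xi,\eta),\quad \eta\in\overline{\Gamma},\ \xi\in\Gamma,\ \xi\neq\eta,$$ where, for every $\xi\in\Gamma$, $\Phi_N(\xi,\cdot)\in C^{(2)}(\Gamma)\cap C^{(1)}(\overline{\Gamma})$ satisfies $\Delta^*_\eta\Phi_N(\xi,\eta)=\frac{1}{\|\Gamma\|}-\frac{1}{4\pi}$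 for $\eta\in\Gamma$ and $\frac{\partial}{\partial\nu(\eta)}\Phi_N(\xi,\eta)=\frac{\partial}{\partial\nu(\eta)}G(\Delta^*;\xi\cdot\eta)$ for $\eta\in\partial\Gamma$ (boundary values taken from within $\Gamma$). *)

(* Defs.v *)
From HB Require Import structures.
From mathcomp Require Import all_boot all_order all_algebra.
From mathcomp Require Import all_classical all_reals all_analysis.
Set Implicit Arguments.
Unset Strict Implicit.
Unset Printing Implicit Defensive.
Import Order.TTheory GRing.Theory Num.Theory.
Import numFieldNormedType.Exports.

Local Open Scope classical_set_scope.
Local Open Scope ring_scope.

Definition dot (R : realType) (u v : 'rV[R]_3) : R :=
  \sum_(i < 3) u 0 i * v 0 i.

(* The library norm on 'rV[R]_3 is the sup norm; it induces the Euclidean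
   topology but not the Euclidean length. *)
Definition enorm (R : realType) (u : 'rV[R]_3) : R := Num.sqrt (dot u u).

Definition normalize (R : realType) (u : 'rV[R]_3) : 'rV[R]_3 :=
  (enorm u)^-1 *: u.

Definition row3 (R : realType) (a b c : R) : 'rV[R]_3 :=
  \row_(i < 3) [:: a; b; c]`_i.

Definition basis3 (R : realType) (i : 'I_3) : 'rV[R]_3 := delta_mx 0 i.

Definition Omega (R : realType) : set 'rV[R]_3 := [set x | enorm x = 1].

(* A function on (a part of) the sphere is represented by a function on R^3,
   of which only the values on the sphere matter: its derivatives are those of
   the extension x |-> F (x / |x|), constant along rays.  Since
   grad = x/|x| d/dr + (1/r) grad^*, the gradient of that extension at a point
   of the sphere is the surface gradient. *)
Definition sgrad (R : realType) (F : 'rV[R]_3 -> R) (x : 'rV[R]_3) :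
    'rV[R]_3 :=
  \row_(i < 3) 'D_(basis3 R i) (fun y => F (normalize y)) x.

Definition sdiv (R : realType) (f : 'rV[R]_3 -> 'rV[R]_3) (x : 'rV[R]_3) : R :=
  \sum_(i < 3) sgrad (fun y => f y 0 i) x 0 i.

Definition beltrami (R : realType) (F : 'rV[R]_3 -> R) : 'rV[R]_3 -> R :=
  sdiv (sgrad F).

Definition sderivable (R : realType) (F : 'rV[R]_3 -> R) (x : 'rV[R]_3) :
    Prop :=
  forall i : 'I_3, derivable (fun y => F (normalize y)) x (basis3 R i).

(* Boundary relative to the sphere. *)
Definition sboundary (R : realType) (Gam : set 'rV[R]_3) : set 'rV[R]_3 :=
  closure Gam `&` closure (@Omega R `\` Gam).

(* C^(k)(Gam), for Gam relatively open in the sphere. *)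
Fixpoint Ck (R : realType) (k : nat) (Gam : set 'rV[R]_3)
    (F : 'rV[R]_3 -> R) : Prop :=
  {within Gam, continuous F} /\
  if k is k'.+1 then
    (forall x, Gam x -> sderivable F x) /\
    (forall i : 'I_3, Ck k' Gam (fun x => sgrad F x 0 i))
  else True.

(* C^(k) of the closure of Gam, for Gam relatively open in the sphere: F and its
   surface derivatives of order <= k, taken inside Gam, have continuous
   extensions G to the closure of Gam. *)
Fixpoint Ck_closure (R : realType) (k : nat) (Gam : set 'rV[R]_3)
    (F : 'rV[R]_3 -> R) : Prop :=
  {within closure Gam, continuous F} /\
  if k is k'.+1 then
    (forall x, Gam x -> sderivable F x) /\
    (exists2 G : 'rV[R]_3 -> 'rV[R]_3,
       forall x, Gam x -> G x = sgrad F x &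
       forall i : 'I_3, Ck_closure k' Gam (fun x => G x 0 i))
  else True.

(* v is unit, tangential to the sphere at eta, perpendicular to every
   differentiable curve in the boundary of Gam through eta, and the great circle
   through eta in the direction v leaves Gam at eta. *)
Definition is_outer_normal (R : realType) (Gam : set 'rV[R]_3)
    (eta v : 'rV[R]_3) : Prop :=
  [/\ enorm v = 1,
      dot v eta = 0,
      forall c : R -> 'rV[R]_3, c 0 = eta -> derivable c 0 1 ->
        (\forall s \near (0 : R), sboundary Gam (c s)) -> dot v (derive1 c 0) = 0 &
      \forall h \near (0 : R)^'+,
        Gam (normalize (eta - h *: v)) /\
        ~ closure Gam (normalize (eta + h *: v))].

Definition outer_normal (R : realType) (Gam : set 'rV[R]_3) (eta : 'rV[R]_3) :
    'rV[R]_3 :=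
  xget 0 [set v | is_outer_normal Gam eta v].

(* nu . grad^* F at a boundary point, with grad^* F at that point understood as
   the limit of its values inside Gam. *)
Definition normal_derivative (R : realType) (Gam : set 'rV[R]_3)
    (F : 'rV[R]_3 -> R) (eta : 'rV[R]_3) : R :=
  lim (dot (outer_normal Gam eta) (sgrad F x) @[x --> within Gam (nbhs eta)]).

(* Polar coordinates p = (t, phi); the two partial derivatives of this map are
   orthogonal with product of lengths 1, so the surface element is dt dphi. *)
Definition sphere_point (R : realType) (p : R * R) : 'rV[R]_3 :=
  row3 (Num.sqrt (1 - p.1 ^+ 2) * cos p.2)
       (Num.sqrt (1 - p.1 ^+ 2) * sin p.2)
       p.1.

Definition surface_integral (R : realType) (Gam : set 'rV[R]_3)
    (f : 'rV[R]_3 -> R) : R :=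
  \int[(@lebesgue_measure R \x @lebesgue_measure R)%E]_(p in
      [set p : R * R | [/\ -1 <= p.1 <= 1, 0 <= p.2 <= 2 * pi &
                          Gam (sphere_point p)]])
    f (sphere_point p).

Definition surface_area (R : realType) (Gam : set 'rV[R]_3) : R :=
  surface_integral Gam (fun=> 1).

Definition line_integral (R : realType) (c : R -> 'rV[R]_3) (a b : R)
    (f : 'rV[R]_3 -> R) : R :=
  \int[@lebesgue_measure R]_(s in `[a, b]) (f (c s) * enorm (derive1 c s)).

Definition fundamental_solution (R : realType) (t : R) : R :=
  (4 * pi)^-1 * ln (1 - t) + (4 * pi)^-1 * (1 - ln 2).

Definition is_neumann_green (R : realType) (Gam : set 'rV[R]_3)
    (GN : 'rV[R]_3 -> 'rV[R]_3 -> R) : Prop :=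
  exists Phi : 'rV[R]_3 -> 'rV[R]_3 -> R,
    (forall xi eta, Gam xi -> closure Gam eta -> xi != eta ->
       GN xi eta = fundamental_solution (dot xi eta) - Phi xi eta) /\
    (forall xi, Gam xi ->
       [/\ Ck 2 Gam (Phi xi),
           Ck_closure 1 Gam (Phi xi),
           forall eta, Gam eta ->
             beltrami (Phi xi) eta = (surface_area Gam)^-1 - (4 * pi)^-1 &
           forall eta, sboundary Gam eta ->
             normal_derivative Gam (Phi xi) eta =
             normal_derivative Gam
               (fun x => fundamental_solution (dot xi x)) eta]).

Definition cap (R : realType) (rho : R) (zeta : 'rV[R]_3) : set 'rV[R]_3 :=
  [set eta | Omega eta /\ 1 - dot zeta eta < rho].

Definition orthonormal_frame (R : realType) (e1 e2 e3 : 'rV[R]_3) : Prop :=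
  [/\ enorm e1 = 1, enorm e2 = 1 & enorm e3 = 1] /\
  [/\ dot e1 e2 = 0, dot e1 e3 = 0 & dot e2 e3 = 0].

(* For 0 <= phi <= 2 pi and an orthonormal frame (e1, e2, zeta) this runs once
   through the boundary circle zeta . eta = 1 - rho of the cap. *)
Definition cap_boundary (R : realType) (e1 e2 zeta : 'rV[R]_3) (rho : R)
    (phi : R) : 'rV[R]_3 :=
  (1 - rho) *: zeta +
  Num.sqrt (1 - (1 - rho) ^+ 2) *: (cos phi *: e1 + sin phi *: e2).

Definition rcheck (R : realType) (rho : R) (zeta xi : 'rV[R]_3) : R :=
  - ((1 + 2 * dot xi zeta * (rho - 1) + (rho - 1) ^+ 2) / (rho * (rho - 2))).

Definition rcheck_quotient (R : realType) (rho : R) (zeta xi : 'rV[R]_3) : R :=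
  if rho == 1 then 2 * dot xi zeta
  else (rcheck rho zeta xi - 1) / (rho - 1).

Definition xicheck (R : realType) (rho : R) (zeta xi : 'rV[R]_3) : 'rV[R]_3 :=
  (rcheck rho zeta xi)^-1 *: xi -
  (rcheck_quotient rho zeta xi / rcheck rho zeta xi) *: zeta.

Definition cap_neumann_green (R : realType) (rho : R) (zeta : 'rV[R]_3)
    (xi eta : 'rV[R]_3) : R :=
  (4 * pi)^-1 * ln (1 - dot xi eta) +
  (4 * pi)^-1 * ln (rcheck rho zeta xi * (1 - dot (xicheck rho zeta xi) eta)) +
  (1 - rho) / (2 * pi * rho) * ln (1 + dot zeta eta).

(* Main.v *)
(* On the unit sphere every function ln (al + b . x) with |b| = al has Beltrami
   image -1 where it is defined, and the regular part of the Green function is a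
   combination of two of these; its boundary condition is an algebraic identity,
   because the outer normal of the cap is explicit and the argument of the
   second logarithm equals 1 - xi . eta on the boundary circle.

   For the representation formula, stereographic coordinates centred at zeta are
   conformal, so U becomes a harmonic function u of polar coordinates (r, phi)
   in a disc of radius r0.  Green's identity on concentric circles, applied to u
   and the kernels 1, ln r, ln |1 - (r/s) e^(i phi)|^2 and
   ln |1 - (a/r) e^(i phi)|^2, expresses the boundary integral of
   ln (1 - xi . eta) against dU/dnu through U zeta and Poisson integrals of u
   over circles r > a; as r -> a these converge to u at xi.  The circle means of
   u all equal U zeta, hence so does the mean of U over the cap. *)
Require Import Defs.
From HB Require Import structures.
From mathcomp Require Import all_boot all_order all_algebra.
From mathcomp Require Import all_classical all_reals all_analysis.
From mathcomp Require Import measurable_realfun.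
From mathcomp Require Import ring lra.
Set Implicit Arguments.
Unset Strict Implicit.
Unset Printing Implicit Defensive.
Import Order.TTheory GRing.Theory Num.Theory.
Import numFieldNormedType.Exports.
Local Open Scope classical_set_scope.
Local Open Scope ring_scope.

(** * Vectors and derivatives along curves *)

(** The regularity hypothesis yields partial derivatives inside the cap and continuous extensions of
    them to its closure. Chain rules therefore start from the fact that continuous partial
    derivatives imply differentiability, and identities on the boundary circle are limits of
    identities on inner circles, by dominated convergence. No disc around the pole is cut out: if xi
    has radius a, all circles used have r > a. On the circle of radius r the kernels with poles at
    radius a and at the reflected radius r^2 / a both equal [logker (a / r)]. The reflected one is
    regular inside and produces the Poisson kernel; the other one shows that the integral does not
    depend on r. Additive constants in a kernel multiply the flux of U, which is zero. The surface
    integral uses polar coordinates about a fixed axis, whereas circle means are known about zeta,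
    so rotation invariance has to be proved. Rotation about the axis is periodicity in the angle. To
    exchange x and z, each hemisphere of constant sign of y is projected to the (x, z)-plane, where
    the surface measure has density 1 / |y|, symmetric in x and z, and Tonelli's theorem applies. *)

Section vectors.
Context {R : realType}.
Implicit Types (u v w x : 'rV[R]_3) (k : R).

Lemma dotE u v : dot u v = u 0 0 * v 0 0 + u 0 1 * v 0 1 + u 0 2%:R * v 0 2%:R.
Proof.
rewrite /dot !big_ord_recl big_ord0 addr0 addrA.
by congr (_ + _ + _); congr (u 0 _ * v 0 _); apply/val_inj.
Qed.

Lemma dotC u v : dot u v = dot v u.
Proof. by apply: eq_bigr => i _; rewrite mulrC. Qed.

Lemma dotDl u v w : dot (u + v) w = dot u w + dot v w.
Proof. by rewrite !dotE !mxE; ring. Qed.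

Lemma dotZl k u w : dot (k *: u) w = k * dot u w.
Proof. by rewrite !dotE !mxE; ring. Qed.

Lemma dotNl u w : dot (- u) w = - dot u w.
Proof. by rewrite !dotE !mxE; ring. Qed.

Lemma dotDr u v w : dot w (u + v) = dot w u + dot w v.
Proof. by rewrite !(dotC w) dotDl. Qed.

Lemma dotZr k u w : dot w (k *: u) = k * dot w u.
Proof. by rewrite !(dotC w) dotZl. Qed.

Lemma dotNr u w : dot w (- u) = - dot w u.
Proof. by rewrite !(dotC w) dotNl. Qed.

Definition dot_bilin := (dotDl, dotDr, dotNl, dotNr, dotZl, dotZr).

Lemma dot_basis u i : dot u (basis3 R i) = u 0 i.
Proof.
rewrite /dot (bigD1 i)//= big1 => [|j ji]; rewrite /basis3 !mxE ?eqxx ?mulr1 ?addr0//.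
by rewrite (negbTE ji) mulr0.
Qed.

Lemma dot_ge0 u : 0 <= dot u u.
Proof. by rewrite dotE; nra. Qed.

Lemma dot_eq0 u : dot u u = 0 -> u = 0.
Proof.
move=> u0; apply/rowP => i; rewrite mxE.
have : \sum_(j < 3) u 0 j * u 0 j = 0 by [].
move/eqP; rewrite psumr_eq0 => [/allP/(_ i)|j _]; last by nra.
by rewrite mem_index_enum => /(_ isT) /=; rewrite mulf_eq0 orbb => /eqP.
Qed.

Lemma OmegaE x : Omega x <-> dot x x = 1.
Proof.
rewrite /Omega /= /enorm; split=> [/(congr1 (fun t => t ^+ 2))|->]; last by rewrite sqrtr1.
by rewrite sqr_sqrtr ?dot_ge0// expr1n.
Qed.

Lemma normalize_Omega x : Omega x -> normalize x = x.
Proof. by rewrite /Omega /= /normalize => ->; rewrite invr1 scale1r. Qed.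

Lemma enorm_gt0 x : x != 0 -> 0 < enorm x.
Proof.
move=> x0; rewrite sqrtr_gt0 lt_neqAle dot_ge0 andbT eq_sym.
by apply: contra x0 => /eqP/dot_eq0 ->.
Qed.

Lemma enormZ k x : enorm (k *: x) = `|k| * enorm x.
Proof.
by rewrite /enorm dotZl dotZr mulrA -expr2 sqrtrM ?sqr_ge0// sqrtr_sqr.
Qed.

Lemma Omega_normalize x : x != 0 -> Omega (normalize x).
Proof.
move=> x0; rewrite /Omega /= /normalize enormZ gtr0_norm ?invr_gt0 ?enorm_gt0//.
by rewrite mulVf// gt_eqF// enorm_gt0.
Qed.

Lemma normalizeZ k x : 0 < k -> normalize (k *: x) = normalize x.
Proof.
move=> k0; rewrite /normalize enormZ gtr0_norm// invfM scalerA.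
by rewrite mulrAC mulVf ?gt_eqF// mul1r.
Qed.

Lemma Omega_neq0 x : Omega x -> x != 0.
Proof.
move=> /OmegaE; apply: contra_eqN => /eqP ->.
by rewrite dotE !mxE !mul0r !addr0 eq_sym oner_eq0.
Qed.

Lemma dot_sub_Omega u v : Omega u -> Omega v ->
  dot (u - v) (u - v) = 2 - 2 * dot u v.
Proof.
by move=> /OmegaE u1 /OmegaE v1; rewrite !dot_bilin u1 v1 (dotC v u); ring.
Qed.

Lemma dot_le1 u v : Omega u -> Omega v -> dot u v <= 1.
Proof.
move=> uO vO; have := dot_ge0 (u - v); rewrite dot_sub_Omega//.
lra.
Qed.

Lemma dot_lt1 u v : Omega u -> Omega v -> u != v -> dot u v < 1.
Proof.
move=> uO vO; rewrite lt_neqAle dot_le1// andbT; apply: contra_neq => uv.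
apply/subr0_eq/dot_eq0; rewrite dot_sub_Omega// uv; lra.
Qed.

Lemma coord_continuous3 (i : 'I_3) : continuous (fun x : 'rV[R]_3 => x 0 i).
Proof. exact: coord_continuous. Qed.

Lemma cvg_dot (T : Type) (F : set_system T) {FF : Filter F} (f g : T -> 'rV[R]_3) u v :
  f @ F --> u -> g @ F --> v -> (fun t => dot (f t) (g t)) @ F --> dot u v.
Proof.
move=> fu gv; rewrite (_ : (fun t => _) = (fun t => f t 0 0 * g t 0 0 + f t 0 1 * g t 0 1
   + f t 0 2%:R * g t 0 2%:R)); last by apply/funext => y; rewrite dotE.
rewrite dotE.
have H (h : T -> 'rV[R]_3) w i : h @ F --> w -> (fun t => h t 0 i) @ F --> w 0 i.
  move=> hw; exact: (@cvg_comp _ _ _ h (fun x : 'rV[R]_3 => x 0 i) F (nbhs w) (nbhs (w 0 i)) hw (@coord_continuous3 i w)).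
by apply: cvgD; [apply: cvgD|]; apply: cvgM; apply: H.
Qed.

Lemma continuous_dot (b : 'rV[R]_3) : continuous (dot b).
Proof.
by move=> x; exact: (@cvg_dot _ (nbhs x) _ (fun=> b) id b x (cvg_cst _) cvg_id).
Qed.

Lemma cvg_row (T : Type) (F : set_system T) {FF : Filter F} (f : T -> 'rV[R]_3) u :
  (forall i, (fun t => f t 0 i) @ F --> u 0 i) -> f @ F --> u.
Proof.
move=> H; apply/cvgrPdist_le => e e0; near=> t.
rewrite /Num.Def.normr/= mx_normrE (bigmax_le _ (ltW e0))//= => -[i j] _ /=.
rewrite !mxE ord1; move: j; near: t; apply: filter_forall => j.
exact: ((cvgrPdist_le _ _).1 (H j)).
Unshelve. all: by end_near. Qed.

Lemma continuous_enorm : continuous (@enorm R).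
Proof.
move=> x; apply: (@continuous_comp _ _ _ (fun x => dot x x) Num.sqrt).
  exact: (@cvg_dot _ (nbhs x) _ id id x x cvg_id cvg_id).
exact: sqrt_continuous.
Qed.

Lemma continuous_normalize x : x != 0 -> {for x, continuous (@normalize R)}.
Proof.
move=> x0; apply: (@cvgZ _ _ _ (nbhs x) _ (fun y => (enorm y)^-1) id); last exact: cvg_id.
by apply: (@cvgV _ _ (nbhs x)); [rewrite gt_eqF// enorm_gt0|exact: continuous_enorm].
Qed.

Lemma is_derive_row (c : R -> 'rV[R]_3) (c' : 'rV[R]_3) (t : R) :
  (forall i, is_derive t 1 (fun s => c s 0 i) (c' 0 i)) -> is_derive t 1 c c'.
Proof.
move=> H.
have dc : derivable c t 1 by apply/derivable_mxP => i j; rewrite ord1; case: (H j).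
apply: DeriveDef => //; rewrite derive_mx//; apply/rowP => j; rewrite mxE.
by case: (H j).
Qed.

(** Moves directional derivatives to one real variable, where the chain rule for real functions
    applies. *)
Lemma is_derive_line (W : normedModType R) (f : 'rV[R]_3 -> W) x v (l : W) :
  is_derive x v f l <-> is_derive (0 : R) 1 (fun h : R => f (h *: v + x)) l.
Proof.
have E : 'D_v f x = 'D_1 (fun h : R => f (h *: v + x)) (0 : R).
  rewrite /derive; apply: (congr1 (fun g : R -> W => lim (g @ 0^'))).
  by apply/funext => h; rewrite /= addr0 scale0r add0r -[h%:A]/(h * 1) mulr1.
split=> [[d dE]|[d dE]]; split.
- exact: (derivable1P f x v).1 d.
- by rewrite -E.
- exact: (derivable1P f x v).2 d.
- by rewrite E.
Qed.

(** |h v + x|^2 = |v|^2 h^2 + 2 (x . v) h + 1, whose inverse square root has derivative -(x . v) at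
    0: normalizing removes the radial part of v. *)
Lemma is_derive_normalize x v : Omega x ->
  is_derive (0 : R) 1 (fun h : R => normalize (h *: v + x)) (v - dot x v *: x).
Proof.
move=> /OmegaE x1; apply: is_derive_row => i.
rewrite (_ : (fun s => _) = (fun s : R => (Num.sqrt (dot v v * s ^+ 2 + 2 * dot x v * s + 1))^-1
    * (v 0 i * s + x 0 i))); last first.
  apply/funext => s; rewrite !mxE [s * _]mulrC; congr ((Num.sqrt _)^-1 * _).
  by rewrite !dot_bilin x1 (dotC v x); ring.
have E : dot v v * 0 ^+ 2 + 2 * dot x v * 0 + 1 = 1 :> R by ring.
have p : 0 < dot v v * 0 ^+ 2 + 2 * dot x v * 0 + 1 :> R by rewrite E.
pose q (s : R) := dot v v * s ^+ 2 + 2 * dot x v * s + 1.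
have dq : is_derive (0 : R) 1 q (2 * dot x v).
  by apply: is_derive_eq; rewrite /GRing.scale /= ; ring.
have ds : is_derive (q 0) 1 Num.sqrt (2^-1).
  have -> : q 0 = 1 by [].
  have := @is_derive1_sqrt R 1 ltr01; rewrite sqrtr1 mulr1; exact.
have dsq := is_derive1_comp ds dq.
have n0 : (Num.sqrt \o q) 0 != 0 by rewrite /= /q E sqrtr1 oner_eq0.
have dV := is_deriveV n0 dsq.
rewrite (_ : (fun s => _) = (fun s => ((Num.sqrt \o q) s)^-1 * (v 0 i * s + x 0 i)))//.
apply: is_derive_eq.
by rewrite /= /q E sqrtr1 !mxE /GRing.scale /=; field.
Qed.

Lemma is_derive_curve (W : normedModType R) (f : 'rV[R]_3 -> W) (c : R -> 'rV[R]_3)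
    (t : R) (x c' : 'rV[R]_3) :
  c t = x -> differentiable f x -> is_derive t 1 c c' ->
  is_derive t 1 (fun s => f (c s)) ('d f x c').
Proof.
move=> <- {x} df [dc cE].
have dc' : differentiable c t by exact/derivable1_diffP.
have dfc : differentiable (f \o c) t by exact: differentiable_comp.
apply: DeriveDef; first exact/derivable1_diffP.
by rewrite deriveE// diff_comp//= -cE deriveE.
Qed.

Definition grad (f : 'rV[R]_3 -> R) (x : 'rV[R]_3) : 'rV[R]_3 := \row_i 'D_(basis3 R i) f x.

Lemma row_basis v : v = \sum_i v 0 i *: basis3 R i.
Proof. exact: row_sum_delta. Qed.

Lemma diff_grad (f : 'rV[R]_3 -> R) x v : differentiable f x ->
  'd f x v = dot (grad f x) v.
Proof.
move=> df; rewrite [in LHS](row_basis v) linear_sum /dot; apply: eq_bigr => i _.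
by rewrite linearZ /= mxE deriveE// mulrC.
Qed.

Lemma is_derive_sgrad (F : 'rV[R]_3 -> R) x i : Omega x -> differentiable F x ->
  is_derive x (basis3 R i) (fun y => F (normalize y)) ('d F x (basis3 R i - x 0 i *: x)).
Proof.
move=> xO dF; apply/is_derive_line.
have nx : normalize (0 *: basis3 R i + x) = x.
  by rewrite scale0r add0r normalize_Omega.
apply: (@is_derive_curve _ F (fun h : R => normalize (h *: basis3 R i + x)))=> //.
by rewrite -[x 0 i]dot_basis; exact: is_derive_normalize.
Qed.

Lemma differentiable_sderivable (F : 'rV[R]_3 -> R) x : Omega x -> differentiable F x -> sderivable F x.
Proof. by move=> xO dF i; case: (is_derive_sgrad i xO dF). Qed.

Lemma sgradE (F : 'rV[R]_3 -> R) x i : Omega x -> differentiable F x ->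
  sgrad F x 0 i = 'd F x (basis3 R i - x 0 i *: x).
Proof. by move=> xO dF; rewrite mxE; case: (is_derive_sgrad i xO dF). Qed.

End vectors.

(** * Functions with a continuous surface gradient *)

Section continuously_differentiable.
Context {R : realType}.
Implicit Types (f : 'rV[R]_3 -> R) (x y p : 'rV[R]_3) (i : 'I_3).

Lemma is_derive_segment f p (v : 'rV[R]_3) (s t : R) : derivable f ((t * s) *: v + p) v ->
  is_derive t 1 (fun t => f ((t * s) *: v + p)) (s * 'D_v f ((t * s) *: v + p)).
Proof.
move=> /derivableP/is_derive_line; set q := (t * s) *: v + p => dq.
have ds : is_derive t 1 (fun t' : R => (t' - t) * s) s.
  by apply: is_derive_eq; rewrite /GRing.scale /=; ring.
have e0 : (fun t' : R => (t' - t) * s) t = 0 by rewrite subrr mul0r.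
rewrite -e0 in dq.
have := @is_derive1_comp R _ (fun t' : R => (t' - t) * s) t _ _ dq ds; rewrite mulrC.
congr is_derive; apply/funext => t' /=; congr f.
by rewrite /q addrA -scalerDl; congr (_ *: _ + _); ring.
Qed.

(** The mean value theorem on a segment. Parametrizing it over [0, 1] treats both signs of s at
    once. *)
Lemma increment_bound f (v p : 'rV[R]_3) (s a e : R) :
  (forall t, 0 <= t <= 1 -> derivable f ((t * s) *: v + p) v /\ `|'D_v f ((t * s) *: v + p) - a| <= e) ->
  `|f (s *: v + p) - f p - s * a| <= e * `|s|.
Proof.
move=> H; pose g t := f ((t * s) *: v + p).
have dg (t : R) : 0 <= t <= 1 -> is_derive t 1 g (s * 'D_v f ((t * s) *: v + p)).
  by move=> /H[df _]; exact: is_derive_segment.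
have [||c] := @MVT _ g (fun t => s * 'D_v f ((t * s) *: v + p)) 0 1 ltr01.
- by move=> t; rewrite in_itv/= => /andP[? ?]; apply: dg; rewrite !ltW.
- apply: derivable_within_continuous => t; rewrite in_itv/= => t01.
  by case: (dg t t01).
rewrite in_itv/= => /andP[c0 c1].
rewrite /g mul1r mul0r scale0r add0r subr0 mulr1 => ->.
rewrite -mulrBr normrM mulrC ler_wpM2r//.
by have [|_ //] := H c; rewrite !ltW.
Qed.

Lemma differentiable_of_increment (V W : normedModType R) (f : V -> W) (L : {linear V -> W}) (x : V) :
  continuous L ->
  (forall e : R, 0 < e -> \forall h \near (0 : V), `|f (h + x) - f x - L h| <= e * `|h|) ->
  differentiable f x.
Proof.
move=> cL H; have o : f \o shift x = cst (f x) + L +o_ 0 id.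
  apply/eqaddoP => e e0; near=> h; rewrite !fctE /= opprD addrA.
  by near: h; exact: H.
by apply/diff_locallyP; rewrite (diff_unique cL o).
Unshelve. all: by end_near. Qed.

Lemma coord_le_norm x i : `|x 0 i| <= `|x|.
Proof.
rewrite [leRHS]/Num.Def.normr/= mx_normrE.
exact: (le_bigmax _ (fun ij : 'I_1 * 'I_3 => `|x ij.1 ij.2|) (0, i)).
Qed.

Lemma norm_lt_coord x (d : R) : 0 < d -> (forall i, `|x 0 i| < d) -> `|x| < d.
Proof.
move=> d0 H; rewrite {1}/Num.Def.normr/= mx_normrE.
by apply/bigmax_ltP; split => // -[i j] _ /=; rewrite ord1.
Qed.

(** The increment from x to h + x is split along three segments parallel to the axes; on each of
    them the partial derivative stays within e / 3 of its value at x. *)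
Lemma continuous_partials_differentiable f x :
  (\forall y \near x, forall i, derivable f y (basis3 R i)) ->
  (forall i, {for x, continuous (fun y => 'D_(basis3 R i) f y)}) ->
  differentiable f x.
Proof.
move=> nd cd.
pose a := grad f x.
have Llin : linear (dot a : 'rV[R]_3 -> R).
  by move=> k u v; rewrite dotDr dotZr.
pose L : {linear 'rV[R]_3 -> R} := HB.pack (dot a : 'rV[R]_3 -> R) (GRing.isLinear.Build _ _ _ _ _ Llin).
have cL : continuous L by exact: continuous_dot.
apply: (differentiable_of_increment cL) => e e0.
have e3 : 0 < e / 3 by rewrite divr_gt0.
have nD : \forall y \near x, forall i, derivable f y (basis3 R i) /\
    `|'D_(basis3 R i) f y - a 0 i| <= e / 3.
  near=> y => i; split; first by move: i; near: y.
  move: i; near: y; apply: filter_forall => i.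
  have /cvgrPdist_le/(_ _ e3) := cd i; apply: filterS => y.
  by rewrite distrC mxE.
have [d /= d0 H] := (nbhs_ballP x _).1 nD.
near=> h; rewrite /=.
have hd : `|h| < d.
  near: h; apply/nbhs_ballP; exists d => //= y; rewrite -ball_normE /ball_ /= sub0r normrN.
  exact.
have hi i : `|h 0 i| < d by apply: le_lt_trans (coord_le_norm h i) hd.
(* Balls of the sup norm are cubes, so the whole box spanned by x and h + x, and with it the three
   segments, stays in the ball. *)
have bx (c0 c1 c2 : R) : `|c0| <= `|h 0 0| -> `|c1| <= `|h 0 1| -> `|c2| <= `|h 0 2%:R| ->
    ball x d (c0 *: basis3 R 0 + c1 *: basis3 R 1 + c2 *: basis3 R 2%:R + x).
  move=> k0 k1 k2; rewrite -ball_normE /ball_ /= distrC addrK; apply: norm_lt_coord => // i.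
  rewrite !mxE eqxx; case: i => [[|[|[|//]]] i3] /=; rewrite ?mulr1 ?mulr0 ?addr0 ?add0r.
  - exact: le_lt_trans k0 _.
  - exact: le_lt_trans k1 _.
  - exact: le_lt_trans k2 _.
have tm (t s : R) : 0 <= t <= 1 -> `|t * s| <= `|s|.
  move=> /andP[t0 t1]; rewrite normrM ger0_norm// -[leRHS]mul1r.
  by rewrite ler_wpM2r.
have z0 (s : R) : `|0 : R| <= `|s| by rewrite normr0.
have I0 := @increment_bound f (basis3 R 0) x (h 0 0) (a 0 0) (e / 3).
have I1 := @increment_bound f (basis3 R 1) (h 0 0 *: basis3 R 0 + x) (h 0 1) (a 0 1) (e / 3).
have I2 := @increment_bound f (basis3 R 2%:R) (h 0 0 *: basis3 R 0 + h 0 1 *: basis3 R 1 + x) (h 0 2%:R) (a 0 2%:R) (e / 3).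
have E0 (s t : R) : (t * s) *: basis3 R 0 + x = (t * s) *: basis3 R 0 + 0 *: basis3 R 1 + 0 *: basis3 R 2%:R + x.
  by rewrite !scale0r !addr0.
have {}I0 : `|f (h 0 0 *: basis3 R 0 + x) - f x - h 0 0 * a 0 0| <= e / 3 * `|h 0 0|.
  apply: I0 => t tt; apply: H; rewrite E0; apply: bx; rewrite ?z0//; exact: tm.
have {}I1 : `|f (h 0 1 *: basis3 R 1 + (h 0 0 *: basis3 R 0 + x)) - f (h 0 0 *: basis3 R 0 + x) - h 0 1 * a 0 1| <= e / 3 * `|h 0 1|.
  apply: I1 => t tt; apply: H.
  have -> : (t * h 0 1) *: basis3 R 1 + (h 0 0 *: basis3 R 0 + x) =
      h 0 0 *: basis3 R 0 + (t * h 0 1) *: basis3 R 1 + 0 *: basis3 R 2%:R + x.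
    by rewrite scale0r addr0 addrCA addrA.
  by apply: bx; rewrite ?z0//; exact: tm.
have {}I2 : `|f (h 0 2%:R *: basis3 R 2%:R + (h 0 0 *: basis3 R 0 + h 0 1 *: basis3 R 1 + x)) -
     f (h 0 0 *: basis3 R 0 + h 0 1 *: basis3 R 1 + x) - h 0 2%:R * a 0 2%:R| <= e / 3 * `|h 0 2%:R|.
  apply: I2 => t tt; apply: H.
  rewrite addrA (addrC _ (_ + _)).
  by apply: bx; rewrite //; exact: tm.
have hE : h 0 2%:R *: basis3 R 2%:R + (h 0 0 *: basis3 R 0 + h 0 1 *: basis3 R 1 + x) = h + x.
  rewrite addrA; congr (_ + x); apply/rowP => i; rewrite !mxE eqxx.
  case: i => [[|[|[|//]]] i3] /=; rewrite ?mulr1 ?mulr0 ?addr0 ?add0r; congr (h 0 _); exact/val_inj.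
rewrite hE in I2.
have aE : h 0 1 *: basis3 R 1 + (h 0 0 *: basis3 R 0 + x) = h 0 0 *: basis3 R 0 + h 0 1 *: basis3 R 1 + x.
  by rewrite addrCA addrA.
rewrite aE in I1.
rewrite dotE.
have c0 := coord_le_norm h 0; have c1 := coord_le_norm h 1; have c2 := coord_le_norm h 2%:R.
set A := f (h 0 0 *: basis3 R 0 + x) in I0 I1; set B := f (_ + _ + x) in I1 I2.
rewrite (_ : _ - _ = (A - f x - h 0 0 * a 0 0) + (B - A - h 0 1 * a 0 1) + (f (h + x) - B - h 0 2%:R * a 0 2%:R)); last ring.
apply: le_trans (ler_normD _ _) _.
apply: le_trans (lerD (ler_normD _ _) (lexx _)) _.
apply: le_trans (lerD (lerD I0 I1) I2) _.
rewrite -!mulrDr (_ : e * `|h| = e / 3 * (3 * `|h|)); last by field.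
rewrite ler_wpM2l ?(ltW e3)//.
rewrite (_ : 3 * `|h| = `|h| + `|h| + `|h|); last ring.
by rewrite !lerD.
Unshelve. all: by end_near. Qed.

(** A function constant along rays is homogeneous of degree 0, so its partial derivatives are
    homogeneous of degree -1. This carries information from the sphere to a neighbourhood in
    space. *)
Lemma radial_partial (F : 'rV[R]_3 -> R) y i : y != 0 ->
  derivable (fun z => F (normalize z)) (normalize y) (basis3 R i) ->
  is_derive y (basis3 R i) (fun z => F (normalize z)) ((enorm y)^-1 * sgrad F (normalize y) 0 i).
Proof.
move=> y0 /derivableP; set Fn := fun z => F (normalize z).
rewrite [sgrad _ _ _ _]mxE -/Fn => /is_derive_line dF.
have k0 := enorm_gt0 y0; set k := enorm y in k0 *.
apply/is_derive_line.
have dk : is_derive (0 : R) 1 (fun t : R => t * k^-1) k^-1.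
  by apply: is_derive_eq; rewrite /GRing.scale /=; ring.
rewrite -(mul0r k^-1) in dF.
have := @is_derive1_comp R _ (fun t : R => t * k^-1) 0 _ _ dF dk; rewrite mulrC.
congr is_derive; apply/funext => t; rewrite /= /Fn; congr F.
rewrite -[RHS](@normalizeZ _ k^-1) ?invr_gt0//; congr normalize.
by rewrite scalerDr scalerA mulrC.
Qed.

Section surface_gradient.
Variables (F : 'rV[R]_3 -> R) (G : 'rV[R]_3 -> 'rV[R]_3) (Gam C : set 'rV[R]_3) (x : 'rV[R]_3).
Hypothesis GamO : Gam `<=` @Omega R.
Hypothesis GamC : Gam `<=` C.
Hypothesis near_Gam : \forall y \near x, Gam (normalize y).
Hypothesis Gx : Gam x.
Hypothesis dF : forall y, Gam y -> sderivable F y.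
Hypothesis FG : forall y, Gam y -> G y = sgrad F y.
Hypothesis cG : forall i, {within C, continuous (fun y => G y 0 i)}.

Let x0 : x != 0.
Proof. exact/Omega_neq0/GamO. Qed.

Let near_n0 : \forall y \near x, y != 0.
Proof.
apply: filterS near_Gam => y /GamO/Omega_neq0; apply: contra => /eqP ->.
by rewrite /normalize scaler0.
Qed.

Let near_derive : \forall y \near x, forall i,
    is_derive y (basis3 R i) (fun z => F (normalize z)) ((enorm y)^-1 * G (normalize y) 0 i).
Proof.
near=> y => i.
have gy : Gam (normalize y) by near: y.
rewrite FG//; apply: radial_partial; first by near: y; exact: near_n0.
exact: dF.
Unshelve. all: by end_near. Qed.

(** Continuity within [C], a thin set in space, becomes continuity on a full neighbourhood after
    normalization, because points near x normalize into [Gam], hence into [C]. *)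
Lemma cvg_comp_normalize (g : 'rV[R]_3 -> R) : {within C, continuous g} ->
  g (normalize y) @[y --> x] --> g x.
Proof.
move=> cg; have Cx : C x by exact: GamC.
have gC : g y @[y --> within C (nbhs x)] --> g x.
  by have := cg x; rewrite /continuous_at /= nbhs_subspace_in.
have nC : normalize y @[y --> x] --> within C (nbhs x).
  move=> A; rewrite /within /= => CA.
  have nx : normalize x = x by apply/normalize_Omega/GamO.
  have nc : @normalize R y @[y --> x] --> x.
    by have := @continuous_normalize R x x0; rewrite /prop_for /continuous_at nx.
  have CA' := nc _ CA.
  have {}CA' : \forall y \near x, C (normalize y) -> A (normalize y) := CA'.
  suff : \forall y \near x, A (normalize y) by [].
  apply: filterS2 near_Gam CA' => y gy; apply; exact: GamC.
exact: (cvg_comp _ _ nC gC).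
Qed.

(** Near x the partial derivatives of the extension are |y|^-1 G (y / |y|), which is continuous at
    x. Differentiability is what allows the chain rule along arbitrary curves on the sphere. *)
Lemma sphere_differentiable : differentiable (fun z => F (normalize z)) x.
Proof.
apply: continuous_partials_differentiable.
  by apply: filterS near_derive => y H i; case: (H i).
move=> i; have nx : normalize x = x by apply/normalize_Omega/GamO.
have [_ De] := nbhs_singleton near_derive i.
have e : {near x, (fun y => (enorm y)^-1 * G (normalize y) 0 i) =1
      'D_(basis3 R i) (fun z => F (normalize z))}.
  by apply: filterS near_derive => y /(_ i)[_ ->].
rewrite /prop_for /continuous_at De; apply: cvg_trans (near_eq_cvg e) _.
apply: (@cvgM _ _ (nbhs x) _ (fun y => (enorm y)^-1) (fun y => G (normalize y) 0 i)); last first.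
  by rewrite nx; exact: (@cvg_comp_normalize (fun y => G y 0 i) (@cG i)).
by apply: (@cvgV _ _ (nbhs x)); [rewrite gt_eqF// enorm_gt0|exact: continuous_enorm].
Qed.

Lemma diff_sphere v : 'd (fun z => F (normalize z)) x v = dot (G x) v.
Proof. by rewrite diff_grad ?FG//; exact: sphere_differentiable. Qed.

Lemma is_derive_sphere_curve (c : R -> 'rV[R]_3) t (c' : 'rV[R]_3) :
  c t = x -> (forall s, Omega (c s)) -> is_derive t 1 c c' ->
  is_derive t 1 (fun s => F (c s)) (dot (G x) c').
Proof.
move=> ct cO dc; have := is_derive_curve ct sphere_differentiable dc.
rewrite diff_sphere; congr is_derive; apply/funext => s.
by rewrite normalize_Omega.
Qed.

(** The extension is constant along the ray through x, so its derivative in the direction x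
    vanishes. *)
Lemma sgrad_tangential : dot (G x) x = 0.
Proof.
have := is_derive_curve _ sphere_differentiable _.
move=> /(_ (fun h : R => h *: x + x) 0 x).
rewrite scale0r add0r diff_sphere => /(_ erefl).
have dc : is_derive (0 : R) 1 (fun h : R => h *: x + x) x.
  apply: is_derive_row => i; rewrite (_ : (fun s => _) = (fun s : R => s * x 0 i + x 0 i)).
    by apply: is_derive_eq; rewrite /GRing.scale /=; ring.
  by apply/funext => s; rewrite !mxE.
move=> /(_ dc)[_ <-].
rewrite (@near_eq_derive _ _ _ _ (cst (F (normalize x)))) ?derive_cst//.
have : \forall h \near (0 : R), -1 < h by exact: lt_nbhsr.
apply: filterS => h h1; rewrite -{2}[x]scale1r -scalerDl normalizeZ//; lra.
Qed.

End surface_gradient.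

End continuously_differentiable.

Lemma closure_sub_closed (T : topologicalType) (A B : set T) :
  closed B -> A `<=` B -> closure A `<=` B.
Proof. by move=> cB AB; rewrite closureE; exact: smallest_sub. Qed.

(** * Orthonormal frames of three-dimensional space *)

Section frames.
Context {R : realType}.
Implicit Types (a b c v w : 'rV[R]_3).

Lemma dot_sqrD v w : dot (v + w) (v + w) = dot v v + 2 * dot v w + dot w w.
Proof. by rewrite !dot_bilin (dotC w v); ring. Qed.

Lemma dot_sqrB v w : dot (v - w) (v - w) = dot v v - 2 * dot v w + dot w w.
Proof. by rewrite !dot_bilin (dotC w v); ring. Qed.

Lemma sum3E (F : 'I_3 -> R) : \sum_i F i = F 0 + F 1 + F 2%:R.
Proof.
rewrite !big_ord_recl big_ord0 addr0 addrA.
by congr (_ + _ + _); congr (F _); apply/val_inj.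
Qed.

(** For the square matrix M with rows a, b, c, M M^T = 1 implies M^T M = 1. *)
Lemma frame_completeness a b c i j : orthonormal_frame a b c ->
  a 0 i * a 0 j + b 0 i * b 0 j + c 0 i * c 0 j = (i == j)%:R.
Proof.
move=> [[/OmegaE a1 /OmegaE b1 /OmegaE c1] [ab ac bc]].
pose M : 'M[R]_3 := \matrix_(k, l) [:: a; b; c]`_k 0 l.
have MMT : M *m M^T = 1%:M.
  apply/matrixP => k l; rewrite !mxE.
  transitivity (dot ([:: a; b; c]`_k) ([:: a; b; c]`_l)).
    by apply: eq_bigr => m _; rewrite !mxE.
  case: k => [[|[|[|//]]] k3]; case: l => [[|[|[|//]]] l3] /=; rewrite ?a1 ?b1 ?c1 ?ab ?ac ?bc//.
  - by rewrite dotC ab.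
  - by rewrite dotC ac.
  - by rewrite dotC bc.
have := mulmx1C MMT => /matrixP/(_ i j); rewrite !mxE => <-.
by rewrite !big_ord_recl big_ord0 !mxE /= addr0 addrA.
Qed.

Lemma dot_frame a b c v w : orthonormal_frame a b c ->
  dot v w = dot v a * dot w a + dot v b * dot w b + dot v c * dot w c.
Proof.
move=> fr.
transitivity (\sum_i \sum_j v 0 i * w 0 j * (i == j)%:R).
  apply: eq_bigr => i _; rewrite (bigD1 i)//= eqxx mulr1 big1 ?addr0// => j ji.
  by rewrite eq_sym (negbTE ji) mulr0.
transitivity (\sum_i \sum_j v 0 i * w 0 j * (a 0 i * a 0 j + b 0 i * b 0 j + c 0 i * c 0 j)).
  by apply: eq_bigr => i _; apply: eq_bigr => j _; rewrite frame_completeness.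
by rewrite !sum3E !dotE; ring.
Qed.

Lemma frame_trace a b c (H : 'I_3 -> 'rV[R]_3) : orthonormal_frame a b c ->
  \sum_i (dot (H i) a * a 0 i + dot (H i) b * b 0 i + dot (H i) c * c 0 i) = \sum_i H i 0 i.
Proof.
move=> fr; apply: eq_bigr => i _; have := dot_frame (H i) (basis3 R i) fr.
by rewrite !(dotC (basis3 R i)) !dot_basis => ->.
Qed.

Definition cross v w : 'rV[R]_3 :=
  row3 (v 0 1 * w 0 2%:R - v 0 2%:R * w 0 1) (v 0 2%:R * w 0 0 - v 0 0 * w 0 2%:R)
       (v 0 0 * w 0 1 - v 0 1 * w 0 0).

Lemma dot_crossl v w : dot (cross v w) v = 0.
Proof. by rewrite dotE !mxE /=; ring. Qed.

Lemma dot_crossr v w : dot (cross v w) w = 0.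
Proof. by rewrite dotE !mxE /=; ring. Qed.

Lemma dot_cross2 v w : dot (cross v w) (cross v w) = dot v v * dot w w - dot v w ^+ 2.
Proof. by rewrite !dotE !mxE /=; ring. Qed.

End frames.

(** * The spherical cap and its outer normal *)

Section cap_geometry.
Context {R : realType}.
Variables (rho : R) (zeta : 'rV[R]_3).
Hypothesis hzeta : Omega zeta.
Hypothesis rho_gt0 : 0 < rho.
Hypothesis rho_lt2 : rho < 2.
Let c : R := 1 - rho.
Let s : R := Num.sqrt (1 - c ^+ 2).
Local Notation Gam := (cap rho zeta).

Lemma cap_height_lt1 : 0 < 1 - c ^+ 2.
Proof. by rewrite /c; move: rho_gt0 rho_lt2; nra. Qed.

Let s2 : s ^+ 2 = 1 - c ^+ 2.
Proof. by rewrite sqr_sqrtr// ltW// cap_height_lt1. Qed.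

Let s0 : 0 < s.
Proof. by rewrite sqrtr_gt0 cap_height_lt1. Qed.

Lemma cap_Omega : Gam `<=` @Omega R.
Proof. by move=> x []. Qed.

Lemma capE x : Gam x <-> Omega x /\ c < dot zeta x.
Proof. by rewrite /cap /= /c; split=> -[? ?]; split => //; lra. Qed.

Lemma near_cap x : Gam x -> \forall y \near x, Gam (normalize y).
Proof.
move=> /capE[xO cx]; have x0 := Omega_neq0 xO.
have nc := @continuous_normalize R x x0.
rewrite /prop_for /continuous_at normalize_Omega// in nc.
have dc : (fun y => dot zeta (normalize y)) @ nbhs x --> dot zeta x.
  exact: (@cvg_dot R _ (nbhs x) _ (fun=> zeta) _ zeta x (cvg_cst _) nc).
have n0 : \forall y \near x, 0 < enorm y.
  have /cvgrPdist_lt/(_ _ (enorm_gt0 x0)) := @continuous_enorm R x.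
  apply: filterS => y; rewrite ltr_distlC => /andP[+ _]; lra.
have d0 : 0 < dot zeta x - c by lra.
have /cvgrPdist_lt/(_ _ d0) := dc.
apply: filterS2 n0 => y y0; rewrite ltr_distlC => /andP[+ _] => h.
apply/capE; split; last lra.
apply: Omega_normalize; apply: contraTneq y0 => ->.
by rewrite /enorm (_ : dot 0 0 = 0) ?sqrtr0 ?ltxx// dotE !mxE; ring.
Qed.

Lemma closed_Omega : closed (@Omega R).
Proof.
rewrite (_ : @Omega R = (fun x : 'rV[R]_3 => dot x x) @^-1` [set x | x = 1]); last first.
  by apply/seteqP; split => x /= /OmegaE.
apply: preimage_closed => [x _|]; last exact: closed_eq.
exact: (@cvg_dot _ _ (nbhs x) _ id id x x cvg_id cvg_id).
Qed.

Lemma closed_cap_hull : closed [set x : 'rV[R]_3 | Omega x /\ c <= dot zeta x].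
Proof.
rewrite (_ : [set _ | _] = @Omega R `&` dot zeta @^-1` [set t | c <= t])//.
apply: closedI; first exact: closed_Omega.
apply: preimage_closed => [x _|]; last exact: closed_ge.
exact: continuous_dot.
Qed.

Lemma closure_cap_sub : closure Gam `<=` [set x | Omega x /\ c <= dot zeta x].
Proof.
apply: closure_sub_closed; first exact: closed_cap_hull.
by move=> x /capE[? /ltW ?]; split.
Qed.

(** At a boundary point, where zeta . eta = c, the tangential part of -zeta is c eta - zeta, and its
    length is s. *)
Definition cap_normal (eta : 'rV[R]_3) : 'rV[R]_3 := s^-1 *: (c *: eta - zeta).

Section boundary_point.
Variable eta : 'rV[R]_3.
Hypothesis eO : Omega eta.
Hypothesis eb : dot zeta eta = c.
Let nu := cap_normal eta.
Let sn : s != 0. Proof. by rewrite gt_eqF. Qed.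

Lemma cap_normal_unit : dot nu nu = 1.
Proof.
move/OmegaE: eO => e1; move/OmegaE: hzeta => z1.
rewrite /nu /cap_normal !dot_bilin (dotC eta zeta) eb e1 z1.
apply: (@mulfI _ (s ^+ 2)); first by rewrite expf_neq0.
rewrite mulr1 {2}s2; field.
by rewrite sn.
Qed.

Lemma cap_normal_tangent : dot nu eta = 0.
Proof.
by move/OmegaE: eO => e1; rewrite /nu /cap_normal !dot_bilin eb e1; ring.
Qed.

Lemma dot_zeta_cap_normal : dot zeta nu = - s.
Proof.
move/OmegaE: hzeta => z1; rewrite /nu /cap_normal !dot_bilin eb z1.
apply: (mulfI sn); rewrite mulVKf// mulrN -(expr2 s) s2; ring.
Qed.

Let dot_moved h : dot (eta + h *: nu) (eta + h *: nu) = 1 + h ^+ 2.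
Proof.
move/OmegaE: eO => e1.
have : forall n, dot n eta = 0 -> dot n n = 1 -> dot (eta + h *: n) (eta + h *: n) = 1 + h ^+ 2.
  by move=> n n1 n2; rewrite !dot_bilin (dotC eta n) n1 n2 e1; ring.
by apply; [exact: cap_normal_tangent|exact: cap_normal_unit].
Qed.

Let dot_zeta_moved h : dot zeta (normalize (eta + h *: nu)) = (c - h * s) / Num.sqrt (1 + h ^+ 2).
Proof.
rewrite /normalize /enorm dot_moved dotZr dotDr dotZr eb dot_zeta_cap_normal mulrC.
by congr (_ / _); ring.
Qed.

Let moved_neq0 h : eta + h *: nu != 0.
Proof.
apply/eqP => e; have := dot_moved h; rewrite e (_ : dot 0 0 = 0); last by rewrite dotE !mxE; ring.
have := sqr_ge0 h; lra.
Qed.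

(** Bounds the length of eta + h nu. To compare heights with c, [cap_inward] uses the lower bound
    for c <= 0 and the upper one for c > 0, and [cap_outward] the other way round; the quadratic
    error is absorbed by h s since h < s. *)
Let sqrt_bounds (h : R) : 1 <= Num.sqrt (1 + h ^+ 2) <= 1 + h ^+ 2 / 2.
Proof.
have h2 := sqr_ge0 h.
have q0 := sqrtr_ge0 (1 + h ^+ 2).
have q2 : Num.sqrt (1 + h ^+ 2) ^+ 2 = 1 + h ^+ 2 by rewrite sqr_sqrtr; lra.
move: (Num.sqrt _) q0 q2 => q q0 q2.
by apply/andP; split; nra.
Qed.

Let c_bounds : -1 < c < 1.
Proof. by rewrite /c; apply/andP; split; move: rho_gt0 rho_lt2; lra. Qed.

Lemma cap_inward h : 0 < h < s -> Gam (normalize (eta - h *: nu)).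
Proof.
move=> /andP[h0 hs]; rewrite -scaleNr; apply/capE; split; first exact: Omega_normalize.
rewrite dot_zeta_moved sqrrN; have /andP[q1 q2] := sqrt_bounds h; have /andP[c1 c2] := c_bounds.
move: (Num.sqrt _) q1 q2 => q q1 q2.
rewrite ltr_pdivlMr; last lra.
rewrite mulNr opprK; have [cn|cp] := leP c 0; nra.
Qed.

Lemma boundary_closure_cap : closure Gam eta.
Proof.
have mc : (fun h : R => normalize (eta - h *: nu)) @ 0^'+ --> eta.
  have c1 : (fun h : R => eta - h *: nu) @ 0^'+ --> eta.
    rewrite -[X in _ --> X](subr0 eta) -(scale0r nu).
    apply: cvgB; first exact: cvg_cst.
    by apply: cvg_at_right_filter; exact: scalel_continuous.
  have nn : {for eta, continuous (@normalize R)} by apply/continuous_normalize/Omega_neq0.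
  rewrite -{2}(normalize_Omega eO); exact: (cvg_comp _ _ c1 nn).
apply: (closed_cvg _ (@closed_closure _ _) _ _ mc).
near=> h; apply: subset_closure; apply: cap_inward; apply/andP; split; near: h.
  exact: nbhs_right_gt.
exact: nbhs_right_lt.
Unshelve. all: by end_near. Qed.

Lemma cap_outward h : 0 < h < s -> dot zeta (normalize (eta + h *: nu)) < c.
Proof.
move=> /andP[h0 hs].
rewrite dot_zeta_moved; have /andP[q1 q2] := sqrt_bounds h; have /andP[c1 c2] := c_bounds.
move: (Num.sqrt _) q1 q2 => q q1 q2.
rewrite ltr_pdivrMr; last lra.
have [cn|cp] := leP 0 c; nra.
Qed.

End boundary_point.

Lemma closure_capE : closure Gam = [set x | Omega x /\ c <= dot zeta x].
Proof.
apply/seteqP; split; first exact: closure_cap_sub.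
move=> x [xO]; rewrite le_eqVlt => /predU1P[/esym xb|cx].
  exact: boundary_closure_cap.
by apply: subset_closure; apply/capE.
Qed.

Lemma sboundary_capE : sboundary Gam = [set x | Omega x /\ dot zeta x = c].
Proof.
apply/seteqP; split => x.
  move=> [/closure_cap_sub[xO cx] xC]; split => //; apply/eqP; rewrite eq_le cx andbT.
  have : [set x : 'rV[R]_3 | dot zeta x <= c] x; last by [].
  apply: (closure_sub_closed _ _ xC) => [|y [yO /capE yN]] /=.
    rewrite (_ : [set _ | _] = dot zeta @^-1` [set t | t <= c])//.
    apply: preimage_closed => [y _|]; last exact: closed_le.
    exact: continuous_dot.
  by rewrite leNgt; apply/negP => cy; apply: yN.
move=> [xO xb]; split; first exact: boundary_closure_cap.
by apply: subset_closure; split => // /capE[_]; rewrite xb ltxx.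
Qed.

Lemma compact_closure_cap : compact (closure Gam).
Proof.
apply: bounded_closed_compact; last exact: closed_closure.
exists 1; split; first exact: num_real.
move=> M M1 x /closure_cap_sub[/OmegaE xO _]; apply: ltW; apply: norm_lt_coord; first lra.
move=> i; apply: le_lt_trans M1.
have : x 0 i ^+ 2 <= 1.
  rewrite -xO /dot (bigD1 i)//= expr2 lerDl sumr_ge0// => j _; nra.
by rewrite -[x in _ <= x -> _](expr1n _ 2) -real_normK ?num_real// ler_sqr ?nnegrE.
Qed.

Section outer_normal.
Variable eta : 'rV[R]_3.
Hypothesis eB : sboundary Gam eta.

Let eO : Omega eta. Proof. by move: eB; rewrite sboundary_capE => -[]. Qed.
Let eb : dot zeta eta = c. Proof. by move: eB; rewrite sboundary_capE => -[]. Qed.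
Let sn : s != 0. Proof. by rewrite gt_eqF. Qed.

(** A curve in the boundary circle keeps zeta . x and |x| constant. Differentiating both relations
    at 0 makes its velocity orthogonal to zeta and to eta, hence to the normal, which is a
    combination of these two. *)
Lemma cap_normal_outer : is_outer_normal Gam eta (cap_normal eta).
Proof.
split.
- by apply/OmegaE; exact: cap_normal_unit.
- exact: cap_normal_tangent.
- move=> cc cc0 /cvg_ex[/= l dl] nb.
  have -> : cc^`()%classic 0 = l.
    by apply: cvg_lim => //; move: dl; under eq_fun do rewrite scaler1.
  have {}dl : h^-1 *: (cc h - eta) @[h --> 0^'] --> l.
    by move: dl; under eq_fun do rewrite scaler1 addr0 cc0.
  (* Continuity at 0 is recovered from the difference quotient: c(h) is h times the quotient, plus
     eta. *)
  have cl : cc h @[h --> 0^'] --> eta.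
    have : h *: (h^-1 *: (cc h - eta)) + eta @[h --> 0^'] --> 0 *: l + eta.
      apply: cvgD; last exact: cvg_cst.
      by apply: cvgZ => //; apply: cvg_within_filter; exact: cvg_id.
    rewrite scale0r add0r; apply: cvg_trans; apply: near_eq_cvg.
    near=> h; rewrite scalerA divff ?scale1r ?subrK//.
    by near: h; exact: nbhs_dnbhs_neq.
  have nb' : \forall h \near 0^', Omega (cc h) /\ dot zeta (cc h) = c.
    by apply: nbhs_dnbhs; apply: filterS nb => h; rewrite sboundary_capE.
  have lim0 (f : R -> R) (z : R) : f h @[h --> 0^'] --> z -> (\forall h \near 0^', f h = 0) -> z = 0.
    move=> fz f0; have f0' : f h @[h --> 0^'] --> 0 by exact: cvg_near_cst.
    by apply: (cvg_unique _ fz f0').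
  have zl : dot zeta l = 0.
    apply: (lim0 (fun h => dot zeta (h^-1 *: (cc h - eta)))).
      by apply: cvg_dot => //; exact: cvg_cst.
    apply: filterS nb' => h [_ ch].
    by rewrite dotZr dotDr dotNr ch eb subrr mulr0.
  (* (c(h) + eta) . (c(h) - eta) = |c(h)|^2 - |eta|^2 = 0. *)
  have el : dot (eta + eta) l = 0.
    apply: (lim0 (fun h => dot (cc h + eta) (h^-1 *: (cc h - eta)))).
      by apply: cvg_dot => //; apply: cvgD => //; exact: cvg_cst.
    apply: filterS nb' => h [/OmegaE c1 _]; move/OmegaE: eO => e1.
    by rewrite !dot_bilin c1 e1 (dotC eta (cc h)); ring.
  rewrite dotDl in el; have {}el : dot eta l = 0 by lra.
  by rewrite /cap_normal !dot_bilin zl el; ring.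
- near=> h; split.
    apply: cap_inward => //; apply/andP; split; near: h; [exact: nbhs_right_gt|exact: nbhs_right_lt].
  move=> /closure_cap_sub[_]; apply/negP; rewrite -ltNge; apply: cap_outward => //.
  by apply/andP; split; near: h; [exact: nbhs_right_gt|exact: nbhs_right_lt].
Unshelve. all: by end_near. Qed.

(** A unit vector orthogonal to eta and to the tangent of the boundary circle is nu or -nu, and -nu
    is excluded because the great circle in that direction enters the cap. *)
Lemma outer_normal_cap : outer_normal Gam eta = cap_normal eta.
Proof.
rewrite /outer_normal; apply: xget_unique; first exact: cap_normal_outer.
move=> v [v1 ve vc vout].
set nu := cap_normal eta.
have e1 : dot eta eta = 1 by apply/OmegaE.
have z1 : dot zeta zeta = 1 by apply/OmegaE.
(* [t] is tangent to the boundary circle at eta, and [cc] below is that circle, obtained by rotating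
   eta about zeta. *)
pose t := cross zeta eta.
have tz : dot t zeta = 0 := dot_crossl _ _.
have te : dot t eta = 0 := dot_crossr _ _.
have tt : dot t t = s ^+ 2 by rewrite dot_cross2 e1 z1 eb s2; ring.
pose cc (h : R) := c *: zeta + cos h *: (eta - c *: zeta) + sin h *: t.
have cc0 : cc 0 = eta by rewrite /cc cos0 sin0 scale0r scale1r addr0 addrC subrK.
have dcc : is_derive (0 : R) 1 cc t.
  apply: is_derive_row => i.
  rewrite (_ : (fun _ => _) = (fun h : R => c * zeta 0 i + cos h * (eta 0 i - c * zeta 0 i) + sin h * t 0 i)); last first.
    by apply/funext => h; rewrite !mxE.
  by apply: is_derive_eq; rewrite sin0 cos0 /GRing.scale /=; ring.
have sb (h : R) : sboundary Gam (cc h).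
  rewrite sboundary_capE; split.
    apply/OmegaE; rewrite /cc !dot_bilin z1 e1 tt (dotC eta zeta) (dotC zeta t) (dotC eta t) tz te eb.
    transitivity (c ^+ 2 + (1 - c ^+ 2) * (cos h ^+ 2 + sin h ^+ 2)); first by rewrite s2; ring.
    by rewrite cos2Dsin2; ring.
  by rewrite /cc !dot_bilin z1 (dotC zeta t) tz eb; ring.
have vt : dot v t = 0.
  have <- : cc^`()%classic 0 = t by rewrite derive1E; case: dcc.
  apply: vc; [exact: cc0|by case: dcc|].
  exact: (@filterE _ (nbhs (0 : R)) _ _ sb).
have nu1 : dot nu nu = 1 by exact: cap_normal_unit.
have nue : dot nu eta = 0 by exact: cap_normal_tangent.
have nut : dot nu t = 0.
  by rewrite /nu /cap_normal !dot_bilin (dotC eta t) (dotC zeta t) tz te; ring.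
have fr : orthonormal_frame (s^-1 *: t) eta nu.
  split; split.
  - by apply/OmegaE; rewrite dotZl dotZr tt; field.
  - exact: eO.
  - exact/OmegaE.
  - by rewrite dotZl te mulr0.
  - by rewrite dotZl dotC nut mulr0.
  - by rewrite dotC nue.
have vv : dot v v = 1 by move/OmegaE : v1.
have := dot_frame v v fr; rewrite dotZr vt ve vv !mulr0 !add0r => vn.
have : (dot v nu - 1) * (dot v nu + 1) = 0 by nra.
move/eqP; rewrite mulf_eq0 => /orP[/eqP h1|/eqP h1].
  apply/subr0_eq/dot_eq0; rewrite dot_sqrB vv nu1; lra.
have vE : v = - nu.
  apply/eqP; rewrite -addr_eq0; apply/eqP/dot_eq0.
  rewrite dot_sqrD vv nu1; lra.
exfalso; near (0 : R)^'+ => h.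
have h0s : 0 < h < s by apply/andP; split; near: h; [exact: nbhs_right_gt|exact: nbhs_right_lt].
have : Gam (normalize (eta - h *: v)) /\ ~ closure Gam (normalize (eta + h *: v)) by near: h.
rewrite vE scalerN opprK => -[/capE[_ h2] _].
have := cap_outward eO eb h0s; rewrite -/nu; lra.
Unshelve. all: by end_near. Qed.

Lemma normal_derivativeE (F : 'rV[R]_3 -> R) (g : 'rV[R]_3) :
  (forall i, sgrad F x 0 i @[x --> within Gam (nbhs eta)] --> g 0 i) ->
  normal_derivative Gam F eta = dot (cap_normal eta) g.
Proof.
move=> H; have pf : ProperFilter (within Gam (nbhs eta)).
  by apply: within_nbhs_proper; case: eB.
rewrite /normal_derivative outer_normal_cap; apply: cvg_lim => //.
apply: cvg_dot; first exact: cvg_cst.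
exact: cvg_row.
Qed.

End outer_normal.

End cap_geometry.

(** * Rotation invariance of the surface integral *)

Section isometries_of_the_line.
Context {R : realType}.
Local Notation mu := (@lebesgue_measure R).
Local Open Scope ereal_scope.

Lemma lebesgue_measure_shift (a : R) (A : set R) : measurable A ->
  pushforward mu (fun x : measurableTypeR R => (x + a)%R : measurableTypeR R) A = mu A.
Proof.
move=> mA; have mf : measurable_fun setT (fun x : measurableTypeR R => (x + a)%R : measurableTypeR R).
  exact: measurable_funD.
pose f : {mfun _ >-> _} := HB.pack (fun x : measurableTypeR R => (x + a)%R : measurableTypeR R)
   (isMeasurableFun.Build _ _ _ _ _ mf).
rewrite -[LHS]/(pushforward mu f A).
apply/esym/lebesgue_measure_unique => //= _ [[b c]] _ <-.
rewrite /pushforward /f /= (_ : _ @^-1` _ = `](b - a)%R, (c - a)%R]%classic); last first.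
  by apply/seteqP; split => x /=; rewrite !in_itv/= ltrBlDr lerBrDr.
rewrite !lebesgue_measure_itv/= !lte_fin ltrD2r.
by case: ifPn => // _; rewrite -!EFinB; congr EFin; ring.
Qed.

Lemma ge0_integral_shift (a : R) (D : set R) (f : R -> \bar R) :
  measurable D -> measurable_fun setT f -> (forall x, 0 <= f x) ->
  \int[mu]_(x in D) f x = \int[mu]_(x in [set y | D (y + a)%R]) f (x + a)%R.
Proof.
move=> mD mf f0; have ma : measurable_fun setT (fun x : measurableTypeR R => (x + a)%R : measurableTypeR R).
  exact: measurable_funD.
rewrite -[RHS](@ge0_integral_pushforward _ _ _ _ _ _ ma mu D f)//; last exact: measurable_funTS.
by apply: eq_measure_integral => A mA _; exact/esym/(lebesgue_measure_shift a).
Qed.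

Lemma ge0_integral_reflect (D : set R) (f : R -> \bar R) :
  measurable D -> measurable_fun setT f -> (forall x, 0 <= f x) ->
  \int[mu]_(x in D) f x = \int[mu]_(x in [set y | D (- y)%R]) f (- x)%R.
Proof.
move=> mD mf f0.
rewrite -[RHS](@ge0_integral_pushforward _ _ (measurableTypeR R) (measurableTypeR R) _ (-%R : _ -> measurableTypeR R) _ mu D f)//; last exact: measurable_funTS.
by apply: eq_measure_integral => A mA _; exact/esym/lebesgue_measureN.
Qed.

End isometries_of_the_line.

(** * The substitution x = r cos phi for measurable integrands *)

Section cos_substitution.
Context {R : realType}.
Local Notation mu := (@lebesgue_measure R).
Variable r : R.
Hypothesis r0 : 0 < r.

Let E : set (measurableTypeR R * measurableTypeR R) :=
  [set p | [/\ 0 <= p.1, p.1 <= pi, 0 <= p.2 & p.2 <= r * sin p.1]].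

Lemma measurable_le_fun d (T : measurableType d) (f g : T -> R) :
  measurable_fun setT f -> measurable_fun setT g -> measurable [set x | f x <= g x].
Proof.
move=> mf mg; rewrite -[X in measurable X]setTI.
have := measurable_fun_ler mf mg measurableT (Y := [set true]) I.
by congr measurable; apply/seteqP; split => x [_ ?]; split.
Qed.

Lemma measurable_lt_fun d (T : measurableType d) (f g : T -> R) :
  measurable_fun setT f -> measurable_fun setT g -> measurable [set x | f x < g x].
Proof.
move=> mf mg; rewrite -[X in measurable X]setTI.
have := measurable_fun_ltr mf mg measurableT (Y := [set true]) I.
by congr measurable; apply/seteqP; split => x [_ ?]; split.
Qed.

Let msin : measurable_fun setT (@sin R).
Proof. by apply: continuous_measurable_fun; exact: continuous_sin. Qed.

Let mcos : measurable_fun setT (@cos R).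
Proof. by apply: continuous_measurable_fun; exact: continuous_cos. Qed.

Let mE : measurable E.
Proof.
have -> : E = [set p | 0 <= p.1] `&` [set p | p.1 <= pi] `&` [set p | 0 <= p.2]
   `&` [set p | p.2 <= r * sin p.1].
  by apply/seteqP; split => p /= => [[]|[[[]]]].
apply: measurableI; [apply: measurableI; [apply: measurableI|]|]; apply: measurable_le_fun => //.
by apply: measurable_funM => //; exact: measurableT_comp msin measurable_fst.
Qed.

(** The default 2 r lies outside [-r, r], so points outside [E] do not contribute to the image
    measure on that interval. *)
Let psi (p : measurableTypeR R * measurableTypeR R) : measurableTypeR R :=
  if p \in E then r * cos p.1 else 2 * r.

Let mpsi : measurable_fun setT psi.
Proof.
apply: measurable_fun_ifT => //.
  apply: (@measurable_fun_bool _ _ _ _ true); rewrite setTI.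
  rewrite [X in measurable X](_ : _ = E)//; apply/seteqP; split => p /=; [exact: set_mem|exact: mem_set].
by apply: measurable_funM => //; exact: measurableT_comp mcos measurable_fst.
Qed.

Let mI : measurable (`[- r, r]%classic : set (measurableTypeR R)).
Proof. exact: measurable_itv. Qed.

Let psiE p : E p -> psi p = r * cos p.1.
Proof. by move=> Ep; rewrite /psi mem_set. Qed.

Let psiNE p : ~ E p -> psi p = 2 * r.
Proof. by move=> Ep; rewrite /psi memNset. Qed.

Let psi_preim A : A `<=` `[- r, r]%classic -> psi @^-1` A = E `&` [set p | A (r * cos p.1)].
Proof.
move=> Ar; apply/seteqP; split => p /=; last by case=> Ep; rewrite psiE.
have [Ep|Ep] := pselect (E p); first by rewrite psiE.
rewrite psiNE// => /Ar /=; rewrite in_itv/= => /andP[_]; move: r0; lra.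
Qed.

Let push : set (measurableTypeR R) -> \bar R := pushforward (mu \x mu)%E psi.

(** The preimage of [b, r] is the region under r sin x over [0, acos (b / r)], whose area is r - r
    cos (acos (b / r)) = r - b. *)
Let push_half (b : R) : - r <= b <= r -> push `[b, r]%classic = (r - b)%:E.
Proof.
move=> /andP[rb br].
have b1 : -1 <= b / r <= 1.
  by rewrite ler_pdivlMr// ler_pdivrMr// mulN1r mul1r rb br.
have a0 := acos_ge0 b1; have api := acos_lepi b1.
have ca : cos (acos (b / r)) = b / r by rewrite acosK// in_itv.
rewrite /push /pushforward psi_preim; last first.
  by move=> x /=; rewrite !in_itv/= => /andP[bx ->]; rewrite (le_trans rb bx).
rewrite /product_measure1 /=.
have mono x : 0 <= x <= pi -> (b <= r * cos x) = (x <= acos (b / r)).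
  move=> xpi; rewrite mulrC -ler_pdivrMr// -[in LHS]ca.
  by rewrite !leNgt ltr_cos// in_itv/= a0 api.
rewrite (_ : (fun x => _) = (EFin \o (fun x => r * sin x)) \_ `[0, acos (b / r)]); last first.
  apply/funext => x /=; rewrite patchE.
  have xs : xsection (E `&` [set p | r * cos p.1 \in `[b, r]]) x =
      if x \in `[0, acos (b / r)]%R then `[0, r * sin x]%classic else set0.
    apply/seteqP; split => y; rewrite /xsection /= inE /=.
      move=> [[/= x0 xpi y0 yr]]; rewrite in_itv/= => /andP[bx _].
      by rewrite in_itv/= x0 -mono ?bx/= ?in_itv/= ?y0 ?yr// x0 xpi.
    case: ifPn => //; rewrite !in_itv/= => /andP[x0 xa] /andP[y0 yr].
    have xpi : 0 <= x <= pi by rewrite x0 (le_trans xa api).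
    split; first by split => //; case/andP: xpi.
    by rewrite mono// xa/= -[leRHS]mulr1 ler_pM2l// cos_le1.
  rewrite xs mem_setE; case: ifPn => xi; last by rewrite measure0.
  rewrite /= lebesgue_measure_itv/= lte_fin.
  have : 0 <= r * sin x.
    rewrite mulr_ge0 ?(ltW r0)// sin_ge0_pi//; move: xi; rewrite in_itv/= => /andP[-> /le_trans]; exact.
  rewrite le_eqVlt => /predU1P[<-|->]; first by rewrite ltxx.
  by rewrite -EFinB subr0.
rewrite -integral_mkcond.
(* In this case b = r; the fundamental theorem of calculus used afterwards needs an interval of
   positive length. *)
have [a00|a00] := eqVneq (acos (b / r)) 0%R.
  rewrite a00 set_itv1 integral_set1; move: ca; rewrite a00 cos0 => /eqP.
  by rewrite eq_sym -subr_eq0 => /eqP; rewrite -(mulfV (lt0r_neq0 r0)) -mulrBl => /eqP; rewrite mulf_eq0 invr_eq0 (gt_eqF r0) orbF subr_eq0 => /eqP ->; rewrite subrr.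
have ap : (0 < acos (b / r))%R by rewrite lt_neqAle a0 eq_sym a00.
rewrite (@continuous_FTC2 _ (fun x => r * sin x) (fun x => - r * cos x))//.
- by rewrite ca cos0 -EFinB; congr EFin; have := lt0r_neq0 r0; move=> ?; field.
- apply: continuous_subspaceT => x; apply: cvgM; [exact: cvg_cst|exact: continuous_sin].
- split.
  + by move=> x _; apply: derivableM => //; exact: ex_derive.
  + by apply: cvg_at_right_filter; apply: cvgM; [exact: cvg_cst|exact: continuous_cos].
  + by apply: cvg_at_left_filter; apply: cvgM; [exact: cvg_cst|exact: continuous_cos].
- move=> x _; rewrite derive1E; apply: derive_val.
  by apply: is_derive_eq; rewrite /GRing.scale /=; ring.
Qed.

Let m1 : {measure set (measurableTypeR R) -> \bar R} :=
  mrestr (measure_function_pushforward__canonical__measure_function_Measure (mu \x mu)%E mpsi) mI.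
Let m2 : {measure set (measurableTypeR R) -> \bar R} := mrestr mu mI.

Let m12 A : measurable A -> m1 A = m2 A.
Proof.
have half b : m1 `[b, +oo[%classic = m2 `[b, +oo[%classic.
  rewrite /m1 /m2 /= /mrestr.
  have [rb|br] := ltP r b.
    rewrite (_ : _ `&` _ = set0) ?measure0//; apply/seteqP; split => // x /=.
    by rewrite !in_itv/= andbT => -[bx /andP[_ xr]]; move: rb; lra.
  pose b' := Num.max b (- r).
  have b'r : - r <= b' <= r by rewrite /b' le_max lexx orbT ge_max br/=; move: r0; lra.
  rewrite (_ : _ `&` _ = `[b', r]%classic); last first.
    apply/seteqP; split => x /=; rewrite !in_itv/= andbT /b' ge_max.
      by move=> [-> /andP[-> ->]].
    by move=> /andP[/andP[-> ->] ->].
  rewrite -[LHS]/(push _) push_half// lebesgue_measure_itv/= lte_fin.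
  case/andP: b'r => _; rewrite le_eqVlt => /predU1P[->|->]; last by rewrite -EFinB.
  by rewrite ltxx subrr.
refine (@measure_unique _ R (measurableTypeR R) (@RGenCInfty.G R) (fun n => `[- n%:R, +oo[%classic)
  (RGenCInfty.measurableE R) _ _ _ m1 m2 _ _ A).
- move=> _ _ [x ->] [y ->]; exists (Num.max x y).
  by apply/seteqP; split => z /=; rewrite !in_itv/= !andbT ge_max => /andP.
- by move=> n; exists (- n%:R).
- apply/seteqP; split => // x _; exists (Num.truncn `|x|).+1 => //=.
  rewrite in_itv/= andbT lerNl.
  have := truncnS_gt `|x|; have := ler_norm (- x); rewrite normrN; lra.
- by move=> _ [x ->]; exact: half.
- move=> n; rewrite half /m2 /mrestr (@le_lt_trans _ _ (mu `[- r, r]%classic))//.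
    by apply: le_measure; rewrite ?inE /=; [exact: measurableI|exact: mI|exact: subIsetr].
  by rewrite lebesgue_measure_itv/=; case: ifPn => // _; rewrite -EFinB ltry.
Qed.

(* For a merely measurable k: the image of planar area on {0 <= y <= r sin x}
   under (x, y) |-> r cos x agrees with Lebesgue measure on half-lines. *)
Lemma integral_cos_substitution (k : measurableTypeR R -> \bar R) :
  measurable_fun setT k -> (forall x, 0 <= k x)%E ->
  (\int[mu]_(x in `[(- r)%R, r]) k x =
   \int[mu]_(x in `[0%R, pi]) (k (r * cos x)%R * (r * sin x)%:E))%E.
Proof.
move=> mk k0.
rewrite (@eq_measure_integral _ _ _ _ (pushforward (mu \x mu)%E psi)); last first.
  move=> A mA Ar; have := m12 mA.
  rewrite /m1 /m2 /mrestr /= => mE12.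
  by have := mE12; rewrite /mrestr (setIidl Ar) => ->.
rewrite (ge0_integral_pushforward mpsi)//; last exact: measurable_funTS.
rewrite psi_preim//.
rewrite (_ : E `&` _ = E); last first.
  apply/seteqP; split => [p []//|p Ep]; split => //=.
  by rewrite in_itv/=; have := cos_geN1 p.1; have := cos_le1 p.1; move: r0; nra.
rewrite integral_mkcond fubini_tonelli1; last 2 first.
- apply/(measurable_restrictT _ mE)/measurable_funTS.
  exact: measurableT_comp mk mpsi.
- by apply: erestrict_ge0 => p _; exact: k0.
rewrite [RHS]integral_mkcond; apply: eq_integral => x _.
rewrite /fubini_F patchE mem_setE.
have [xpi|xpi] := boolP (x \in `[0, pi]).
  rewrite (_ : (fun _ => _) = (cst (k (r * cos x))) \_ `[0, r * sin x]%classic); last first.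
    apply/funext => y; rewrite !patchE mem_setE /=.
    have [Ey|Ey] := pselect (E (x, y)).
      rewrite mem_set// psiE//=.
      by case: Ey => /= _ _ y0 ys; rewrite in_itv/= y0 ys.
    rewrite memNset// ifN//; apply: contra_notN Ey; rewrite in_itv/= => /andP[y0 ys].
    by split => //=; move: xpi; rewrite in_itv/= => /andP[].
  rewrite -integral_mkcond integral_cst//; congr (_ * _)%E.
  rewrite /= lebesgue_measure_itv/= lte_fin.
  have : 0 <= r * sin x.
    by rewrite mulr_ge0 ?(ltW r0)// sin_ge0_pi//; move: xpi; rewrite in_itv.
  rewrite le_eqVlt => /predU1P[<-|->]; first by rewrite ltxx.
  by rewrite -EFinB subr0.
rewrite integral0_eq// => y _; rewrite patchE memNset// => -[/= x0 xp _ _].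
by move: xpi; rewrite in_itv/= x0 xp.
Qed.

End cos_substitution.

(** * Symmetries of the integral over the sphere *)

Section sphere_integral.
Context {R : realType}.
Local Notation mu := (@lebesgue_measure R).
Implicit Types f : 'rV[R]_3 -> R.

(** Borel measurability of f read in coordinates, in the form used by Tonelli's theorem on products
    of lines. *)
Definition borel3 f := measurable_fun setT
  (fun p : (measurableTypeR R * measurableTypeR R) * measurableTypeR R => f (row3 p.1.1 p.1.2 p.2)).

Lemma borel3_comp d (T : measurableType d) f (A B C : T -> R) : borel3 f ->
  measurable_fun setT A -> measurable_fun setT B -> measurable_fun setT C ->
  measurable_fun setT (fun q => f (row3 (A q) (B q) (C q))).
Proof.
move=> bf mA mB mC.
exact: (measurableT_comp bf (measurable_fun_pair (measurable_fun_pair mA mB) mC)).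
Qed.

Lemma cos_2pi : cos (2 * pi) = 1 :> R.
Proof. by rewrite mulr_natl cos2pi. Qed.

Lemma sin_2pi : sin (2 * pi) = 0 :> R.
Proof. by rewrite mulr_natl sin2pi. Qed.

Lemma measurable_cos : measurable_fun setT (@cos R).
Proof. by apply: continuous_measurable_fun; exact: continuous_cos. Qed.

Lemma measurable_sin : measurable_fun setT (@sin R).
Proof. by apply: continuous_measurable_fun; exact: continuous_sin. Qed.

Lemma measurable_sqrt : measurable_fun setT (@Num.sqrt R).
Proof. by apply: continuous_measurable_fun; exact: sqrt_continuous. Qed.

Lemma measurable_inv : measurable_fun setT (fun x : R => x^-1).
Proof.
rewrite -(setUv [set 0 : R]); apply/measurable_funU => //; first exact: measurableC.
split; first exact: measurable_fun_set1.
apply: open_continuous_measurable_fun; first exact/closed_openC/accessible_closed_set1/hausdorff_accessible/Rhausdorff.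
by move=> x; rewrite inE /= => /eqP x0; exact: inv_continuous.
Qed.

Definition sphere_int f : \bar R :=
  (\int[mu]_(t in `[(-1)%R, 1%R]) \int[mu]_(phi in `[0%R, (2 * pi)%R])
     (f (sphere_point (t, phi)))%:E)%E.

(** Used for s = 1 and s = -1: the hemisphere where s y >= 0, on which (x, z) are coordinates. *)
Definition hemisphere_int (s : R) f : \bar R :=
  (\int[mu]_(t in `[(-1)%R, 1%R]) \int[mu]_(phi in `[0%R, pi])
     (f (row3 (Num.sqrt (1 - t ^+ 2) * cos phi) (s * (Num.sqrt (1 - t ^+ 2) * sin phi)) t))%:E)%E.

Lemma measurable_param d1 d2 (T1 : measurableType d1) (T2 : measurableType d2)
  (m : {sigma_finite_measure set T2 -> \bar R}) (D : set T2)  (g : T1 -> T2 -> R) :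
  measurable D -> measurable_fun setT (fun q : T1 * T2 => g q.1 q.2) ->
  (forall x y, 0 <= g x y) ->
  measurable_fun setT (fun x => \int[m]_(y in D) (g x y)%:E)%E.
Proof.
move=> mD mg g0.
have := @measurable_fun_fubini_tonelli_F _ _ T1 T2 R m
  ((fun q : T1 * T2 => (g q.1 q.2)%:E) \_ [set q | D q.2]).
have mD2 : measurable [set q : T1 * T2 | D q.2].
  by rewrite -[X in measurable X]setTI; exact: measurable_snd.
move=> /(_ _ _)/wrap[].
- by apply/(measurable_restrictT _ mD2)/measurable_funTS; apply/measurable_EFinP.
- by apply: erestrict_ge0 => q _; rewrite lee_fin.
rewrite /fubini_F; congr measurable_fun; apply/funext => x.
rewrite [RHS]integral_mkcond; apply: eq_integral => y _.
rewrite !patchE; have [Dy|Dy] := pselect (D y); first by rewrite !mem_set.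
by rewrite !memNset.
Qed.

(** Substitutes x = r cos phi, r being the radius of the parallel at height t, so that dphi becomes
    dx / |y|. Where the radicand is not positive, the conventions sqrt = 0 and 0^-1 = 0 kill the
    integrand, which extends the x-integral to the whole line. *)
Lemma integral_hemisphere_circle (s t : R) f : borel3 f -> (forall x, 0 <= f x) ->
  -1 < t < 1 ->
  (\int[mu]_(phi in `[0%R, pi])
     (f (row3 (Num.sqrt (1 - t ^+ 2) * cos phi) (s * (Num.sqrt (1 - t ^+ 2) * sin phi)) t))%:E =
   \int[mu]_x (f (row3 x (s * Num.sqrt (1 - t ^+ 2 - x ^+ 2)) t) *
      (Num.sqrt (1 - t ^+ 2 - x ^+ 2))^-1)%:E)%E.
Proof.
move=> bf f0 /andP[t1 t2]; set r := Num.sqrt (1 - t ^+ 2).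
have q0 : 0 < 1 - t ^+ 2 by nra.
have r0 : 0 < r by rewrite sqrtr_gt0.
have r2 : r ^+ 2 = 1 - t ^+ 2 by rewrite sqr_sqrtr// ltW.
pose k x := (f (row3 x (s * Num.sqrt (1 - t ^+ 2 - x ^+ 2)) t) *
      (Num.sqrt (1 - t ^+ 2 - x ^+ 2))^-1)%:E.
have mq : measurable_fun setT (fun x : R => Num.sqrt (1 - t ^+ 2 - x ^+ 2)).
  apply: (measurableT_comp measurable_sqrt).
  by apply: measurable_funB => //; exact: measurable_funX.
have mk : measurable_fun setT k.
  apply/measurable_EFinP; apply: measurable_funM.
    by apply: borel3_comp => //; exact: measurable_funM.
  exact: measurableT_comp measurable_inv mq.
have k0 x : (0 <= k x)%E by rewrite lee_fin mulr_ge0// invr_ge0 sqrtr_ge0.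
transitivity (\int[mu]_(x in `[(- r)%R, r]) k x)%E; last first.
  rewrite integral_mkcond; apply: eq_integral => x _; rewrite patchE mem_setE.
  case: ifPn => //; rewrite in_itv/= -ler_norml -ltNge => rx.
  rewrite /k (_ : Num.sqrt _ = 0) ?invr0 ?mulr0//.
  apply: ler0_sqrtr; rewrite -r2 subr_le0 -(real_normK (num_real x)).
  by rewrite lerXn2r ?nnegrE ?ltW// (le_lt_trans _ rx)// ltW.
rewrite integral_cos_substitution//.
rewrite integral_itv_bndoo; last first.
  apply: measurable_funTS; apply/measurable_EFinP; apply: borel3_comp => //.
    by apply: measurable_funM => //; exact: measurable_cos.
  by do 2 apply: measurable_funM => //; exact: measurable_sin.
rewrite [RHS]integral_itv_bndoo; last first.
  apply: measurable_funTS; apply: emeasurable_funM.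
    apply: (measurableT_comp mk).
    by apply: measurable_funM => //; exact: measurable_cos.
  by apply/measurable_EFinP; apply: measurable_funM => //; exact: measurable_sin.
apply: eq_integral => x; rewrite inE/= => xpi.
have s0 : 0 < r * sin x by rewrite mulr_gt0// sin_gt0_pi//; move: xpi; rewrite in_itv.
have E : Num.sqrt (1 - t ^+ 2 - (r * cos x) ^+ 2) = r * sin x.
  rewrite -r2 (_ : _ - _ = (r * sin x) ^+ 2) ?sqrtr_sqr ?gtr0_norm//.
  by rewrite [in RHS]exprMn sin2cos2; ring.
by rewrite /k E -EFinM mulfVK// gt_eqF.
Qed.

Lemma hemisphere_intE (s : R) f : borel3 f -> (forall x, 0 <= f x) ->
  (hemisphere_int s f =
   \int[mu]_t \int[mu]_x (f (row3 x (s * Num.sqrt (1 - t ^+ 2 - x ^+ 2)) t) *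
      (Num.sqrt (1 - t ^+ 2 - x ^+ 2))^-1)%:E)%E.
Proof.
move=> bf f0; rewrite /hemisphere_int.
rewrite integral_itv_bndoo; last first.
  apply/measurable_funTS/measurable_param => //.
  have m1 : measurable_fun setT (fun q : measurableTypeR R * measurableTypeR R => Num.sqrt (1 - q.1 ^+ 2)).
    apply: (measurableT_comp measurable_sqrt).
    by apply: measurable_funB => //; exact: measurable_funX.
  apply: borel3_comp => //; first by apply: measurable_funM => //; exact: measurableT_comp measurable_cos measurable_snd.
  by do 2 apply: measurable_funM => //; exact: measurableT_comp measurable_sin measurable_snd.
rewrite integral_mkcond; apply: eq_integral => t _; rewrite patchE mem_setE.
case: ifPn => [|]; rewrite in_itv/=.
  exact: integral_hemisphere_circle.
rewrite -ltr_norml -leNgt => t1; rewrite integral0_eq// => x _.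
rewrite (_ : Num.sqrt _ = 0) ?invr0 ?mulr0//.
apply: ler0_sqrtr; rewrite -(real_normK (num_real t)); have := sqr_ge0 x.
by move: (`|t|) t1 => u; nra.
Qed.

Definition swap_xz (x : 'rV[R]_3) : 'rV[R]_3 := row3 (x 0 2%:R) (x 0 1) (x 0 0).

Lemma row3E (a b c : R) : (row3 a b c 0 0 = a) * (row3 a b c 0 1 = b) * (row3 a b c 0 2%:R = c).
Proof. by rewrite !mxE. Qed.

Lemma borel3_swap f : borel3 f -> borel3 (f \o swap_xz).
Proof.
move=> bf; rewrite /borel3 /= /swap_xz.
under eq_fun do rewrite !row3E.
apply: borel3_comp => //.
- exact: measurableT_comp measurable_snd measurable_fst.
- exact: measurableT_comp measurable_fst measurable_fst.
Qed.

(** Both y and the density 1 / |y| are symmetric in x and z, so exchanging x and z in f only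
    exchanges the order of integration. *)
Lemma hemisphere_int_swap (s : R) f : borel3 f -> (forall x, 0 <= f x) ->
  hemisphere_int s (f \o swap_xz) = hemisphere_int s f.
Proof.
move=> bf f0; rewrite (hemisphere_intE s bf f0) (hemisphere_intE s (borel3_swap bf) (fun x => f0 _)).
pose g (q : measurableTypeR R * measurableTypeR R) : \bar R := (f (row3 q.1 (s * Num.sqrt (1 - q.1 ^+ 2 - q.2 ^+ 2)) q.2) *
      (Num.sqrt (1 - q.1 ^+ 2 - q.2 ^+ 2))^-1)%:E.
have mq : measurable_fun setT (fun q : measurableTypeR R * measurableTypeR R => Num.sqrt (1 - q.1 ^+ 2 - q.2 ^+ 2)).
  apply: (measurableT_comp measurable_sqrt).
  by apply: measurable_funB; [apply: measurable_funB => //|]; exact: measurable_funX.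
have mg : measurable_fun setT g.
  apply/measurable_EFinP; apply: measurable_funM.
    by apply: borel3_comp => //; exact: measurable_funM.
  exact: measurableT_comp measurable_inv mq.
have g0 x : (0 <= g x)%E by rewrite lee_fin mulr_ge0// invr_ge0 sqrtr_ge0.
transitivity (\int[mu]_t fubini_F mu g t)%E.
  by apply: eq_integral => t _; apply: eq_integral => x _; rewrite /= /swap_xz !row3E /g.
transitivity (\int[mu]_x fubini_G mu g x)%E; first exact: (fubini_tonelli g mg g0).
apply: eq_integral => t _; apply: eq_integral => x _; rewrite /g /=.
by rewrite (addrAC 1).
Qed.

Lemma measurable_height : measurable_fun setT
  (fun q : measurableTypeR R * measurableTypeR R => Num.sqrt (1 - q.1 ^+ 2)).
Proof.
apply: (measurableT_comp measurable_sqrt).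
by apply: measurable_funB => //; exact: measurable_funX.
Qed.

Lemma borel3_sphere_point f : borel3 f ->
  measurable_fun setT (fun q : measurableTypeR R * measurableTypeR R => f (sphere_point q)).
Proof.
move=> bf; rewrite /sphere_point; have m1 := measurable_height; apply: borel3_comp => //.
  by apply: measurable_funM => //; exact: measurableT_comp measurable_cos measurable_snd.
by apply: measurable_funM => //; exact: measurableT_comp measurable_sin measurable_snd.
Qed.

(** The reflection phi to 2 pi - phi maps the second half of each parallel to the first one and
    changes the sign of the sine. *)
Lemma sphere_int_hemisphere f : borel3 f -> (forall x, 0 <= f x) ->
  sphere_int f = (hemisphere_int 1 f + hemisphere_int (-1) f)%E.
Proof.
move=> bf f0; rewrite /sphere_int /hemisphere_int.
have m1 := measurable_height.
have mh (s : R) : measurable_fun setT (fun t : measurableTypeR R => \int[mu]_(phi in `[0%R, pi])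
     (f (row3 (Num.sqrt (1 - t ^+ 2) * cos phi) (s * (Num.sqrt (1 - t ^+ 2) * sin phi)) t))%:E)%E.
  apply: measurable_param => //.
  apply: borel3_comp => //; first by apply: measurable_funM => //; exact: measurableT_comp measurable_cos measurable_snd.
  by do 2 apply: measurable_funM => //; exact: measurableT_comp measurable_sin measurable_snd.
rewrite -ge0_integralD//=; first last.
- exact: measurable_funTS (mh (-1)).
- by move=> x _; apply: integral_ge0 => y _; rewrite lee_fin.
- exact: measurable_funTS (mh 1).
- by move=> x _; apply: integral_ge0 => y _; rewrite lee_fin.
apply: eq_integral => t _.
set g := fun phi : measurableTypeR R => (f (sphere_point (t, phi)))%:E.
have mg : measurable_fun setT g.
  apply/measurable_EFinP.
  exact: measurableT_comp (borel3_sphere_point bf) (measurable_pair1 t).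
have g0 x : (0 <= g x)%E by rewrite lee_fin.
have pp := @pi_gt0 R.
rewrite (_ : `[0%R, (2 * pi)%R]%classic = `[0%R, pi]%classic `|` `]pi, (2 * pi)%R]%classic); last first.
  apply/seteqP; split => x /=; rewrite !in_itv/=.
    by move=> /andP[x0 x2]; have [xp|px] := leP x pi; [left|right]; apply/andP; split.
  by case=> /andP[a b]; apply/andP; split; lra.
rewrite ge0_integral_setU//=; first last.
- apply/disj_setPS => x /=; rewrite !in_itv/= => -[/andP[_ a] /andP[b _]]; lra.
- by move=> x _; rewrite lee_fin.
- exact: measurable_funTS.
congr (_ + _)%E.
  by apply: eq_integral => x _; rewrite /g /sphere_point /= mul1r.
rewrite integral_itv_obnd_cbnd; last exact: measurable_funTS.
rewrite (ge0_integral_reflect _ mg)//.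
have mgN : measurable_fun setT (fun x : measurableTypeR R => g (- x)).
  by apply: (measurableT_comp mg); exact: measurable_funN.
rewrite (@ge0_integral_shift _ (- (2 * pi)) _ (fun x => g (- x)))//; last first.
  rewrite (_ : [set y | _] = `[(- (2 * pi))%R, (- pi)%R]%classic)//.
  by apply/seteqP; split => x /=; rewrite !in_itv/= => /andP[? ?]; apply/andP; split; lra.
rewrite (_ : [set y | _] = `[0%R, pi]%classic); last first.
  by apply/seteqP; split => x /=; rewrite !in_itv/= => /andP[? ?]; apply/andP; split; lra.
apply: eq_integral => x _; rewrite /g /sphere_point /=.
have -> : - (x - 2 * pi) = 2 * pi - x by ring.
rewrite cosB sinB cos_2pi sin_2pi; congr (f (row3 _ _ _))%:E; ring.
Qed.

Lemma sphere_int_swap f : borel3 f -> (forall x, 0 <= f x) ->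
  sphere_int (f \o swap_xz) = sphere_int f.
Proof.
move=> bf f0; rewrite (sphere_int_hemisphere (borel3_swap bf) (fun x => f0 _)).
by rewrite !hemisphere_int_swap// -sphere_int_hemisphere.
Qed.

Definition rot_z (b : R) (x : 'rV[R]_3) : 'rV[R]_3 :=
  row3 (cos b * x 0 0 - sin b * x 0 1) (sin b * x 0 0 + cos b * x 0 1) (x 0 2%:R).

Lemma rot_z_sphere_point b t phi :
  rot_z b (sphere_point (t, phi)) = sphere_point (t, phi + b).
Proof.
by rewrite /rot_z /sphere_point /= !row3E cosD sinD; congr row3; ring.
Qed.

Lemma borel3_rot_z b f : borel3 f -> borel3 (f \o rot_z b).
Proof.
move=> bf; rewrite /borel3 /= /rot_z.
under eq_fun do rewrite !row3E.
have m1 : measurable_fun setT (fun p : (measurableTypeR R * measurableTypeR R) * measurableTypeR R => p.1.1).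
  exact: measurableT_comp measurable_fst measurable_fst.
have m2 : measurable_fun setT (fun p : (measurableTypeR R * measurableTypeR R) * measurableTypeR R => p.1.2).
  exact: measurableT_comp measurable_snd measurable_fst.
by apply: borel3_comp => //; [apply: measurable_funB|apply: measurable_funD]; exact: measurable_funM.
Qed.

Lemma ge0_integral_period (b : R) (g : measurableTypeR R -> \bar R) :
  measurable_fun setT g -> (forall x, 0 <= g x)%E ->
  (forall x, g (x + 2 * pi) = g x) -> 0 <= b <= 2 * pi ->
  (\int[mu]_(x in `[0%R, (2 * pi)%R]) g (x + b)%R = \int[mu]_(x in `[0%R, (2 * pi)%R]) g x)%E.
Proof.
move=> mg g0 gp /andP[b0 b2]; have pp := @pi_gt0 R.
transitivity (\int[mu]_(x in `[b, (2 * pi + b)%R]) g x)%E.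
  rewrite [RHS](ge0_integral_shift b _ mg)//; congr (integral _ _ _).
  by apply/seteqP; split => x /=; rewrite !in_itv/= => /andP[? ?]; apply/andP; split; lra.
rewrite -integral_itv_obnd_cbnd; last exact: measurable_funTS.
rewrite -[RHS]integral_itv_obnd_cbnd; last exact: measurable_funTS.
have U (x y z : R) : (x <= y)%R -> (y <= z)%R ->
   (\int[mu]_(t in `]x, z]) g t = \int[mu]_(t in `]x, y]) g t + \int[mu]_(t in `]y, z]) g t)%E.
  move=> xy yz; rewrite -ge0_integral_setU//=.
  - congr (integral _ _ _); apply/seteqP; split => t /=; rewrite !in_itv/=.
      by move=> /andP[t0 t2]; have [xp|px] := leP t y; [left|right]; apply/andP; split.
    by case=> /andP[? ?]; apply/andP; split; lra.
  - exact: measurable_funTS.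
  - by apply/disj_setPS => t /=; rewrite !in_itv/= => -[/andP[_ ?] /andP[? _]]; lra.
rewrite (U b (2 * pi) (2 * pi + b))//; last lra.
rewrite (U 0 b (2 * pi))// addeC; congr (_ + _)%E.
rewrite (ge0_integral_shift (2 * pi) _ mg)//.
rewrite (_ : [set y | _] = `]0%R, b]%classic).
  by apply: eq_integral => x _; rewrite gp.
by apply/seteqP; split => x /=; rewrite !in_itv/= => /andP[? ?]; apply/andP; split; lra.
Qed.

Lemma sphere_int_rot_z b f : borel3 f -> (forall x, 0 <= f x) -> 0 <= b <= 2 * pi ->
  sphere_int (f \o rot_z b) = sphere_int f.
Proof.
move=> bf f0 bb; apply: eq_integral => t _ /=.
under eq_integral do rewrite rot_z_sphere_point.
apply: (@ge0_integral_period b (fun phi => (f (sphere_point (t, phi)))%:E)) => //.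
  apply/measurable_EFinP.
  exact: measurableT_comp (borel3_sphere_point bf) (measurable_pair1 t).
  by move=> x; rewrite lee_fin.
by move=> x; rewrite /sphere_point /= cosD sinD cos_2pi sin_2pi !mulr1 !mulr0 subr0 addr0.
Qed.

End sphere_integral.

(** * Integrals over a cap as integrals over parallel circles *)

Section cap_integral.
Context {R : realType}.
Local Notation mu := (@lebesgue_measure R).
Implicit Types (f : 'rV[R]_3 -> R).

Lemma polar_angle (x y r : R) : 0 <= r -> x ^+ 2 + y ^+ 2 = r ^+ 2 ->
  exists2 b, 0 <= b <= 2 * pi & x = r * cos b /\ y = r * sin b.
Proof.
rewrite le_eqVlt => /predU1P[<-|r0] xyr.
  have pp := @pi_gt0 R.
  exists 0; first by apply/andP; split; lra.
  by rewrite !mul0r; split; nra.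
have rn : r != 0 by rewrite gt_eqF.
have u1 : -1 <= x / r <= 1.
  by rewrite ler_pdivlMr// ler_pdivrMr// mulN1r mul1r; apply/andP; split; nra.
have xE : x = r * cos (acos (x / r)) by rewrite acosK ?in_itv//= mulrC divfK.
have yE : r * sin (acos (x / r)) = `|y|.
  rewrite sin_acos// -[LHS]ger0_norm; last by rewrite mulr_ge0 ?sqrtr_ge0// ltW.
  rewrite -[LHS]sqrtr_sqr -[RHS]sqrtr_sqr; congr Num.sqrt.
  rewrite exprMn sqr_sqrtr; last by move/andP: u1 => [? ?]; nra.
  rewrite mulrBr mulr1 -exprMn [_ * (x / r)]mulrC divfK//; lra.
have a0 := acos_ge0 u1; have api := acos_lepi u1.
have [y0|y0] := leP 0 y.
  exists (acos (x / r)); first by apply/andP; split; lra.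
  by split => //; rewrite yE ger0_norm.
exists (2 * pi - acos (x / r)); first by apply/andP; split; lra.
rewrite cosB sinB cos_2pi sin_2pi mul1r !mul0r addr0 sub0r; split => //.
by rewrite mul1r mulrN yE ltr0_norm// opprK.
Qed.

Definition circle (e1 e2 zeta : 'rV[R]_3) (t phi : R) : 'rV[R]_3 :=
  t *: zeta + Num.sqrt (1 - t ^+ 2) *: (cos phi *: e1 + sin phi *: e2).

(* Rotations about the z-axis and the reflection x <-> z generate enough
   isometries to move zeta to the north pole. *)
Lemma sphere_int_frame (zeta : 'rV[R]_3) : Omega zeta ->
  exists e1 e2, orthonormal_frame e1 e2 zeta /\
  forall f, borel3 f -> (forall x, 0 <= f x) ->
  (sphere_int f = \int[mu]_(t in `[(-1)%R, 1%R]) \int[mu]_(phi in `[0%R, (2 * pi)%R])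
     (f (circle e1 e2 zeta t phi))%:E)%E.
Proof.
move=> /OmegaE; rewrite dotE; set a := zeta 0 0; set b := zeta 0 1; set c := zeta 0 2%:R => abc.
have c1 : -1 <= c <= 1 by apply/andP; split; nra.
pose al := acos c.
have ca : cos al = c by rewrite acosK.
have sa : sin al = Num.sqrt (1 - c ^+ 2) by rewrite sin_acos.
have sa0 : 0 <= sin al by rewrite sa sqrtr_ge0.
have al2 : 0 <= al <= 2 * pi.
  by have := acos_ge0 c1; have := acos_lepi c1; rewrite -/al => ? ?; apply/andP; split; lra.
(* The composite [M] of the four isometries sends the north pole to (- sin al sin be, sin al cos be,
   cos al). Equating this with zeta makes al its colatitude and be the polar angle of (b, -a). *)
have abr : b ^+ 2 + (- a) ^+ 2 = sin al ^+ 2.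
  by rewrite sa sqr_sqrtr; [lra|move/andP: c1 => [? ?]; nra].
have [be be2 [bE aE]] := polar_angle sa0 abr.
pose e1 : 'rV[R]_3 := row3 (cos be) (sin be) 0.
pose e2 : 'rV[R]_3 := row3 (- cos al * sin be) (cos al * cos be) (- sin al).
have zE : zeta = row3 (- (sin al * sin be)) (sin al * cos be) (cos al).
  apply/rowP => i; rewrite !mxE.
  case: i => [[|[|[|//]]] i3] /=; [rewrite -aE opprK|rewrite -bE|rewrite ca];
    by congr (zeta 0 _); apply/val_inj.
have M f x : ((((f \o rot_z be) \o swap_xz) \o rot_z al) \o swap_xz) x =
    f (x 0 0 *: e1 + x 0 1 *: e2 + x 0 2%:R *: zeta).
  rewrite /= zE; congr f; apply/rowP => i; rewrite !mxE /=.
  case: i => [[|[|[|//]]] i3] /=; ring.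
have ce := cos2Dsin2 be; have ca2 := cos2Dsin2 al.
exists e1, e2; split.
  split; [split|split]; [apply/OmegaE|apply/OmegaE|apply/OmegaE|..]; rewrite dotE ?zE !row3E.
  - nra.
  - transitivity (cos al ^+ 2 * (cos be ^+ 2 + sin be ^+ 2) + sin al ^+ 2); first ring.
    by rewrite ce mulr1.
  - transitivity (sin al ^+ 2 * (cos be ^+ 2 + sin be ^+ 2) + cos al ^+ 2); first ring.
    by rewrite ce mulr1 addrC.
  - ring.
  - ring.
  - transitivity (cos al * sin al * (cos be ^+ 2 + sin be ^+ 2) - sin al * cos al); first ring.
    by rewrite ce mulr1 mulrC subrr.
move=> f bf f0.
rewrite -(sphere_int_rot_z bf f0 be2).
have bf1 := borel3_rot_z be bf.
rewrite -(sphere_int_swap bf1); last by move=> x; exact: f0.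
have bf2 := borel3_swap bf1.
rewrite -(sphere_int_rot_z bf2 _ al2); last by move=> x; exact: f0.
have bf3 := borel3_rot_z al bf2.
rewrite -(sphere_int_swap bf3); last by move=> x; exact: f0.
apply: eq_integral => t _; apply: eq_integral => phi _.
rewrite M /sphere_point /= !row3E /circle; congr (f _)%:E.
by rewrite scalerDr !scalerA addrC.
Qed.

(** An open set is the union of the boxes with rational centre and radius 1 / (n + 1) that it
    contains, a countable family of measurable sets. *)
Lemma open_measurable3 (V : set 'rV[R]_3) : open V ->
  measurable [set p : (measurableTypeR R * measurableTypeR R) * measurableTypeR R |
     V (row3 p.1.1 p.1.2 p.2)].
Proof.
move=> oV.
pose box (q : rat * rat * rat * nat) : set ((measurableTypeR R * measurableTypeR R) * measurableTypeR R) :=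
  [set p | [/\ `|p.1.1 - ratr q.1.1.1| < q.2.+1%:R^-1, `|p.1.2 - ratr q.1.1.2| < q.2.+1%:R^-1
    & `|p.2 - ratr q.1.2| < q.2.+1%:R^-1]].
pose good q := box q `<=` [set p | V (row3 p.1.1 p.1.2 p.2)].
pose B q := if `[< good q >] then box q else set0.
have -> : [set p | V (row3 p.1.1 p.1.2 p.2)] = \bigcup_q B q.
  apply/seteqP; split => [p Vp|p [q _]]; last first.
    by rewrite /B; case: asboolP => // gq; exact: gq.
  have [e /= e0 eV] : exists2 e : R, 0 < e & ball (row3 p.1.1 p.1.2 p.2) e `<=` V.
    by apply/nbhs_ballP/open_nbhs_nbhs.
  (* Half the radius suffices: two points of a box are each within 1 / (n + 1) of its centre. *)
  have [n ne] : exists n : nat, n.+1%:R^-1 < e / 2.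
    exists (Num.truncn (e / 2)^-1).
    rewrite invf_plt ?posrE ?divr_gt0//; exact: truncnS_gt.
  have dn : 0 < n.+1%:R^-1 :> R by rewrite invr_gt0 ltr0n.
  have ex (x : R) : exists q : rat, `|x - ratr q| < n.+1%:R^-1.
    have xn : x - n.+1%:R^-1 < x + n.+1%:R^-1 by rewrite ltrD2l gt0_cp.
    have [q] := rat_in_itvoo xn.
    rewrite in_itv/= => /andP[h1 h2]; by exists q; rewrite ltr_distlC h1 h2.
  have [q1 h1] := ex p.1.1; have [q2 h2] := ex p.1.2; have [q3 h3] := ex p.2.
  exists (q1, q2, q3, n) => //; rewrite /B asboolT//= => p' [/= k1 k2 k3].
  have tri (x y z d : R) : d < e / 2 -> `|x - z| < d -> `|y - z| < d -> `|x - y| < e.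
    move=> de xz yz; rewrite (_ : x - y = (x - z) - (y - z)); last ring.
    by apply: le_lt_trans (ler_normB _ _) _; lra.
  apply: eV; rewrite -ball_normE /ball_ /=.
  rewrite {1}/Num.Def.normr/= mx_normrE.
  apply/bigmax_ltP; split => // -[i j] _ /=.
  rewrite !mxE; case: j => [[|[|[|//]]] j3] /=.
  - exact: tri ne h1 k1.
  - exact: tri ne h2 k2.
  - exact: tri ne h3 k3.
apply: countable_bigcupT_measurable; first exact: countableP.
move=> q; rewrite /B; case: asboolP => // _.
have -> : box q = [set p | `|p.1.1 - ratr q.1.1.1| < q.2.+1%:R^-1] `&`
   [set p | `|p.1.2 - ratr q.1.1.2| < q.2.+1%:R^-1] `&` [set p | `|p.2 - ratr q.1.2| < q.2.+1%:R^-1].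
  by apply/seteqP; split => p /= => [[]|[[]]].
have mA d (T : measurableType d) (g : T -> R) (y z : R) : measurable_fun setT g ->
    measurable [set p | `|g p - y| < z].
  move=> mg; apply: measurable_lt_fun => //.
  by apply: measurableT_comp => //; exact: measurable_funB.
apply: measurableI; [apply: measurableI|]; apply: mA => //.
- exact: measurableT_comp measurable_fst measurable_fst.
- exact: measurableT_comp measurable_snd measurable_fst.
Qed.

(** A relatively open preimage is the trace on C of an open set of the space, and open sets are
    measurable in coordinates. *)
Lemma borel3_restrict (A C : set 'rV[R]_3) f : {within C, continuous f} -> A `<=` C ->
  measurable [set p : (measurableTypeR R * measurableTypeR R) * measurableTypeR R |
     A (row3 p.1.1 p.1.2 p.2)] ->
  borel3 (f \_ A).
Proof.
move=> cf AC mA; rewrite /borel3.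
set D := [set p | _] in mA.
rewrite (_ : (fun p => _) = (fun p : measurableTypeR R * measurableTypeR R * measurableTypeR R => f (row3 p.1.1 p.1.2 p.2)) \_ D); last first.
  apply/funext => p; rewrite !patchE; have [Ap|Ap] := pselect (A (row3 p.1.1 p.1.2 p.2)).
    by rewrite !mem_set.
  by rewrite !memNset.
apply/(measurable_restrictT _ mA).
apply: (measurability _ (RGenOpens.measurableE R)) => //.
move=> _ [_ [a [b ->]] <-].
have oab : open `]a, b[%classic by exact: interval_open.
move/continuousP: cf => /(_ _ oab).
move=> /open_subspaceP[V oV VE].
have mV := open_measurable3 oV.
rewrite (_ : _ `&` _ = D `&` [set p : (measurableTypeR R * measurableTypeR R) * measurableTypeR R | V (row3 p.1.1 p.1.2 p.2)]).
  exact: measurableI.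
apply/seteqP; split => p /= [Dp].
  move=> fp; split => //.
  have : (V `&` C) (row3 p.1.1 p.1.2 p.2) by rewrite VE; split => //; exact: AC.
  by case.
move=> Vp; split => //.
have : (V `&` C) (row3 p.1.1 p.1.2 p.2) by split => //; exact: AC.
by rewrite VE => -[].
Qed.

Lemma measurable_cap (rho : R) (zeta : 'rV[R]_3) :
  measurable [set p : (measurableTypeR R * measurableTypeR R) * measurableTypeR R |
     cap rho zeta (row3 p.1.1 p.1.2 p.2)].
Proof.
have -> : [set p : measurableTypeR R * measurableTypeR R * measurableTypeR R | cap rho zeta (row3 p.1.1 p.1.2 p.2)] =
  ~` ([set p | (~` [set x : 'rV[R]_3 | dot x x = 1]) (row3 p.1.1 p.1.2 p.2)]) `&`
  [set p | [set x : 'rV[R]_3 | 1 - dot zeta x < rho] (row3 p.1.1 p.1.2 p.2)].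
  apply/seteqP; split => p /=; first by move=> [/OmegaE H ?]; split => // /(_ H).
  by move=> [/contrapT /OmegaE].
apply: measurableI; [apply: measurableC|]; apply: open_measurable3.
  apply: closed_openC; rewrite (_ : [set _ | _] = (fun x : 'rV[R]_3 => dot x x) @^-1` [set x | x = 1])//.
  apply: preimage_closed => [x _|]; last exact: closed_eq.
  exact: (@cvg_dot _ _ (nbhs x) _ id id x x cvg_id cvg_id).
rewrite (_ : [set _ | _] = dot zeta @^-1` [set x | 1 - rho < x]); last first.
  by apply/seteqP; split => x /=; lra.
apply: open_comp => [x _|]; last exact: open_gt.
exact: continuous_dot.
Qed.

Lemma circle_Omega (e1 e2 zeta : 'rV[R]_3) t phi : orthonormal_frame e1 e2 zeta ->
  -1 <= t <= 1 -> Omega (circle e1 e2 zeta t phi).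
Proof.
move=> [[/OmegaE h1 /OmegaE h2 /OmegaE h3] [h12 h13 h23]] /andP[t1 t2]; apply/OmegaE.
rewrite /circle; set r := Num.sqrt _.
have r2 : r ^+ 2 = 1 - t ^+ 2 by rewrite sqr_sqrtr//; nra.
rewrite !dot_bilin (dotC e2 e1) (dotC zeta e1) (dotC zeta e2) h1 h2 h3 h12 h13 h23.
transitivity (t ^+ 2 + r ^+ 2 * (cos phi ^+ 2 + sin phi ^+ 2)); first ring.
by rewrite cos2Dsin2 r2; ring.
Qed.

Lemma dot_circle (e1 e2 zeta : 'rV[R]_3) t phi : orthonormal_frame e1 e2 zeta ->
  dot zeta (circle e1 e2 zeta t phi) = t.
Proof.
move=> [[/OmegaE h1 /OmegaE h2 /OmegaE h3] [h12 h13 h23]].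
by rewrite /circle !dot_bilin (dotC zeta e1) (dotC zeta e2) h3 h13 h23; ring.
Qed.

Definition chart_domain (Gam : set 'rV[R]_3) : set (measurableTypeR R * measurableTypeR R) :=
  [set p | [/\ -1 <= p.1 <= 1, 0 <= p.2 <= 2 * pi & Gam (sphere_point p)]].

Definition chart_box : set (measurableTypeR R * measurableTypeR R) :=
  [set p | -1 <= p.1 <= 1 /\ 0 <= p.2 <= 2 * pi].

Lemma measurable_chart_box : measurable chart_box.
Proof.
have -> : chart_box = ([set p | -1 <= p.1] `&` [set p | p.1 <= 1]) `&`
    ([set p | 0 <= p.2] `&` [set p | p.2 <= 2 * pi]).
  apply/seteqP; split => p /=; first by move=> [/andP[? ?] /andP[? ?]].
  by move=> [[? ?] [? ?]]; split; apply/andP.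
by apply: measurableI; apply: measurableI; exact: measurable_le_fun.
Qed.

Lemma measurable_chart_domain rho (zeta : 'rV[R]_3) : measurable (chart_domain (cap rho zeta)).
Proof.
have -> : chart_domain (cap rho zeta) = chart_box `&` [set p | cap rho zeta (sphere_point p)].
  by apply/seteqP; split => p /= => [[]|[[]]].
apply: measurableI; first exact: measurable_chart_box.
have m1 := @measurable_height R.
have := measurable_fun_pair (measurable_fun_pair
  (measurable_funM m1 (measurableT_comp (@measurable_cos R) (@measurable_snd _ _ (measurableTypeR R) (measurableTypeR R))))
  (measurable_funM m1 (measurableT_comp (@measurable_sin R) (@measurable_snd _ _ (measurableTypeR R) (measurableTypeR R)))))
   (@measurable_fst _ _ (measurableTypeR R) (measurableTypeR R)).
by move=> /(_ measurableT _ (measurable_cap rho zeta)); rewrite setTI.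
Qed.

(** In the coordinates (t, phi) about zeta the cap is 1 - rho < t <= 1 and the measure is dt dphi;
    if each parallel circle has mean V, only the height rho and the angle 2 pi remain as factors. *)
Lemma ge0_cap_integral rho (zeta : 'rV[R]_3) f (V : R) :
  Omega zeta -> 0 < rho < 2 -> borel3 (f \_ (cap rho zeta)) ->
  (forall x, cap rho zeta x -> 0 <= f x) ->
  (forall e1 e2, orthonormal_frame e1 e2 zeta -> forall t, 1 - rho < t < 1 ->
   (\int[mu]_(phi in `[0%R, (2 * pi)%R]) (f (circle e1 e2 zeta t phi))%:E = (2 * pi * V)%:E)%E) ->
  (\int[(mu \x mu)%E]_(p in chart_domain (cap rho zeta)) (f (sphere_point p))%:E
     = (2 * pi * rho * V)%:E)%E.
Proof.
move=> zO /andP[r0 r2] bf f0 mean; set Gam := cap rho zeta; set h := f \_ Gam.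
have h0 x : 0 <= h x.
  by rewrite /h patchE; case: ifPn => //; rewrite inE; exact: f0.
have mB := measurable_chart_box; set B := chart_box in mB.
have mh := borel3_sphere_point bf.
transitivity (sphere_int h).
  transitivity (\int[(mu \x mu)%E]_p (((fun p => (h (sphere_point p))%:E) \_ B) p))%E.
    rewrite integral_mkcond; apply: eq_integral => p _; rewrite !patchE.
    have [[p1 p2 Gp]|nD] := pselect (chart_domain Gam p).
      by rewrite mem_set// mem_set// /h patchE mem_set.
    rewrite memNset//; have [[p1 p2]|nB] := pselect (B p); last by rewrite memNset.
    rewrite mem_set// /h patchE memNset// => Gp.
    by apply: nD; split.
  rewrite fubini_tonelli1; last 2 first.
  - by apply/(measurable_restrictT _ mB)/measurable_funTS/measurable_EFinP.
  - by apply: erestrict_ge0 => p _; rewrite lee_fin.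
  rewrite /sphere_int [RHS]integral_mkcond; apply: eq_integral => t _.
  rewrite patchE mem_setE; case: ifPn; rewrite in_itv/= => tI; last first.
    by rewrite /fubini_F integral0_eq// => phi _; rewrite patchE memNset// => -[/= tI' _]; rewrite tI' in tI.
  rewrite /fubini_F [RHS]integral_mkcond; apply: eq_integral => phi _.
  rewrite !patchE mem_setE in_itv/=; have [pp|pp] := boolP (0 <= phi <= 2 * pi).
    by rewrite mem_set.
  by rewrite memNset// => -[_ /=]; rewrite (negbTE pp).
have [e1 [e2 [fr inv]]] := sphere_int_frame zO.
rewrite inv//.
have mc : measurable_fun setT (fun t : measurableTypeR R =>
    \int[mu]_(phi in `[0%R, (2 * pi)%R]) (h (circle e1 e2 zeta t phi))%:E)%E.
  apply: measurable_param => //.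
  rewrite (_ : (fun q => _) = (fun q => h (row3 (circle e1 e2 zeta q.1 q.2 0 0)
    (circle e1 e2 zeta q.1 q.2 0 1) (circle e1 e2 zeta q.1 q.2 0 2%:R)))); last first.
    apply/funext => q; congr h; apply/rowP => i; rewrite [RHS]mxE.
    by case: i => [[|[|[|//]]] i3] /=; congr (circle _ _ _ _ _ 0 _); apply/val_inj.
  have m1 := @measurable_height R.
  have mi (i : 'I_3) : measurable_fun setT (fun q : measurableTypeR R * measurableTypeR R => circle e1 e2 zeta q.1 q.2 0 i).
    under eq_fun do rewrite /circle !mxE.
    apply: measurable_funD; first exact: measurable_funM.
    apply: measurable_funM => //.
    apply: measurable_funD; apply: measurable_funM => //.
      exact: measurableT_comp (@measurable_cos R) measurable_snd.
    exact: measurableT_comp (@measurable_sin R) measurable_snd.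
  exact: borel3_comp.
rewrite integral_itv_bndoo; last exact: measurable_funTS.
rewrite (_ : (\int[mu]_(t in _) _)%E = (\int[mu]_(t in `](1 - rho)%R, 1%R[) (cst (2 * pi * V)%:E t))%E).
  rewrite integral_cst//= lebesgue_measure_itv/= lte_fin ifT; last lra.
  by rewrite -EFinB -EFinM; congr EFin; ring.
rewrite [LHS]integral_mkcond [RHS]integral_mkcond; apply: eq_integral => t _.
rewrite !patchE !mem_setE !in_itv/=.
case: ifPn => [/andP[t1 t2]|/negP t1]; last by rewrite ifN//; apply/negP => /andP[? ?]; apply: t1; apply/andP; split; lra.
have t11 : -1 <= t <= 1 by rewrite !ltW.
case: ifPn => tr.
  rewrite -(mean _ _ fr t tr); apply: eq_integral => phi _; congr EFin.
  rewrite /h patchE mem_set//; split; first exact: circle_Omega.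
  by rewrite (dot_circle _ _ fr); case/andP: tr => ? ?; lra.
rewrite integral0_eq// => phi _; rewrite /h patchE memNset// => -[_].
rewrite (dot_circle _ _ fr) => ?; move/negP: tr; apply; apply/andP; split; lra.
Qed.

Lemma lebesgue_circle : mu `[0%R, (2 * pi)%R]%classic = (2 * pi)%:E :> \bar R.
Proof.
by rewrite lebesgue_measure_itv/= lte_fin mulr_gt0// ?pi_gt0// -EFinB subr0.
Qed.

(** The sign condition of [ge0_cap_integral] is met by f + M and by M; subtracting the two integrals
    requires that [K] provide integrability along with the value. *)
Lemma cap_surface_integral rho (zeta : 'rV[R]_3) f (M V : R) :
  Omega zeta -> 0 < rho < 2 -> {within closure (cap rho zeta), continuous f} ->
  (forall x, cap rho zeta x -> `|f x| <= M) ->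
  (forall e1 e2, orthonormal_frame e1 e2 zeta -> forall t, 1 - rho < t < 1 ->
   mu.-integrable `[0, 2 * pi] (EFin \o (fun phi => f (circle e1 e2 zeta t phi))) /\
   \int[mu]_(phi in `[0, 2 * pi]) f (circle e1 e2 zeta t phi) = 2 * pi * V) ->
  surface_integral (cap rho zeta) f = 2 * pi * rho * V.
Proof.
move=> zO r02 cf fM mean.
have M0 : 0 <= M.
  by apply: le_trans (fM zeta _) => //; split => //; move/OmegaE: zO => ->; rewrite subrr; case/andP: r02.
have K (g : 'rV[R]_3 -> R) (W : R) : {within closure (cap rho zeta), continuous g} ->
    (forall x, cap rho zeta x -> 0 <= g x) ->
    (forall e1 e2, orthonormal_frame e1 e2 zeta -> forall t, 1 - rho < t < 1 ->
      (\int[mu]_(phi in `[0%R, (2 * pi)%R]) (g (circle e1 e2 zeta t phi))%:E = (2 * pi * W)%:E)%E) ->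
    (mu \x mu)%E.-integrable (chart_domain (cap rho zeta)) (EFin \o (fun p => g (sphere_point p))) /\
    surface_integral (cap rho zeta) g = 2 * pi * rho * W.
  move=> cg g0 gm.
  have bg : borel3 (g \_ (cap rho zeta)).
    by apply: (borel3_restrict cg); [exact: subset_closure|exact: measurable_cap].
  have I := ge0_cap_integral zO r02 bg g0 gm.
  have mD := measurable_chart_domain rho zeta.
  split; last by rewrite /surface_integral /Rintegral -[X in integral _ X _]/(chart_domain (cap rho zeta)) I.
  apply/integrableP; split.
    apply/measurable_EFinP.
    have := measurable_funTS (D := chart_domain (cap rho zeta)) (borel3_sphere_point bg).
    apply: eq_measurable_fun => p; rewrite inE => -[_ _ Gp].
    by rewrite patchE mem_set.
  rewrite (_ : (\int[_]_(x in _) _)%E = (2 * pi * rho * W)%:E) ?ltry// -I.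
  apply: eq_integral => p; rewrite inE => -[_ _ Gp] /=.
  by rewrite ger0_norm// g0.
have [i1 s1] : (mu \x mu)%E.-integrable (chart_domain (cap rho zeta)) (EFin \o (fun p => M)) /\
    surface_integral (cap rho zeta) (fun=> M) = 2 * pi * rho * M.
  apply: (K (fun=> M)) => //; first by move=> x; exact: cvg_cst.
  move=> e1 e2 _ t _; rewrite -[X in (integral _ _ X)]/(cst M%:E).
  by rewrite integral_cst//= lebesgue_circle -EFinM mulrC.
have [i2 s2] : (mu \x mu)%E.-integrable (chart_domain (cap rho zeta)) (EFin \o (fun p => f (sphere_point p) + M)) /\
    surface_integral (cap rho zeta) (fun x => f x + M) = 2 * pi * rho * (V + M).
  apply: (K (fun x => f x + M)).
  - by move=> x; apply: cvgD; [exact: cf|exact: cvg_cst].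
  - by move=> x /fM; rewrite ler_norml => /andP[? _]; lra.
  - move=> e1 e2 fr t tr; have [i s] := mean _ _ fr t tr.
    under eq_integral do rewrite EFinD.
    rewrite integralD//=; last first.
      apply/integrableP; split => //.
      under eq_integral do rewrite /= (ger0_norm M0).
      by rewrite -[X in (integral _ _ X)]/(cst M%:E) integral_cst//= lebesgue_circle -EFinM ltry.
    rewrite -[X in (_ + integral _ _ X)%E]/(cst M%:E) integral_cst//= lebesgue_circle.
    rewrite (_ : (\int[_]_(x in _) _)%E = (2 * pi * V)%:E); last first.
      by rewrite -s /Rintegral fineK//; exact: integrable_fin_num.
    by rewrite -EFinM -EFinD; congr EFin; ring.
rewrite (_ : surface_integral _ f = surface_integral (cap rho zeta) (fun x => f x + M) -
   surface_integral (cap rho zeta) (fun=> M)).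
  by rewrite s1 s2; ring.
rewrite /surface_integral -RintegralB//; last exact: measurable_chart_domain.
by apply: eq_Rintegral => p _; rewrite addrK.
Qed.

End cap_integral.

(** * Logarithms of affine functions and the Green function *)

Section log_affine.
Context {R : realType}.
Implicit Types (x v b : 'rV[R]_3) (al : R).

Lemma differentiable_dot b x : differentiable (dot b : 'rV[R]_3 -> R) x.
Proof.
have Llin : linear (dot b : 'rV[R]_3 -> R) by move=> k u v; rewrite dotDr dotZr.
pose L : {linear 'rV[R]_3 -> R} := HB.pack (dot b : 'rV[R]_3 -> R) (GRing.isLinear.Build _ _ _ _ _ Llin).
rewrite -[dot b]/(L : 'rV[R]_3 -> R).
apply: linear_differentiable; exact: continuous_dot.
Qed.

Lemma diff_line (f : 'rV[R]_3 -> R) x v (l : R) : differentiable f x ->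
  is_derive (0 : R) 1 (fun h : R => f (h *: v + x)) l -> 'd f x v = l.
Proof. by move=> df /is_derive_line[_ <-]; rewrite deriveE. Qed.

Lemma is_derive_comb (f1 f2 : R -> R) (C A1 A2 t d1 d2 : R) :
  is_derive t 1 f1 d1 -> is_derive t 1 f2 d2 ->
  is_derive t 1 (fun h => C + A1 * f1 h + A2 * f2 h) (A1 * d1 + A2 * d2).
Proof. by move=> D1 D2; apply: is_derive_eq; rewrite /GRing.scale /=; ring. Qed.

Lemma diff_comb (f1 f2 : 'rV[R]_3 -> R) (C A1 A2 : R) x v :
  differentiable f1 x -> differentiable f2 x ->
  differentiable (fun y => C + A1 * f1 y + A2 * f2 y) x /\
  'd (fun y => C + A1 * f1 y + A2 * f2 y) x v = A1 * 'd f1 x v + A2 * 'd f2 x v.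
Proof.
move=> d1 d2; have df : differentiable (fun y => C + A1 * f1 y + A2 * f2 y) x.
  apply: differentiableD; [apply: differentiableD; first exact: differentiable_cst|].
  - by apply: differentiableM => //; exact: differentiable_cst.
  - by apply: differentiableM => //; exact: differentiable_cst.
split => //; apply: diff_line => //.
have H (f : 'rV[R]_3 -> R) : differentiable f x ->
    is_derive (0 : R) 1 (fun h : R => f (h *: v + x)) ('d f x v).
  by move=> dff; apply/is_derive_line; split; [exact: diff_derivable|rewrite deriveE].
exact: (is_derive_comb C A1 A2 (H _ d1) (H _ d2)).
Qed.

Definition log_affine al b x : R := ln (al + dot b x).

(** For unit x this is the tangential projection of the ambient gradient b / (al + b . x). Being an
    explicit function on the whole space, it can be differentiated again. *)
Definition log_affine_grad al b x : 'rV[R]_3 := (al + dot b x)^-1 *: (b - dot b x *: x).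

Lemma differentiable_affine al b x : differentiable (fun y : 'rV[R]_3 => al + dot b y) x.
Proof. by apply: differentiableD; [exact: differentiable_cst|exact: differentiable_dot]. Qed.

Lemma differentiable_log_affine al b x : 0 < al + dot b x ->
  differentiable (log_affine al b) x.
Proof.
move=> p; apply: (@differentiable_comp _ _ _ _ (fun y : 'rV[R]_3 => al + dot b y) (@ln R)).
  exact: differentiable_affine.
by apply/derivable1_diffP; case: (is_derive1_ln p).
Qed.

Lemma is_derive_affine_line al b x v :
  is_derive (0 : R) 1 (fun h : R => al + dot b (h *: v + x)) (dot b v).
Proof.
rewrite (_ : (fun h => _) = (fun h : R => h * dot b v + (al + dot b x))); last first.
  by apply/funext => h; rewrite dotDr dotZr; ring.
by apply: is_derive_eq; rewrite /GRing.scale /=; ring.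
Qed.

Lemma diff_log_affine al b x v : 0 < al + dot b x ->
  'd (log_affine al b) x v = (al + dot b x)^-1 * dot b v.
Proof.
move=> p; apply: diff_line; first exact: differentiable_log_affine.
have da := is_derive_affine_line al b x v.
have p0 : 0 < al + dot b (0 *: v + x) by rewrite scale0r add0r.
have := @is_derive1_comp R (@ln R) (fun h : R => al + dot b (h *: v + x)) 0 _ _ (is_derive1_ln p0) da.
by rewrite scale0r add0r.
Qed.

Lemma log_affine_gradE al b x i :
  log_affine_grad al b x 0 i = (al + dot b x)^-1 * (b 0 i - dot b x * x 0 i).
Proof. by rewrite !mxE. Qed.

Lemma diff_log_affine_grad al b x (i : 'I_3) v : 0 < al + dot b x ->
  differentiable (fun y => log_affine_grad al b y 0 i) x /\
  'd (fun y => log_affine_grad al b y 0 i) x v =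
    (al + dot b x)^-1 * (- (dot b v * x 0 i) - dot b x * v 0 i) -
    (al + dot b x) ^- 2 * dot b v * (b 0 i - dot b x * x 0 i).
Proof.
move=> p; have pn : al + dot b x != 0 by rewrite gt_eqF.
have -> : (fun y => log_affine_grad al b y 0 i) =
   (fun y : 'rV[R]_3 => (al + dot b y)^-1) * (fun y => b 0 i - dot b y * y 0 i).
  by apply/funext => y; rewrite log_affine_gradE.
have df : differentiable ((fun y : 'rV[R]_3 => (al + dot b y)^-1) * (fun y => b 0 i - dot b y * y 0 i)) x.
  apply: differentiableM; first by apply: differentiableV => //; exact: differentiable_affine.
  apply: differentiableB; first exact: differentiable_cst.
  by apply: differentiableM; [exact: differentiable_dot|exact: differentiable_coord].
split => //; apply: diff_line => //.
pose D (h : R) := al + dot b (h *: v + x).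
have dD : is_derive (0 : R) 1 D (dot b v) by exact: is_derive_affine_line.
have D0 : D 0 = al + dot b x by rewrite /D scale0r add0r.
have dV : is_derive (0 : R) 1 (fun h => (D h)^-1) (- (D 0) ^- 2 *: dot b v).
  by apply: is_deriveV; rewrite D0.
rewrite (_ : (fun h => _) = (fun h : R => (D h)^-1 * (b 0 i - (D h - al) * (h * v 0 i + x 0 i)))); last first.
  by apply/funext => h; rewrite fctE /D !mxE (addrC al) addrK.
apply: is_derive_eq; rewrite /GRing.scale /= D0; ring.
Qed.

(** Surface derivatives at x see only the values on the sphere near x. Hence a gradient may be
    replaced by any formula valid on [Gam] before it is differentiated a second time. *)
Lemma sgrad_local (F1 F2 : 'rV[R]_3 -> R) (Gam : set 'rV[R]_3) x :
  (\forall y \near x, Gam (normalize y)) -> (forall y, Gam y -> F1 y = F2 y) ->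
  sgrad F1 x = sgrad F2 x /\ (sderivable F2 x -> sderivable F1 x).
Proof.
move=> nG F12.
have nF : {near x, (fun y => F2 (normalize y)) =1 (fun y => F1 (normalize y))}.
  by apply: filterS nG => y Gy; rewrite F12.
split.
  by apply/rowP => i; rewrite !mxE; apply/esym/near_eq_derive.
by move=> d2 i; apply: (near_eq_derivable nF); exact: d2.
Qed.

Lemma within_continuous_eq (A : set 'rV[R]_3) (f g : 'rV[R]_3 -> R) :
  (forall x, A x -> f x = g x) -> (forall x, A x -> {for x, continuous g}) ->
  {within A, continuous f}.
Proof.
move=> fg cg; apply: (@subspace_eq_continuous _ _ _ g).
  by move=> x /set_mem Ax; exact/esym/fg.
by apply: continuous_in_subspaceT => x /set_mem; exact: cg.
Qed.

Section two_logs.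
Variables (C A1 A2 al1 al2 : R) (b1 b2 : 'rV[R]_3).
Variables (Gam K : set 'rV[R]_3).
Hypothesis GO : Gam `<=` @Omega R.
Hypothesis KO : K `<=` @Omega R.
Hypothesis GK : Gam `<=` K.
Hypothesis nG : forall x, Gam x -> \forall y \near x, Gam (normalize y).
Hypothesis p1 : forall x, K x -> 0 < al1 + dot b1 x.
Hypothesis p2 : forall x, K x -> 0 < al2 + dot b2 x.

Let Psi x := C + A1 * log_affine al1 b1 x + A2 * log_affine al2 b2 x.
Let g x := A1 *: log_affine_grad al1 b1 x + A2 *: log_affine_grad al2 b2 x.

Let dPsi x : K x -> differentiable Psi x.
Proof.
move=> Kx; have [] := @diff_comb (log_affine al1 b1) (log_affine al2 b2) C A1 A2 x 0 => //.
  exact/differentiable_log_affine/p1.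
exact/differentiable_log_affine/p2.
Qed.

Let dPsiE x v : K x -> 'd Psi x v = A1 * 'd (log_affine al1 b1) x v + A2 * 'd (log_affine al2 b2) x v.
Proof.
move=> Kx; have [] := @diff_comb (log_affine al1 b1) (log_affine al2 b2) C A1 A2 x v => //.
  exact/differentiable_log_affine/p1.
exact/differentiable_log_affine/p2.
Qed.

Lemma sgrad_two_logs x : K x -> sgrad Psi x = g x.
Proof.
move=> Kx; apply/rowP => i; rewrite sgradE; [|exact: KO|exact: dPsi].
apply: etrans (dPsiE _ Kx) _.
have H al b : 0 < al + dot b x ->
    'd (log_affine al b) x (basis3 R i - x 0 i *: x) = log_affine_grad al b x 0 i.
  move=> p; apply: etrans (diff_log_affine _ p) _.
  by rewrite log_affine_gradE dotDr dotNr dotZr dot_basis (mulrC (x 0 i)).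
rewrite [RHS]mxE [X in _ = X + _]mxE [X in _ = _ + X]mxE.
by congr (A1 * _ + A2 * _); apply: H; [exact: p1|exact: p2].
Qed.

Let gE i : (fun y => g y 0 i) =
  (fun y => 0 + A1 * log_affine_grad al1 b1 y 0 i + A2 * log_affine_grad al2 b2 y 0 i).
Proof. by apply/funext => y; rewrite !mxE add0r. Qed.

Let dg_comb x i v : K x -> differentiable (fun y => g y 0 i) x /\
  'd (fun y => g y 0 i) x v =
  A1 * 'd (fun y => log_affine_grad al1 b1 y 0 i) x v + A2 * 'd (fun y => log_affine_grad al2 b2 y 0 i) x v.
Proof.
move=> Kx; rewrite gE; apply: (diff_comb 0 A1 A2 v).
  by have [] := diff_log_affine_grad i 0 (p1 Kx).
by have [] := diff_log_affine_grad i 0 (p2 Kx).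
Qed.

Let dg x i : K x -> differentiable (fun y => g y 0 i) x.
Proof. by move=> /(dg_comb i 0)[]. Qed.

(** Inclusion in [K] is asked only near x, so that the limit at a boundary point also applies to the
    fundamental solution, whose pole lies in the cap but not in [K]. *)
Lemma cvg_sgrad_two_logs x i : K x -> (\forall y \near x, Gam y -> K y) ->
  sgrad Psi y 0 i @[y --> within Gam (nbhs x)] --> g x 0 i.
Proof.
move=> Kx nK; have cg : g y 0 i @[y --> within Gam (nbhs x)] --> g x 0 i.
  by apply: cvg_within_filter; exact/differentiable_continuous/dg.
apply: cvg_trans cg; apply: near_eq_cvg.
by apply: filterS nK => y GKy Gy; rewrite sgrad_two_logs//; exact: GKy.
Qed.

Lemma two_logs_Ck_closure : closure Gam `<=` K -> Ck_closure 1 Gam Psi.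
Proof.
move=> cK; split.
  apply: (within_continuous_eq (g := Psi)) => // x /cK Kx.
  exact/differentiable_continuous/dPsi.
split; first by move=> x Gx; apply: differentiable_sderivable; [exact: GO|exact/dPsi/GK].
exists g; first by move=> x Gx; rewrite sgrad_two_logs//; exact: GK.
move=> i; split => //.
apply: (within_continuous_eq (g := fun x => g x 0 i)) => // x /cK Kx.
exact/differentiable_continuous/dg.
Qed.

(** The j-th surface derivative of the i-th component of [log_affine_grad]: its differential applied
    to the tangential part of the j-th basis vector. *)
Let d2 al b x (i j : 'I_3) : R :=
  (al + dot b x)^-1 * (- ((b 0 j - x 0 j * dot b x) * x 0 i) - dot b x * ((i == j)%:R - x 0 j * x 0 i)) -
    (al + dot b x) ^- 2 * (b 0 j - x 0 j * dot b x) * (b 0 i - dot b x * x 0 i).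

Let cont_d2 al b (i j : 'I_3) x : 0 < al + dot b x -> {for x, continuous (fun y => d2 al b y i j)}.
Proof.
move=> p; have cb : {for x, continuous (dot b)} by exact: continuous_dot.
have cx k : {for x, continuous (fun y : 'rV[R]_3 => y 0 k)} by exact: coord_continuous.
have ca : {for x, continuous (fun y : 'rV[R]_3 => al + dot b y)}.
  by apply: continuousD => //; exact: cst_continuous.
have cV : {for x, continuous (fun y : 'rV[R]_3 => (al + dot b y)^-1)}.
  by apply: continuousV => //; rewrite gt_eqF.
have cV2 : {for x, continuous (fun y : 'rV[R]_3 => (al + dot b y)^-2)}.
  rewrite (_ : (fun y => _) = (fun y => (al + dot b y)^-1 * (al + dot b y)^-1)).
    exact: continuousM.
  by apply/funext => y; rewrite -invfM -expr2.
have cc (k : R) : {for x, continuous (fun=> k : R)} by exact: cst_continuous.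
have cq k : {for x, continuous (fun y : 'rV[R]_3 => b 0 k - y 0 k * dot b y)}.
  by apply: continuousB => //; exact: continuousM.
have cq' k : {for x, continuous (fun y : 'rV[R]_3 => b 0 k - dot b y * y 0 k)}.
  by apply: continuousB => //; exact: continuousM.
apply: continuousB; last by apply: continuousM => //; exact: continuousM.
apply: continuousM => //; apply: continuousB.
  by apply: continuousN; exact: continuousM.
by apply: continuousM => //; apply: continuousB => //; exact: continuousM.
Qed.

Let sgrad_g x i j : K x -> sgrad (fun y => g y 0 i) x 0 j = A1 * d2 al1 b1 x i j + A2 * d2 al2 b2 x i j.
Proof.
move=> Kx; rewrite sgradE; [|exact: KO|exact: dg].
have [_ ->] := dg_comb i (basis3 R j - x 0 j *: x) Kx.
have H al b : 0 < al + dot b x ->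
    'd (fun y => log_affine_grad al b y 0 i) x (basis3 R j - x 0 j *: x) = d2 al b x i j.
  move=> p; have [_ e] := diff_log_affine_grad i (basis3 R j - x 0 j *: x) p.
  apply: etrans e _.
  rewrite /d2 dotDr dotNr dotZr dot_basis.
  have -> : (basis3 R j - x 0 j *: x) 0 i = (i == j)%:R - x 0 j * x 0 i.
    by rewrite !mxE eqxx.
  by [].
by congr (A1 * _ + A2 * _); apply: H; [exact: p1|exact: p2].
Qed.

Let local_sgrad x i : Gam x ->
  sgrad (fun y => sgrad Psi y 0 i) x = sgrad (fun y => g y 0 i) x /\ sderivable (fun y => sgrad Psi y 0 i) x.
Proof.
move=> Gx; have [|e d] := @sgrad_local (fun y => sgrad Psi y 0 i) (fun y => g y 0 i) Gam x (nG Gx).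
  by move=> y Gy; rewrite sgrad_two_logs//; exact: GK.
split => //; apply: d; apply: differentiable_sderivable; [exact: GO|exact/dg/GK].
Qed.

Lemma two_logs_Ck : Ck 2 Gam Psi.
Proof.
split.
  apply: (within_continuous_eq (g := Psi)) => // x /GK Kx.
  exact/differentiable_continuous/dPsi.
split; first by move=> x Gx; apply: differentiable_sderivable; [exact: GO|exact/dPsi/GK].
move=> i; split.
  apply: (within_continuous_eq (g := fun x => g x 0 i)) => [x Gx|x /GK Kx].
    by rewrite sgrad_two_logs//; exact: GK.
  exact/differentiable_continuous/dg.
split=> [x Gx|j]; first by case: (local_sgrad i Gx).
split => //.
apply: (within_continuous_eq (g := fun x => A1 * d2 al1 b1 x i j + A2 * d2 al2 b2 x i j)) => [x Gx|x /GK Kx].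
  by have [-> _] := local_sgrad i Gx; rewrite sgrad_g//; exact: GK.
have cc (k : R) : {for x, continuous (fun=> k : R)} by exact: cst_continuous.
by apply: continuousD; apply: continuousM => //; apply: cont_d2; [exact: p1|exact: p2].
Qed.

(** With B = b . x and |b| = al, the trace of [d2] is -2 B / (al + B) - (al^2 - B^2) / (al + B)^2 =
    -1 for each logarithm. *)
Lemma beltrami_two_logs x : dot b1 b1 = al1 ^+ 2 -> dot b2 b2 = al2 ^+ 2 -> Gam x ->
  beltrami Psi x = - A1 - A2.
Proof.
move=> n1 n2 Gx; have Kx := GK Gx; have xO := GO Gx.
transitivity (\sum_i (A1 * d2 al1 b1 x i i + A2 * d2 al2 b2 x i i)).
  by apply: eq_bigr => i _; have [-> _] := local_sgrad i Gx; rewrite sgrad_g.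
rewrite big_split/= -!mulr_sumr.
have T al b : dot b b = al ^+ 2 -> 0 < al + dot b x -> \sum_i d2 al b x i i = - 1.
  move=> nb p; have x1 : dot x x = 1 by apply/OmegaE.
  have S (u u2 B : R) : \sum_i (u * (- ((b 0 i - x 0 i * B) * x 0 i) - B * (1 - x 0 i * x 0 i)) -
      u2 * (b 0 i - x 0 i * B) * (b 0 i - B * x 0 i)) =
      u * (- (dot b x - B * dot x x) - B * (3 - dot x x)) - u2 * (dot b b - 2 * B * dot b x + B ^+ 2 * dot x x).
    by rewrite sum3E !dotE; ring.
  rewrite /d2; under eq_bigr do rewrite eqxx.
  have pn : al + dot b x != 0 by rewrite gt_eqF.
  by rewrite S nb x1; field.
rewrite !T//; [ring|exact: p2|exact: p1].
Qed.

End two_logs.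

End log_affine.

(** * The Neumann Green function of the cap *)

Section cap_green.
Context {R : realType}.
Variables (rho : R) (zeta : 'rV[R]_3).
Hypothesis hzeta : Omega zeta.
Hypothesis rho_gt0 : 0 < rho.
Hypothesis rho_lt2 : rho < 2.
Let Gam := cap rho zeta.
Let c := 1 - rho.
Let s := Num.sqrt (1 - c ^+ 2).

Let w0 : 0 < 1 - c ^+ 2. Proof. exact: cap_height_lt1. Qed.
Let wn : 1 - c ^+ 2 != 0. Proof. by rewrite gt_eqF. Qed.
Let rhoE : rho = 1 - c. Proof. by rewrite /c; ring. Qed.
Let c1 : -1 < c < 1. Proof. by rewrite /c; apply/andP; split; move: rho_gt0 rho_lt2; lra. Qed.

Lemma surface_area_cap : surface_area Gam = 2 * pi * rho.
Proof.
rewrite /surface_area (@cap_surface_integral R rho zeta (fun=> 1) 1 1)//.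
- by rewrite mulr1.
- by rewrite rho_gt0.
- by apply: continuous_subspaceT => x; exact: cst_continuous.
- by move=> x _; rewrite normr1.
- have p0 : (0 : R) <= 2 * pi by rewrite mulr_ge0// pi_ge0.
  move=> e1 e2 _ t _; split.
    apply: continuous_compact_integrable; first exact: segment_compact.
    by apply: continuous_subspaceT => x; exact: cst_continuous.
  rewrite Rintegral_cst//= lebesgue_measure_itv/= lte_fin mul1r.
  by rewrite mulr_gt0// ?pi_gt0//= oppr0 addr0 mulr1.
Qed.

Section pole.
Variable xi : 'rV[R]_3.
Hypothesis xG : Gam xi.
Let t := dot xi zeta.
Let r := rcheck rho zeta xi.
Let q := rcheck_quotient rho zeta xi.

Let xO : Omega xi. Proof. by case: xG. Qed.
Let ct : c < t. Proof. by case/(capE rho zeta): xG => _; rewrite dotC. Qed.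
Let t1 : t <= 1. Proof. exact: dot_le1. Qed.

Let rE : r = (1 - 2 * t * c + c ^+ 2) / (1 - c ^+ 2).
Proof.
rewrite /r /rcheck -/t rhoE.
have -> : (1 - c) * (1 - c - 2) = - (1 - c ^+ 2) by ring.
by rewrite invrN mulrN opprK; congr (_ / _); ring.
Qed.

(** The factor rho - 1 cancels in the quotient, and the resulting formula is regular at c = 0, where
    it gives the value prescribed for rho = 1. *)
Let qE : q = 2 * (t - c) / (1 - c ^+ 2).
Proof.
rewrite /q /rcheck_quotient; case: eqP => [r1|/eqP r1].
  have -> : c = 0 by rewrite /c r1 subrr.
  by rewrite -/t subr0 expr0n subr0 divr1.
rewrite -/r rE; have c0 : c != 0 by rewrite /c subr_eq0 eq_sym.
have -> : rho - 1 = - c by rewrite /c; ring.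
by field; rewrite c0 wn.
Qed.

Let r_gt0 : 0 < r.
Proof.
rewrite rE divr_gt0//; move/andP: c1 => [ca cb]; have := ct; have := t1.
have [c0|c0] := leP 0 c; nra.
Qed.

(* Hence r (1 - xicheck . eta) = 1 - xi . eta when zeta . eta = c. *)
Let rqc : r + q * c = 1.
Proof. by rewrite rE qE; field. Qed.

Let q_gt0 : 0 < q.
Proof. by rewrite qE divr_gt0// mulr_gt0// subr_gt0. Qed.

Let b1 := q *: zeta - xi.

Let b1E y : r + dot b1 y = r + q * dot zeta y - dot xi y.
Proof. by rewrite /b1 !dot_bilin; ring. Qed.

Let green_arg y : rcheck rho zeta xi * (1 - dot (xicheck rho zeta xi) y) = r + dot b1 y.
Proof.
have rn : r != 0 by rewrite gt_eqF.
by rewrite b1E /xicheck -/r -/q !dot_bilin; field.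
Qed.

(** By [rqc] the value is (1 - xi . y) + q (zeta . y - c). Both terms are nonnegative on the closed
    cap; the first is positive unless y = xi, and there the second is. *)
Let p1 y : closure Gam y -> 0 < r + dot b1 y.
Proof.
rewrite (closure_capE hzeta rho_gt0 rho_lt2) => -[yO cy]; rewrite b1E.
have [<-|ne] := eqVneq xi y.
  have -> : dot xi xi = 1 by apply/OmegaE.
  rewrite (dotC zeta) -/t; have := rqc; have := ct; have := q_gt0; nra.
have := dot_lt1 xO yO ne; have := rqc; have := q_gt0; rewrite -/c in cy; nra.
Qed.

Let p2 y : closure Gam y -> 0 < 1 + dot zeta y.
Proof.
rewrite (closure_capE hzeta rho_gt0 rho_lt2) => -[yO cy]; rewrite -/c in cy.
by case/andP: c1 => ? ?; lra.
Qed.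

(** Since b1 = - r xicheck, this puts the reflected pole xicheck on the unit sphere, which is what
    [beltrami_two_logs] requires. *)
Let b1b1 : dot b1 b1 = r ^+ 2.
Proof.
have z1 : dot zeta zeta = 1 by apply/OmegaE.
have x1 : dot xi xi = 1 by apply/OmegaE.
by rewrite /b1 !dot_bilin z1 x1 (dotC zeta) -/t rE qE; field.
Qed.

Definition regular_part (y : 'rV[R]_3) : R :=
  (4 * pi)^-1 * (1 - ln 2) + - (4 * pi)^-1 * log_affine r b1 y +
  - ((1 - rho) / (2 * pi * rho)) * log_affine 1 zeta y.

Lemma cap_neumann_greenE y :
  cap_neumann_green rho zeta xi y = fundamental_solution (dot xi y) - regular_part y.
Proof.
rewrite /cap_neumann_green green_arg /fundamental_solution /regular_part /log_affine.
by ring.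
Qed.

Let GO : Gam `<=` @Omega R. Proof. exact: cap_Omega. Qed.
Let KO : closure Gam `<=` @Omega R.
Proof. by rewrite (closure_capE hzeta rho_gt0 rho_lt2) => y []. Qed.
Let GK : Gam `<=` closure Gam. Proof. exact: subset_closure. Qed.
Let nG y : Gam y -> \forall z \near y, Gam (normalize z). Proof. exact: near_cap. Qed.

Lemma regular_part_Ck : Ck 2 Gam regular_part.
Proof. exact: (two_logs_Ck _ _ _ GO KO GK nG p1 p2). Qed.

Lemma regular_part_Ck_closure : Ck_closure 1 Gam regular_part.
Proof. exact: (two_logs_Ck_closure _ _ _ GO KO GK p1 p2). Qed.

(** Here the coefficient of the last logarithm is decided: 1 / (4 pi) + (1 - rho) / (2 pi rho) = 1 /
    (2 pi rho) - 1 / (4 pi). *)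
Lemma beltrami_regular_part y : Gam y ->
  beltrami regular_part y = (surface_area Gam)^-1 - (4 * pi)^-1.
Proof.
move=> Gy; rewrite (beltrami_two_logs _ _ _ GO KO GK nG p1 p2)//; last first.
  by rewrite expr1n; apply/OmegaE.
rewrite surface_area_cap.
have pn : (pi : R) != 0 by rewrite gt_eqF// pi_gt0.
have rn : rho != 0 by rewrite gt_eqF.
by move: (pi : R) pn => p pn; field; rewrite rn pn.
Qed.

(** With D = 1 - xi . y one has q s + 2 nu . xi = - 2 c D / s. The terms with the two poles
    therefore differ by the constant - c / (2 pi s), and the term ln (1 + zeta . y) supplies c / (2
    pi s). *)
Lemma normal_derivative_regular_part y : sboundary Gam y ->
  normal_derivative Gam regular_part y =
  normal_derivative Gam (fun x => fundamental_solution (dot xi x)) y.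
Proof.
move=> yB; have := yB; rewrite (sboundary_capE hzeta rho_gt0 rho_lt2) => -[yO yc].
have yK : closure Gam y by case: yB.
have xy : xi != y.
  by apply/eqP => e; have := ct; rewrite /t e dotC yc /c ltxx.
have D0 : 0 < 1 - dot xi y by rewrite subr_gt0; exact: dot_lt1.
(* A second logarithm with coefficient 0 brings the fundamental solution into the form with two
   logarithms. *)
have -> : (fun x => fundamental_solution (dot xi x)) =
    (fun x => (4 * pi)^-1 * (1 - ln 2) + (4 * pi)^-1 * log_affine 1 (- xi) x + 0 * log_affine 1 (- xi) x).
  by apply/funext => x; rewrite /fundamental_solution /log_affine dotNl; ring.
have nxi : \forall z \near y, z != xi.
  have : open (~` [set xi]) by apply: closed_openC; exact: accessible_closed_set1 (hausdorff_accessible (@norm_hausdorff _ _)) _.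
  have yx : (~` [set xi]) y by apply/eqP; rewrite eq_sym.
  move=> oA; have := open_nbhs_nbhs (conj oA yx).
  by apply: filterS => z /eqP.
have nK0 : \forall z \near y, Gam z -> closure Gam z by apply: filterS nxi => z _; exact: GK.
apply: etrans (normal_derivativeE hzeta rho_gt0 rho_lt2 yB
  (fun i => @cvg_sgrad_two_logs R _ _ _ _ _ _ _ Gam _ KO p1 p2 _ i yK nK0)) _.
(* The largest part of the sphere on which the fundamental solution is smooth; since y is not xi, it
   contains the points of the cap near y. *)
pose K := [set z | Omega z /\ z != xi].
have Kp z : K z -> 0 < 1 + dot (- xi) z.
  by move=> [zO zx]; rewrite dotNl subr_gt0; apply: dot_lt1 => //; rewrite eq_sym.
have KO' : K `<=` @Omega R by move=> z [].
have Ky : K y by split => //; rewrite eq_sym.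
have nK : \forall z \near y, Gam z -> K z by apply: filterS nxi => z zx /GO.
apply/esym; apply: etrans (normal_derivativeE hzeta rho_gt0 rho_lt2 yB
  (fun i => @cvg_sgrad_two_logs R _ _ _ _ _ _ _ Gam _ KO' Kp Kp _ i Ky nK)) _; apply/esym.
have nu0 := cap_normal_tangent yO yc.
have nuz := dot_zeta_cap_normal hzeta rho_gt0 rho_lt2 yc.
rewrite -/c -/s in nuz.
have nux : dot (cap_normal rho zeta y) xi = s^-1 * (c * dot xi y - t).
  by rewrite /cap_normal -/c -/s !dot_bilin (dotC y) (dotC zeta xi).
have s_gt0 : 0 < s by rewrite sqrtr_gt0.
have s2 : s ^+ 2 = 1 - c ^+ 2 by rewrite sqr_sqrtr// ltW.
have H al b : dot (cap_normal rho zeta y) (log_affine_grad al b y) =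
    (al + dot b y)^-1 * dot (cap_normal rho zeta y) b.
  by rewrite /log_affine_grad dotZr dotDr dotNr dotZr nu0; ring.
have LL (u L1 L2 : 'rV[R]_3) a b : dot u (a *: L1 + b *: L2) = a * dot u L1 + b * dot u L2.
  by rewrite dotDr !dotZr.
rewrite !LL !H b1E yc -/c rqc dotNr dotNl /b1 dotDr dotNr dotZr.
rewrite (dotC _ zeta) nuz nux rhoE.
have pn : (pi : R) != 0 by rewrite gt_eqF// pi_gt0.
have D0' : 1 - dot xi y != 0 by rewrite gt_eqF.
have sn : s != 0 by rewrite gt_eqF.
have cn : 1 - c != 0 by rewrite -rhoE gt_eqF.
have cn' : 1 + c != 0 by case/andP: c1 => ? ?; rewrite gt_eqF//; lra.
have qq : q = 2 * (t - c) / s ^+ 2 by rewrite qE s2.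
move: (pi : R) pn => p pn.
have e : c / (2 * p * (1 - c)) * ((1 + c)^-1 * - s) = - (c / (2 * p * s)).
  have -> : c / (2 * p * (1 - c)) * ((1 + c)^-1 * - s) = - (c * s / (2 * p * ((1 - c) * (1 + c)))).
    by field; rewrite cn cn' pn.
  have -> : (1 - c) * (1 + c) = s ^+ 2 by rewrite s2; ring.
  by field; rewrite sn pn.
rewrite [X in _ + X = _]mulNr e qq; field.
by rewrite sn D0' pn.
Qed.
End pole.

Lemma neumann_green_cap : is_neumann_green Gam (cap_neumann_green rho zeta).
Proof.
exists regular_part; split=> [xi eta xG _ _|xi xG]; first exact: cap_neumann_greenE.
split; [exact: regular_part_Ck|exact: regular_part_Ck_closure|exact: beltrami_regular_part|].
exact: normal_derivative_regular_part.
Qed.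

End cap_green.

(** * Green's identity on concentric circles *)

Section circle_integral.
Context {R : realType}.
Implicit Types (f g : R -> R).
Let mu := @lebesgue_measure R.

Definition circ f : R := \int[mu]_(phi in `[0, 2 * pi]) f phi.

Lemma two_pi_gt0 : 0 < 2 * pi :> R.
Proof. by rewrite mulr_gt0// pi_gt0. Qed.

Lemma continuous_integrable f : continuous f -> mu.-integrable `[0, 2 * pi] (EFin \o f).
Proof.
move=> cf; apply: continuous_compact_integrable; first exact: segment_compact.
exact: continuous_subspaceT.
Qed.

Lemma continuous_mul f g : continuous f -> continuous g -> continuous (fun x => f x * g x).
Proof. by move=> cf cg x; exact: (cvgM (cf x) (cg x)). Qed.

Lemma continuous_sub f g : continuous f -> continuous g -> continuous (fun x => f x - g x).
Proof. by move=> cf cg x; exact: (cvgB (cf x) (cg x)). Qed.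

Lemma continuous_scale (k : R) f : continuous f -> continuous (fun x => k * f x).
Proof. by move=> cf x; exact: (cvgMr (cf x)). Qed.

Lemma circ_cst (k : R) : circ (fun=> k) = 2 * pi * k.
Proof.
rewrite /circ Rintegral_cst//= lebesgue_measure_itv/= lte_fin two_pi_gt0/=.
by rewrite oppr0 addr0 mulrC.
Qed.

Lemma circD f g : continuous f -> continuous g -> circ (fun x => f x + g x) = circ f + circ g.
Proof. by move=> cf cg; apply: RintegralD => //; exact: continuous_integrable. Qed.

Lemma circB f g : continuous f -> continuous g -> circ (fun x => f x - g x) = circ f - circ g.
Proof. by move=> cf cg; apply: RintegralB => //; exact: continuous_integrable. Qed.

Lemma circZ (k : R) f : continuous f -> circ (fun x => k * f x) = k * circ f.
Proof. by move=> cf; apply: RintegralZl => //; exact: continuous_integrable. Qed.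

Lemma le_circ f g : continuous f -> continuous g -> (forall x, f x <= g x) -> circ f <= circ g.
Proof. by move=> cf cg fg; apply: le_Rintegral => //; exact: continuous_integrable. Qed.

Lemma circ_norm_le f g : continuous f -> continuous g -> (forall x, `|f x| <= g x) -> `|circ f| <= circ g.
Proof.
move=> cf cg fg; rewrite ler_norml; apply/andP; split.
  rewrite lerNl -mulN1r -circZ//; apply: le_circ => //.
    exact: continuous_scale.
  by move=> x; rewrite mulN1r lerNl; have := fg x; rewrite ler_norml => /andP[].
by apply: le_circ => // x; have := fg x; rewrite ler_norml => /andP[].
Qed.

Lemma circ_bound f (M : R) : continuous f -> (forall x, `|f x| <= M) -> `|circ f| <= 2 * pi * M.
Proof.
by move=> cf fM; rewrite -circ_cst; apply: circ_norm_le => // x; exact: cst_continuous.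
Qed.

Lemma is_derive_continuous f (f' : R -> R) : (forall x : R, is_derive x 1 f (f' x)) -> continuous f.
Proof.
move=> df x; apply: differentiable_continuous; apply/derivable1_diffP.
by case: (df x).
Qed.

Lemma circ_derive f (f' : R -> R) : (forall x : R, is_derive x 1 f (f' x)) -> continuous f' ->
  f (2 * pi) = f 0 -> circ f' = 0.
Proof.
move=> df cf' per; have cf := is_derive_continuous df.
rewrite /circ /Rintegral (@continuous_FTC2 R f' f) ?per//.
- by rewrite -EFinB subrr.
- exact: two_pi_gt0.
- exact: continuous_subspaceT.
- split=> [x _||].
  + by case: (df x).
  + exact/cvg_at_right_filter/cf.
  + exact/cvg_at_left_filter/cf.
- by move=> x _; rewrite derive1E; case: (df x).
Qed.

(** Carries an identity with constant right-hand side from inner circles to the boundary circle,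
    with a constant as dominating function. *)
Lemma circ_limit (f_ : nat -> R -> R) f (M V : R) : (forall n, continuous (f_ n)) ->
  (forall x, f_ n x @[n --> \oo] --> f x) -> (forall n x, `|f_ n x| <= M) ->
  (forall n, circ (f_ n) = V) -> circ f = V.
Proof.
move=> cf ff fM fV.
have mI : measurable (`[0, 2 * pi] : set R) by [].
have mf n : measurable_fun `[0, 2 * pi] (f_ n).
  by have /integrableP[/measurable_EFinP] := continuous_integrable (@cf n).
have mf0 : measurable_fun `[0, 2 * pi] f by apply: (@measurable_fun_cvg _ _ _ _ f_).
have iM : mu.-integrable `[0, 2 * pi] (EFin \o (fun=> M)).
  by apply: continuous_integrable => x; exact: cst_continuous.
have [|||||i1 _ i2] := @dominated_convergence _ _ _ mu _ mI (fun n => EFin \o f_ n) (EFin \o f) (EFin \o (fun=> M)).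
- by move=> n; apply/measurable_EFinP; exact: mf.
- by apply/measurable_EFinP; exact: mf0.
- by apply: aeW => x _; apply: cvg_EFin; [exact: nearW|exact: ff].
- exact: iM.
- by apply: aeW => x n _ /=; rewrite lee_fin.
have e : [sequence (\int[mu]_(x in `[0%R, (2 * pi)%R]) (EFin \o f_ n) x)%E]_n = fun=> V%:E.
  apply/funext => n /=; rewrite -(fV n) fineK//.
  by apply: integrable_fin_num => //; exact: continuous_integrable.
rewrite e in i2.
have := cvg_lim (@ereal_hausdorff _) i2; rewrite lim_cst// => {}i2.
by rewrite /circ /Rintegral -i2.
Qed.

End circle_integral.

(** * Harmonic functions in polar coordinates *)

Section polar_harmonic.
Context {R : realType}.
Implicit Types (a b r phi : R).

(* Here u1 = r du/dr, u2 = r du1/dr and uf = du/dphi, so that ph_dff is Laplace's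
   equation in polar coordinates. *)
Record polar_harmonic a b (u u1 uf u2 : R -> R -> R) : Prop := PolarHarmonic {
  ph_dr : forall r phi : R, a < r < b -> is_derive r 1 (u^~ phi) (u1 r phi / r) ;
  ph_dr1 : forall r phi : R, a < r < b -> is_derive r 1 (u1^~ phi) (u2 r phi / r) ;
  ph_df : forall r phi : R, a < r < b -> is_derive phi 1 (u r) (uf r phi) ;
  ph_dff : forall r phi : R, a < r < b -> is_derive phi 1 (uf r) (- u2 r phi) ;
  ph_cont1 : forall r, a < r < b -> continuous (u1 r) ;
  ph_cont2 : forall r, a < r < b -> continuous (u2 r) ;
  ph_per : forall r, a < r < b -> u r (2 * pi) = u r 0 /\ uf r (2 * pi) = uf r 0 ;
  ph_bound : exists M, forall r phi : R, a < r < b ->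
    [/\ `|u r phi| <= M, `|u1 r phi| <= M & `|u2 r phi| <= M] }.

Lemma ph_cont a b u u1 uf u2 r : polar_harmonic a b u u1 uf u2 -> a < r < b -> continuous (u r).
Proof. by move=> h ar; apply: is_derive_continuous => x; exact: (ph_df h). Qed.

Lemma ph_sub a b a' b' u u1 uf u2 : a <= a' -> b' <= b ->
  polar_harmonic a b u u1 uf u2 -> polar_harmonic a' b' u u1 uf u2.
Proof.
move=> aa bb [h1 h2 h3 h4 h5 h6 h7 [M h8]].
have S r : a' < r < b' -> a < r < b.
  by move=> /andP[ar rb]; rewrite (le_lt_trans aa ar) (lt_le_trans rb bb).
split; do ?[by move=> r phi /S; eauto].
- by move=> r /S /h5.
- by move=> r /S /h6.
- by move=> r /S /h7.
- by exists M => r phi /S; exact: h8.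
Qed.

Lemma circ_derive_under (f f' : R -> R -> R) a b r (M : R) : a < r < b ->
  (forall s, a < s < b -> continuous (f s)) ->
  (forall s phi, a < s < b -> is_derive s 1 (f^~ phi) (f' s phi)) ->
  (forall s phi, a < s < b -> `|f' s phi| <= M) ->
  is_derive r 1 (fun s => circ (f s)) (circ (f' r)).
Proof.
move=> rab cf df fM.
have mI : measurable (`[0, 2 * pi] : set R) by [].
have Ir : `]a, b[%classic r by rewrite /= in_itv.
have intf x : `]a, b[%classic x -> (@lebesgue_measure R).-integrable `[0, 2 * pi] (EFin \o f x).
  by rewrite /= in_itv/= => xab; apply/continuous_integrable/cf.
have derf x y : `]a, b[%classic x -> `[0, 2 * pi]%classic y -> derivable (f ^~ y) x 1.
  by rewrite /= in_itv/= => xab _; case: (df x y xab).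
have intM : (@lebesgue_measure R).-integrable `[0, 2 * pi] (EFin \o (fun=> `|M| : R)).
  by apply: continuous_integrable => x; exact: cst_continuous.
have M_ub x y : `]a, b[%classic x -> `[0, 2 * pi]%classic y -> `|partial1of2 f x y| <= `|M|.
  rewrite /= in_itv/= => xab _; rewrite partial1of2E.
  have [_ ->] := df x y xab.
  by apply: le_trans (fM _ _ xab) _; exact: ler_norm.
have M0 (y : R) : 0 <= `|M| by [].
have d := @derivable_under_integral R _ _ (@lebesgue_measure R) f _ mI r a b Ir intf derf (fun=> `|M|) M0 intM M_ub.
apply: DeriveDef; first exact: d.
rewrite -derive1E.
apply: etrans (@differentiation_under_integral R _ _ (@lebesgue_measure R) f _ mI r a b Ir intf derf (fun=> `|M|) M0 intM M_ub) _.
by apply: eq_Rintegral => y _; rewrite partial1of2E; case: (df r y rab).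
Qed.

Lemma zero_derive_cst (J : R -> R) (a b r r' : R) : a < r < b -> a < r' < b ->
  (forall s : R, a < s < b -> is_derive s 1 J 0) -> J r = J r'.
Proof.
wlog rr : r r' / r < r'.
  move=> H ra ra' dJ; have [rr|rr|->//] := ltgtP r r'; first exact: H.
  by apply/esym; exact: H.
move=> /andP[ar _] /andP[_ rb] dJ.
have S x : r <= x <= r' -> a < x < b.
  by move=> /andP[rx xr]; rewrite (lt_le_trans ar rx) (le_lt_trans xr rb).
have [||c _] := @MVT _ J (fun=> 0) r r' rr.
- by move=> x; rewrite in_itv/= => /andP[? ?]; apply/dJ/S; rewrite !ltW.
- by apply: derivable_within_continuous => x; rewrite in_itv/= => /S/dJ[].
by rewrite mul0r => /eqP; rewrite subr_eq0 => /eqP ->.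
Qed.

(* The r-derivative of the integral is 1/r times the integral of
   d/dphi (Kf u - K uf). *)
Lemma green_circles a b u u1 uf u2 K K1 Kf K2 r r' : 0 <= a ->
  polar_harmonic a b u u1 uf u2 -> polar_harmonic a b K K1 Kf K2 ->
  a < r < b -> a < r' < b ->
  circ (fun phi => K r phi * u1 r phi - K1 r phi * u r phi) =
  circ (fun phi => K r' phi * u1 r' phi - K1 r' phi * u r' phi).
Proof.
move=> a0 hu hK rab rab'.
pose f s phi := K s phi * u1 s phi - K1 s phi * u s phi.
pose g s phi := K s phi * u2 s phi - K2 s phi * u s phi.
have cf s : a < s < b -> continuous (f s).
  move=> sab; apply: continuous_sub; apply: continuous_mul.
  - exact: (ph_cont hK).
  - exact: (ph_cont1 hu).
  - exact: (ph_cont1 hK).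
  - exact: (ph_cont hu).
have cg s : a < s < b -> continuous (g s).
  move=> sab; apply: continuous_sub; apply: continuous_mul.
  - exact: (ph_cont hK).
  - exact: (ph_cont2 hu).
  - exact: (ph_cont2 hK).
  - exact: (ph_cont hu).
have df s phi : a < s < b -> is_derive s 1 (f^~ phi) (s^-1 * g s phi).
  move=> sab.
  have k0 := ph_dr hK phi sab; have k1 := ph_dr1 hK phi sab.
  have v0 := ph_dr hu phi sab; have v1 := ph_dr1 hu phi sab.
  by apply: is_derive_eq; rewrite /g /GRing.scale /=; ring.
have [M hM] := ph_bound hu; have [N hN] := ph_bound hK.
apply: (@zero_derive_cst (fun s => circ (f s)) a b) => // s sab.
have s0 : 0 < s by case/andP: sab => /(le_lt_trans a0).
have -> : 0 = circ (fun phi => s^-1 * g s phi).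
  rewrite circZ; last exact: cg.
  suff -> : circ (g s) = 0 by rewrite mulr0.
  apply: (@circ_derive _ (fun phi => Kf s phi * u s phi - K s phi * uf s phi)); last 2 first.
  - exact: cg.
  - by have [-> ->] := ph_per hu sab; have [-> ->] := ph_per hK sab.
  move=> x; have k0 := ph_df hK x sab; have k1 := ph_dff hK x sab.
  have v0 := ph_df hu x sab; have v1 := ph_dff hu x sab.
  by apply: is_derive_eq; rewrite /g /GRing.scale /=; ring.
(* Differentiation under the integral needs a bound on the factor 1 / x near s; as a may be 0, the
   lower end is raised to at least s / 2. *)
pose a' := Num.max a (s / 2).
have a'0 : 0 < a' by rewrite lt_max divr_gt0 ?orbT.
have S x : a' < x < b -> a < x < b.
  by move=> /andP[]; rewrite gt_max => /andP[-> _] ->.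
apply: (@circ_derive_under f (fun s phi => s^-1 * g s phi) a' b s (a'^-1 * (N * M + N * M))).
- case/andP: sab => as_ ->; rewrite andbT gt_max as_/=; lra.
- by move=> x /S; exact: cf.
- by move=> x phi /S; exact: df.
- move=> x phi xab; have := S _ xab => xab'.
  have x0 : 0 < x by case/andP: xab => /(lt_trans a'0).
  have [m0 m1 m2] := hM x phi xab'; have [n0 n1 n2] := hN x phi xab'.
  rewrite normrM; apply: ler_pM => //.
    rewrite ger0_norm ?invr_ge0 ?(ltW x0)// lef_pV2 ?posrE//.
    by case/andP: xab => /ltW.
  rewrite /g; apply: le_trans (ler_normB _ _) _.
  by rewrite !normrM; apply: lerD; apply: ler_pM.
Qed.

End polar_harmonic.

(** * The Neumann problem in a disc *)

Section log_kernel.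
Context {R : realType}.
Implicit Types (q psi : R).

(* kden q psi = |1 - q e^(i psi)|^2; logker1 = q d/dq logker,
   logkerf = d/dpsi logker and logker2 = q d/dq logker1 = - d/dpsi logkerf. *)
Definition kden q psi : R := 1 - 2 * q * cos psi + q ^+ 2.
Definition logker q psi : R := ln (kden q psi).
Definition logker1 q psi : R := (2 * q ^+ 2 - 2 * q * cos psi) / kden q psi.
Definition logkerf q psi : R := 2 * q * sin psi / kden q psi.
Definition logker2 q psi : R :=
  4 * q ^+ 2 * sin psi ^+ 2 / kden q psi ^+ 2 - 2 * q * cos psi / kden q psi.

Lemma kden_ge q psi : 0 <= q -> (1 - q) ^+ 2 <= kden q psi.
Proof. by move=> q0; rewrite /kden; have := cos_le1 psi; nra. Qed.

Lemma kden_gt0 q psi : 0 <= q < 1 -> 0 < kden q psi.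
Proof.
move=> /andP[q0 q1]; apply: lt_le_trans (kden_ge psi q0).
by rewrite exprn_gt0// subr_gt0.
Qed.

Lemma logker_bound q q0 psi : 0 <= q <= q0 -> q0 < 1 ->
  `|logker q psi| <= `|ln ((1 - q0) ^+ 2)| + `|ln 4|.
Proof.
move=> /andP[qge qq] q01.
have w0 : 0 < (1 - q0) ^+ 2 by rewrite exprn_gt0// subr_gt0.
have wD : (1 - q0) ^+ 2 <= kden q psi.
  by apply: le_trans (kden_ge _ qge); rewrite ler_pXn2r// ?nnegrE; lra.
have D0 : 0 < kden q psi by exact: lt_le_trans wD.
have c2 := cos_geN1 psi.
have D4 : kden q psi <= 4 by rewrite /kden; nra.
have l1 : ln ((1 - q0) ^+ 2) <= ln (kden q psi) by rewrite ler_ln ?posrE.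
have l2 : ln (kden q psi) <= ln 4 by rewrite ler_ln ?posrE.
rewrite /logker ler_norml; apply/andP; split.
  by have := ler_norm (- ln ((1 - q0) ^+ 2)); rewrite normrN; have := normr_ge0 (ln 4 : R); lra.
by have := ler_norm (ln 4 : R); have := normr_ge0 (ln ((1 - q0) ^+ 2)); lra.
Qed.

Lemma is_derive_kden_f q psi th :
  is_derive psi 1 (fun p => kden q (p - th)) (2 * q * sin (psi - th)).
Proof.
have d0 : is_derive psi (1 : R) (fun p : R => p - th) 1.
  by apply: is_derive_eq; rewrite subr0.
have := @is_derive1_comp R (@cos R) (fun p : R => p - th) psi _ _ (is_derive_cos _) d0 => d1.
by apply: is_derive_eq; rewrite /GRing.scale /=; ring.
Qed.

Lemma is_derive_kden_q q psi : is_derive q 1 (kden^~ psi) (2 * q - 2 * cos psi).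
Proof. by apply: is_derive_eq; rewrite /GRing.scale /=; ring. Qed.

End log_kernel.

(* e = 1 for Q r = r / s (singularity outside the disc), e = -1 for Q r = a / r
   (singularity inside). *)
Section kernel_harmonic.
Context {R : realType}.
Implicit Types (r psi p : R).
Variables (e th q0 a b : R) (Q : R -> R).
Hypothesis e2 : e ^+ 2 = 1.
Hypothesis q01 : q0 < 1.
Hypothesis a0 : 0 <= a.
Hypothesis Q0 : forall r, a < r < b -> 0 < Q r <= q0.
Hypothesis dQ : forall r : R, a < r < b -> is_derive r 1 Q (e * Q r / r).

Let D0 r psi : a < r < b -> 0 < kden (Q r) psi.
Proof.
by move=> /Q0/andP[q q']; apply: kden_gt0; rewrite (ltW q) (le_lt_trans q' q01).
Qed.

Let Dn r psi : a < r < b -> kden (Q r) psi != 0.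
Proof. by move=> /D0 => /(_ psi) ?; rewrite gt_eqF. Qed.

Let dD r psi : a < r < b ->
  is_derive r 1 (fun s => kden (Q s) psi) ((e * Q r / r) * (2 * Q r - 2 * cos psi)).
Proof.
move=> rab; have := @is_derive1_comp R (kden^~ psi) Q r _ _ (is_derive_kden_q _ _) (dQ rab).
by rewrite mulrC.
Qed.

Let dker r psi : a < r < b -> is_derive r 1 (fun s => logker (Q s) psi) (e * logker1 (Q r) psi / r).
Proof.
move=> rab; have := @is_derive1_comp R (@ln R) (fun s => kden (Q s) psi) r _ _
  (is_derive1_ln (D0 psi rab)) (dD psi rab).
by congr is_derive; rewrite /logker1; ring.
Qed.

Let dkerf r psi : a < r < b -> is_derive psi 1 (fun p => logker (Q r) (p - th)) (logkerf (Q r) (psi - th)).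
Proof.
move=> rab; have := @is_derive1_comp R (@ln R) (fun p => kden (Q r) (p - th)) psi _ _
  (is_derive1_ln (D0 (psi - th) rab)) (is_derive_kden_f _ _ _).
by congr is_derive; rewrite /logkerf; ring.
Qed.

Let dker1 r psi : a < r < b -> is_derive r 1 (fun s => e * logker1 (Q s) psi) (logker2 (Q r) psi / r).
Proof.
move=> rab; have dq := dQ rab.
have dV : is_derive r 1 (fun s => (kden (Q s) psi)^-1) (- (kden (Q r) psi) ^- 2 *: ((e * Q r / r) * (2 * Q r - 2 * cos psi))).
  by apply: is_deriveV => //; [exact: Dn|exact: dD].
rewrite /logker1; apply: is_derive_eq; rewrite /GRing.scale /=.
have Dn' := Dn psi rab; have r0 : r != 0 by case/andP: rab => /(le_lt_trans a0)/gt_eqF->.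
have s2 : sin psi ^+ 2 = 1 - cos psi ^+ 2 by rewrite -(cos2Dsin2 psi); ring.
rewrite /logker2 s2.
transitivity (e ^+ 2 * ((4 * Q r ^+ 2 - 2 * Q r * cos psi) / kden (Q r) psi -
   (2 * Q r ^+ 2 - 2 * Q r * cos psi) * (kden (Q r) psi) ^- 2 * Q r * (2 * Q r - 2 * cos psi)) / r).
  by field; rewrite r0 Dn'.
rewrite e2 mul1r; congr (_ / r).
have DE : kden (Q r) psi = 1 - 2 * Q r * cos psi + Q r ^+ 2 by [].
move: (kden (Q r) psi) Dn' DE => D Dn' DE.
transitivity (((4 * Q r ^+ 2 - 2 * Q r * cos psi) * D -
   (2 * Q r ^+ 2 - 2 * Q r * cos psi) * Q r * (2 * Q r - 2 * cos psi)) / D ^+ 2); first by field.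
transitivity ((4 * Q r ^+ 2 * (1 - cos psi ^+ 2) - 2 * Q r * cos psi * D) / D ^+ 2); last by field.
by congr (_ / _); rewrite DE; ring.
Qed.

Let dkerff r psi : a < r < b -> is_derive psi 1 (fun p => logkerf (Q r) (p - th)) (- logker2 (Q r) (psi - th)).
Proof.
move=> rab.
have d0 : is_derive psi (1 : R) (fun p : R => p - th) 1.
  by apply: is_derive_eq; rewrite subr0.
have := @is_derive1_comp R (@sin R) (fun p : R => p - th) psi _ _ (is_derive_sin _) d0 => d1.
have dV : is_derive psi 1 (fun s => (kden (Q r) (s - th))^-1) (- (kden (Q r) (psi - th)) ^- 2 *: (2 * Q r * sin (psi - th))).
  by apply: is_deriveV => //; [exact: Dn|exact: is_derive_kden_f].
rewrite /logkerf; apply: is_derive_eq; rewrite /GRing.scale /= /logker2.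
by field; exact: Dn.
Qed.

Let ccos : continuous (fun p : R => cos (p - th)).
Proof.
move=> p; apply: (@continuous_comp _ _ _ (fun p : R => p - th) (@cos R)); last exact: continuous_cos.
by apply: continuousB; [exact: cvg_id|exact: cst_continuous].
Qed.

Let csin : continuous (fun p : R => sin (p - th)).
Proof.
move=> p; apply: (@continuous_comp _ _ _ (fun p : R => p - th) (@sin R)); last exact: continuous_sin.
by apply: continuousB; [exact: cvg_id|exact: cst_continuous].
Qed.

Let cden r : continuous (fun p : R => kden (Q r) (p - th)).
Proof. by apply: is_derive_continuous => p; exact: is_derive_kden_f. Qed.

Let cdenV r : a < r < b -> continuous (fun p : R => (kden (Q r) (p - th))^-1).
Proof. by move=> rab p; apply: cvgV; [exact: Dn|exact: cden]. Qed.

Let cker1 r : a < r < b -> continuous (fun p => logker1 (Q r) (p - th)).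
Proof.
move=> rab; apply: continuous_mul; last exact: cdenV.
apply: continuous_sub; first by move=> x; exact: cst_continuous.
exact: continuous_scale.
Qed.

Let cker2 r : a < r < b -> continuous (fun p => logker2 (Q r) (p - th)).
Proof.
move=> rab; apply: continuous_sub.
  rewrite (_ : (fun x => _) = (fun x => 4 * Q r ^+ 2 * (sin (x - th) * sin (x - th)) * ((kden (Q r) (x - th))^-1 * (kden (Q r) (x - th))^-1))).
    apply: continuous_mul; last by apply: continuous_mul; exact: cdenV.
    by apply: continuous_scale; exact: continuous_mul.
  by apply/funext => x; rewrite -!expr2 exprVn.
apply: continuous_mul; last exact: cdenV.
exact: continuous_scale.
Qed.

Lemma kernel_harmonic : polar_harmonic a b (fun r p => logker (Q r) (p - th))
  (fun r p => e * logker1 (Q r) (p - th)) (fun r p => logkerf (Q r) (p - th))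
  (fun r p => logker2 (Q r) (p - th)).
Proof.
split.
- by move=> r p; exact: dker.
- by move=> r p; exact: dker1.
- by move=> r p; exact: dkerf.
- by move=> r p; exact: dkerff.
- by move=> r rab; apply: continuous_scale; exact: cker1.
- by move=> r rab; exact: cker2.
- move=> r rab.
  have c2 : cos (2 * pi - th) = cos (0 - th) by rewrite addrC add0r mulr_natl cosD2pi.
  have s2 : sin (2 * pi - th) = sin (0 - th) by rewrite addrC add0r mulr_natl sinD2pi.
  by rewrite /logker /logkerf /kden c2 s2.
(* All bounds rest on w <= kden <= 4, where w is the least value of |1 - q e^(i psi)|^2 over 0 <= q
   <= q0. *)
- pose w := (1 - q0) ^+ 2.
  have w0 : 0 < w by rewrite exprn_gt0// subr_gt0.
  exists (`|ln w| + `|ln 4| + 4 / w + (4 / w ^+ 2 + 2 / w)) => r p rab.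
  have q01' := q01; have /andP[Qr Qq] := Q0 rab; set D := kden (Q r) (p - th); set c := cos (p - th).
  have wD : w <= D.
    by apply: le_trans (kden_ge _ (ltW Qr)); rewrite ler_pXn2r// ?nnegrE; lra.
  have Dgt0 : 0 < D by exact: lt_le_trans w0 wD.
  have c1 : c <= 1 by exact: cos_le1.
  have c2 : -1 <= c by exact: cos_geN1.
  have D4 : D <= 4 by rewrite /D /kden -/c; nra.
  have iD : D^-1 <= w^-1 by rewrite lef_pV2 ?posrE.
  have iD0 : 0 < D^-1 by rewrite invr_gt0.
  have B1 : `|logker (Q r) (p - th)| <= `|ln w| + `|ln 4|.
    by apply: logker_bound => //; rewrite (ltW Qr).
  have B2 : `|e * logker1 (Q r) (p - th)| <= 4 / w.
    have en : `|e| = 1.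
      by apply/eqP; rewrite -sqrp_eq1// -normrX e2 normr1.
    rewrite normrM en mul1r /logker1 -/D -/c normrM [X in _ * X]ger0_norm ?(ltW iD0)//.
    by apply: ler_pM => //; [exact: ltW|rewrite ler_norml; apply/andP; split; nra].
  have B3 : `|logker2 (Q r) (p - th)| <= 4 / w ^+ 2 + 2 / w.
    rewrite /logker2 -/D -/c; apply: le_trans (ler_normB _ _) _; apply: lerD.
      rewrite normrM [X in _ * X]ger0_norm ?invr_ge0 ?exprn_ge0 ?(ltW Dgt0)//.
      apply: ler_pM => //; first by rewrite invr_ge0 exprn_ge0 ?(ltW Dgt0).
        rewrite ger0_norm; last by apply: mulr_ge0; [apply: mulr_ge0 => //|]; exact: sqr_ge0.
        have : sin (p - th) ^+ 2 <= 1 by have := cos2Dsin2 (p - th); have := sqr_ge0 (cos (p - th)); lra.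
        have : Q r ^+ 2 <= 1 by rewrite expr2; nra.
        have := sqr_ge0 (sin (p - th)); have := sqr_ge0 (Q r).
        move: (Q r ^+ 2) (sin (p - th) ^+ 2) => x y; nra.
      rewrite lef_pV2 ?posrE; [|exact: exprn_gt0|exact: exprn_gt0].
      by rewrite ler_pXn2r// nnegrE ltW.
    rewrite normrM [X in _ * X]ger0_norm ?(ltW iD0)//.
    by apply: ler_pM => //; [exact: ltW|rewrite ler_norml; apply/andP; split; nra].
  have P1 : 0 <= 4 / w by rewrite divr_ge0// ltW.
  have P2 : 0 <= 4 / w ^+ 2 by rewrite divr_ge0// exprn_ge0// ltW.
  have P3 : 0 <= 2 / w by rewrite divr_ge0// ltW.
  have P4 := normr_ge0 (ln w); have P5 := normr_ge0 (ln 4 : R).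
  by split; [apply: le_trans B1 _|apply: le_trans B2 _|apply: le_trans B3 _]; lra.
Qed.

End kernel_harmonic.

(** * Integral identities for harmonic functions in a disc *)

Section neumann_disc.
Context {R : realType}.

Lemma eq0_of_small (x C r : R) : 0 < r -> (forall s, 0 < s < r -> `|x| <= C * s) -> x = 0.
Proof.
move=> r0 H; apply/eqP; rewrite -normr_le0; apply/ler_addgt0Pl => e e0; rewrite addr0.
pose s := Num.min (r / 2) (e / (`|C| + 1)).
have C1 : 0 < `|C| + 1 by rewrite ltr_wpDl.
have s0 : 0 < s by rewrite lt_min !divr_gt0.
have sr : s < r by rewrite gt_min; apply/orP; left; lra.
have := H s; rewrite s0 sr => /(_ isT) /le_trans; apply.
apply: (@le_trans _ _ ((`|C| + 1) * s)).
  by rewrite ler_wpM2r ?(ltW s0)//; have := ler_norm C; lra.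
by rewrite -ler_pdivlMl// mulrC /s ge_min lexx orbT.
Qed.

Lemma cst_harmonic (a b k : R) : polar_harmonic a b (fun _ _ => k) (fun _ _ => 0) (fun _ _ => 0) (fun _ _ => 0).
Proof.
have c0 (k' : R) : continuous (fun _ : R => k') by move=> x; exact: cst_continuous.
split => //; try by move=> r phi _; rewrite ?mul0r ?oppr0; exact: is_derive_cst.
by exists `|k| => r phi _; split => //; rewrite normr0.
Qed.

Lemma ln_harmonic (a b : R) : 0 < a -> polar_harmonic a b (fun r _ => ln r) (fun _ _ => 1) (fun _ _ => 0) (fun _ _ => 0).
Proof.
move=> a0; have c0 (k' : R) : continuous (fun _ : R => k') by move=> x; exact: cst_continuous.
split => //; try by move=> r phi _; rewrite ?mul0r ?oppr0; exact: is_derive_cst.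
- by move=> r phi /andP[ar _]; rewrite div1r; apply: is_derive1_ln; exact: lt_trans ar.
- exists (`|ln a| + `|ln b| + 1) => r phi /andP[ar rb].
  have r0 := lt_trans a0 ar; have b0 := lt_trans r0 rb.
  have l1 : ln a <= ln r by rewrite ler_ln ?posrE// ltW.
  have l2 : ln r <= ln b by rewrite ler_ln ?posrE// ltW.
  have n1 := normr_ge0 (ln a); have n2 := normr_ge0 (ln b).
  split; rewrite ?normr0 ?normr1; [|lra|lra].
  rewrite ler_norml; apply/andP; split.
    by have := ler_norm (- ln a); rewrite normrN; lra.
  by have := ler_norm (ln b); lra.
Qed.

Lemma logker1_bound (q q0 psi : R) : 0 <= q <= q0 -> q0 < 1 -> `|logker1 q psi| <= 4 * q / (1 - q0) ^+ 2.
Proof.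
move=> /andP[qge qq] q01.
have w0 : 0 < (1 - q0) ^+ 2 by rewrite exprn_gt0// subr_gt0.
have wD : (1 - q0) ^+ 2 <= kden q psi.
  by apply: le_trans (kden_ge _ qge); rewrite ler_pXn2r// ?nnegrE; lra.
have D0 : 0 < kden q psi by exact: lt_le_trans wD.
rewrite /logker1 normrM [X in _ * X]ger0_norm ?invr_ge0 ?(ltW D0)//.
apply: ler_pM => //; first by rewrite invr_ge0 ltW.
  have c1 := cos_le1 psi; have c2 := cos_geN1 psi.
  by rewrite ler_norml; apply/andP; split; nra.
by rewrite lef_pV2 ?posrE.
Qed.

Lemma logker1_poisson (q psi : R) : 0 <= q < 1 -> logker1 q psi = 1 - (1 - q ^+ 2) / kden q psi.
Proof.
move=> q1; have D0 : kden q psi != 0 by rewrite gt_eqF// kden_gt0.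
have DE : kden q psi = 1 - 2 * q * cos psi + q ^+ 2 by [].
rewrite /logker1 (_ : _ - _ = kden q psi - (1 - q ^+ 2)); last by rewrite DE; ring.
by rewrite mulrBl divff.
Qed.

Lemma is_derive_scale (k r : R) : 0 < r -> is_derive r 1 (fun s : R => k * s) (1 * (k * r) / r).
Proof.
move=> r0; have rn : r != 0 by rewrite gt_eqF.
by apply: is_derive_eq; rewrite /GRing.scale /=; field.
Qed.

Section harmonic.
Variables (r0 B : R) (u u1 uf u2 : R -> R -> R).
Hypothesis hu : polar_harmonic 0 r0 u u1 uf u2.
Hypothesis hB : forall r phi, 0 < r < r0 -> `|u1 r phi| <= B * r.

(** Green's identity with the kernel 1 makes the flux independent of the radius, and by [hB] it is
    O(s) on the circle of radius s. *)
Lemma flux_zero r : 0 < r < r0 -> circ (u1 r) = 0.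
Proof.
move=> rr; apply: (@eq0_of_small _ (2 * pi * B) r); first by case/andP: rr.
move=> s /andP[s0 sr].
have ss : 0 < s < r0 by rewrite s0; case/andP: rr => _; exact: lt_trans.
have := green_circles (lexx 0) hu (cst_harmonic 0 r0 1) rr ss.
have E t : (fun phi => 1 * u1 t phi - 0 * u t phi) = u1 t.
  by apply/funext => x; rewrite mul1r mul0r subr0.
rewrite !E => ->; rewrite -mulrA; apply: circ_bound; first exact: (ph_cont1 hu).
by move=> x; exact: hB.
Qed.

(* Green's identity with the kernel Q s = (q / r) s, harmonic up to s = 0, where
   the circle integral vanishes. *)
Lemma circ_kernel (q th r : R) : 0 < q < 1 -> 0 < r < r0 ->
  circ (fun phi => logker q (phi - th) * u1 r phi) =
  circ (fun phi => logker1 q (phi - th) * u r phi).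
Proof.
move=> /andP[q_gt0 q1] /andP[r_gt0 rr0].
have qn : q != 0 by rewrite gt_eqF.
have rn : r != 0 by rewrite gt_eqF.
(* The kernel becomes singular at s = r / q, where Q s = 1. The midpoint b exceeds r and keeps Q
   below (1 + q) / 2. *)
pose b := (r + r / q) / 2; pose q0 := q / r * b.
have q0E : q0 = (1 + q) / 2 by rewrite /q0 /b; field; rewrite qn rn.
have q01 : q0 < 1 by rewrite q0E; lra.
have rb : r < b by rewrite /b; have : r < r / q; [rewrite ltr_pdivlMr//; nra|lra].
have b0 := lt_trans r_gt0 rb.
pose b' := Num.min b r0.
have Q0 s : 0 < s < b' -> 0 < q / r * s <= q0.
  move=> /andP[s0]; rewrite lt_min => /andP[sb _].
  by rewrite mulr_gt0 ?divr_gt0//= ler_wpM2l ?divr_ge0 ?ltW.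
have dQ (s : R) : 0 < s < b' -> is_derive s 1 (fun s : R => q / r * s) (1 * (q / r * s) / s).
  by case/andP => s0 _; exact: is_derive_scale.
have hK := kernel_harmonic th (expr1n _ 2) q01 (lexx 0) Q0 dQ.
have b'r0 : b' <= r0 by rewrite ge_min lexx orbT.
have hu' := ph_sub (lexx 0) b'r0 hu.
have rb' : 0 < r < b' by rewrite r_gt0 lt_min rb rr0.
have qrr : q / r * r = q by rewrite mulfVK.
pose J s := circ (fun phi => logker (q / r * s) (phi - th) * u1 s phi - 1 * logker1 (q / r * s) (phi - th) * u s phi).
have cK s : 0 < s < b' -> continuous (fun phi => logker (q / r * s) (phi - th) * u1 s phi).
  by move=> sb; apply: continuous_mul; [exact: (ph_cont hK sb)|exact: (ph_cont1 hu' sb)].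
have cK1 s : 0 < s < b' -> continuous (fun phi => 1 * logker1 (q / r * s) (phi - th) * u s phi).
  by move=> sb; apply: continuous_mul; [exact: (ph_cont1 hK sb)|exact: (ph_cont hu' sb)].
suff : J r = 0.
  rewrite /J circB; [|exact: cK|exact: cK1].
  rewrite qrr => /eqP; rewrite subr_eq0 => /eqP ->.
  by apply: eq_Rintegral => x _; rewrite mul1r.
have [N hN] := ph_bound hK; have [M hM] := ph_bound hu'.
(* Both terms of J s are O(s): the first because u1 is, by [hB], the second because [logker1] at (q
   / r) s is, by [logker1_bound]. *)
apply: (@eq0_of_small _ (2 * pi * (N * B + 4 * (q / r) / (1 - q0) ^+ 2 * M)) r r_gt0) => s /andP[s0 sr].
have sb' : 0 < s < b' by rewrite s0 (lt_trans sr)//; case/andP: rb'.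
rewrite [J r](green_circles (lexx 0) hu' hK rb' sb') -[leRHS]mulrA; apply: circ_bound.
  by apply: continuous_sub; [exact: cK|exact: cK1].
move=> x; have [n0 _ _] := hN s x sb'; have [m0 _ _] := hM s x sb'.
apply: le_trans (ler_normB _ _) _; rewrite mulrDl; apply: lerD.
  rewrite normrM -[leRHS]mulrA; apply: ler_pM => //; apply: hB.
  by rewrite s0 (lt_trans sr).
rewrite mul1r normrM.
have /andP[z1 z2] := Q0 _ sb'.
have := logker1_bound (x - th) _ q01.
move=> /(_ (q / r * s)); rewrite z2 (ltW z1) => /(_ isT) l1.
apply: le_trans (ler_pM _ _ l1 m0) _ => //.
by rewrite le_eqVlt; apply/orP; left; apply/eqP; ring.
Qed.

Section center.
Variable U0 : R.
Hypothesis hU0 : forall e, 0 < e -> exists2 d, 0 < d &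
  forall r phi, 0 < r < r0 -> r < d -> `|u r phi - U0| <= e.

(* Green's identity with the kernel ln r. *)
Lemma circ_mean r : 0 < r < r0 -> circ (u r) = 2 * pi * U0.
Proof.
move=> rr; apply/eqP; rewrite -subr_eq0 -normr_le0; apply/ler_addgt0Pl => e e0; rewrite addr0.
have p0 := @two_pi_gt0 R.
have [d d0 hd] := hU0 (divr_gt0 e0 p0).
pose s := Num.min r d / 2.
have m0 : 0 < Num.min r d by rewrite lt_min d0; case/andP: rr => ->.
have s0 : 0 < s by rewrite divr_gt0.
have sr : s < r by have : Num.min r d <= r; [rewrite ge_min lexx|rewrite /s; lra].
have sd : s < d by have : Num.min r d <= d; [rewrite ge_min lexx orbT|rewrite /s; lra].
have ss : 0 < s < r0 by rewrite s0; case/andP: rr => _; exact: lt_trans.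
have E t : 0 < t < r0 -> circ (fun phi => ln t * u1 t phi - 1 * u t phi) = - circ (u t).
  move=> tt; rewrite circB.
  - rewrite circZ; last exact: (ph_cont1 hu).
    by rewrite flux_zero// mulr0 sub0r circZ ?mul1r//; exact: (ph_cont hu).
  - by apply: continuous_scale; exact: (ph_cont1 hu).
  - by apply: continuous_scale; exact: (ph_cont hu).
(* The kernel ln r is bounded only away from 0, so the annulus starts at s / 2. *)
have s20 : 0 < s / 2 by rewrite divr_gt0.
have rr' : s / 2 < r < r0 by case/andP: rr => _ ->; rewrite andbT; lra.
have ss' : s / 2 < s < r0 by case/andP: ss => _ ->; rewrite andbT; lra.
have := green_circles (ltW s20) (ph_sub (ltW s20) (lexx r0) hu) (ln_harmonic r0 s20) rr' ss'.
rewrite !E// => /oppr_inj ->.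
have -> : circ (u s) - 2 * pi * U0 = circ (fun phi => u s phi - U0).
  rewrite circB ?circ_cst//; first exact: (ph_cont hu).
  by move=> x; exact: cst_continuous.
have -> : e = 2 * pi * (e / (2 * pi)) by rewrite mulrC mulfVK// gt_eqF.
apply: circ_bound => [|x]; last exact: hd.
by apply: continuous_sub; [exact: (ph_cont hu)|move=> x; exact: cst_continuous].
Qed.

End center.
End harmonic.

Lemma continuous_kden (q th : R) : continuous (fun p => kden q (p - th)).
Proof. by apply: is_derive_continuous => p; exact: is_derive_kden_f. Qed.

Lemma continuous_logker1 (q th : R) : 0 <= q < 1 -> continuous (fun p => logker1 q (p - th)).
Proof.
move=> q1; rewrite (_ : (fun p => _) = (fun p => 1 - (1 - q ^+ 2) * (kden q (p - th))^-1)); last first.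
  by apply/funext => p; rewrite logker1_poisson.
apply: continuous_sub; first by move=> x; exact: cst_continuous.
apply: continuous_scale => p; apply: cvgV; last exact: continuous_kden.
by rewrite gt_eqF// kden_gt0.
Qed.

Lemma continuous_logker (q th : R) : 0 <= q < 1 -> continuous (fun p => logker q (p - th)).
Proof.
move=> q1 p; apply: (@continuous_comp _ _ _ (fun p : R => kden q (p - th)) (@ln R)).
  exact: continuous_kden.
by apply: continuous_ln; exact: kden_gt0.
Qed.

(** The case u = 1 of [circ_kernel]. Equivalently, the Poisson kernel has mean 1. *)
Lemma circ_logker1 (q th : R) : 0 < q < 1 -> circ (fun p => logker1 q (p - th)) = 0.
Proof.
move=> q1; have B (r phi : R) : 0 < r < 2 -> `|(0 : R)| <= 0 * r.
  by rewrite normr0 mul0r.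
have r1 : 0 < (1 : R) < 2 by rewrite ltr01 ltr1n.
have := circ_kernel (cst_harmonic 0 2 1) B th q1 r1.
under eq_fun do rewrite mulr0; rewrite circ_cst mulr0 => /esym.
by under eq_fun do rewrite mulr1.
Qed.

Section neumann.
Variables (r0 B U0 a th : R) (u u1 uf u2 : R -> R -> R).
Hypothesis hu : polar_harmonic 0 r0 u u1 uf u2.
Hypothesis hB : forall r phi, 0 < r < r0 -> `|u1 r phi| <= B * r.
Hypothesis hU0 : forall e, 0 < e -> exists2 d, 0 < d &
  forall r phi, 0 < r < r0 -> r < d -> `|u r phi - U0| <= e.
Hypothesis a0 : 0 < a < r0.
Hypothesis hA : forall e, 0 < e -> exists2 C, 0 <= C &
  forall r phi, a < r < r0 -> `|u r phi - u a th| <= e + C * (r ^+ 2 * kden (a / r) (phi - th)).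

Let S r : a < r < r0 -> 0 < r < r0.
Proof. by case/andP: a0 => a1 _ /andP[/(lt_trans a1) -> ->]. Qed.

Let q1 r : a < r -> 0 < a / r < 1.
Proof.
case/andP: a0 => a1 _ ar; have r_gt0 := lt_trans a1 ar.
by rewrite divr_gt0//= ltr_pdivrMr// mul1r.
Qed.

Let q1' r : a < r -> 0 <= a / r < 1.
Proof. by move=> /q1/andP[/ltW -> ->]. Qed.

Let T r := circ (fun phi => logker (a / r) (phi - th) * u1 r phi).

Let TE r : a < r < r0 -> T r = circ (fun phi => logker1 (a / r) (phi - th) * u r phi).
Proof. by move=> /[dup] /andP[ar _] rr; apply: (circ_kernel hu hB); [exact: q1|exact: S]. Qed.

(* With Q s = a / s one has K1 = - logker1, so Green's integral is the sum of two
   terms that circ_kernel identifies: it equals 2 T. *)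
Let T_cst r r' : a < r < r0 -> a < r' < r0 -> T r = T r'.
Proof.
move=> ra ra'; case/andP: a0 => a_gt0 ar0.
(* Starting strictly above a keeps a / s at most a / a' < 1, as uniform bounds on the kernel
   require. *)
pose a' := (a + Num.min r r') / 2.
have m : a < Num.min r r' by rewrite lt_min; case/andP: ra => ->; case/andP: ra' => ->.
have aa' : a < a' by rewrite /a'; lra.
have a'm : a' < Num.min r r' by rewrite /a'; lra.
have rr : a' < r < r0.
  by case/andP: ra => _ ->; rewrite andbT (lt_le_trans a'm)// ge_min lexx.
have rr' : a' < r' < r0.
  by case/andP: ra' => _ ->; rewrite andbT (lt_le_trans a'm)// ge_min lexx orbT.
have a'_gt0 := lt_trans a_gt0 aa'.
have Q0 s : a' < s < r0 -> 0 < a / s <= a / a'.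
  move=> /andP[s0 _]; have s_gt0 := lt_trans a'_gt0 s0.
  rewrite divr_gt0//= ler_wpM2l ?(ltW a_gt0)// lef_pV2 ?posrE//; exact: ltW.
have dQ (s : R) : a' < s < r0 -> is_derive s 1 (fun s : R => a / s) (-1 * (a / s) / s).
  move=> /andP[s0 _]; have sn : s != 0 by rewrite gt_eqF// (lt_trans a'_gt0 s0).
  have dV : is_derive s 1 (fun s : R => s^-1) (- s ^- 2 *: 1) by exact: is_deriveV.
  by apply: is_derive_eq; rewrite /GRing.scale /=; field.
have e1 : (-1 : R) ^+ 2 = 1 by rewrite sqrrN expr1n.
have /andP[_ q01] := q1 aa'.
have hK := kernel_harmonic th e1 q01 (ltW a'_gt0) Q0 dQ.
have E s : a' < s < r0 -> circ (fun phi => logker (a / s) (phi - th) * u1 s phi -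
    -1 * logker1 (a / s) (phi - th) * u s phi) = 2 * T s.
  move=> ss; have sa : a < s < r0 by case/andP: ss => /(lt_trans aa') -> ->.
  have /andP[as_ _] := sa.
  rewrite circB.
  - have -> : circ (fun x => -1 * logker1 (a / s) (x - th) * u s x) = - T s.
      rewrite -[RHS]mulN1r TE// -circZ.
        by apply: eq_Rintegral => x _; rewrite mulrA.
      by apply: continuous_mul; [exact: continuous_logker1 (q1' as_)|exact: (ph_cont hu (S sa))].
    by rewrite -/(T s); ring.
  - by apply: continuous_mul; [exact: continuous_logker (q1' as_)|exact: (ph_cont1 hu (S sa))].
  - apply: continuous_mul; last exact: (ph_cont hu (S sa)).
    by apply: continuous_scale; exact: continuous_logker1 (q1' as_).
have := green_circles (ltW a'_gt0) (ph_sub (ltW a'_gt0) (lexx r0) hu) hK rr rr'.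
rewrite !E// => /mulfI; apply; by rewrite pnatr_eq0.
Qed.

(* logker1 is 1 minus the Poisson kernel P; hA bounds |u - u a th| by e plus a
   multiple of r^2 kden, and P kden = 1 - (a / r)^2 vanishes as r -> a. *)
Lemma neumann_disc r : a < r < r0 ->
  circ (fun phi => logker (a / r) (phi - th) * u1 r phi) = 2 * pi * (U0 - u a th).
Proof.
move=> ra; rewrite -/(T r); apply/eqP; rewrite -subr_eq0 -normr_le0.
case/andP: a0 => a_gt0 ar0.
apply/ler_addgt0Pl => e e0; rewrite addr0.
have p0 := @two_pi_gt0 R.
(* Two error terms will each integrate to at most 2 pi e' = e / 2. *)
pose e' := e / (2 * pi) / 2.
have e'0 : 0 < e' by rewrite !divr_gt0.
have [C C0 hC] := hA e'0.
have C1 : 0 < C + 1 by rewrite ltr_wpDl.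
have r0_gt0 := lt_trans a_gt0 ar0.
(* The first bound keeps s = a + h below r0. The second gives C (s^2 - a^2) <= e', because s^2 - a^2
   = h (s + a) <= 2 r0 h; C + 1 replaces C, which may be 0, in the denominator. *)
pose h := Num.min ((r0 - a) / 2) (e' / (C + 1) / (2 * r0)).
have h0 : 0 < h.
  rewrite lt_min; apply/andP; split; first by lra.
  by apply: divr_gt0; [exact: divr_gt0|rewrite mulr_gt0].
have h1 : h <= (r0 - a) / 2 by rewrite ge_min lexx.
have h2 : h <= e' / (C + 1) / (2 * r0) by rewrite ge_min lexx orbT.
pose s := a + h.
have ss : a < s < r0 by rewrite /s; apply/andP; split; lra.
have s_gt0 : 0 < s by case/andP: (S ss).
have sn : s != 0 by rewrite gt_eqF.
have s2 : C * (s ^+ 2 - a ^+ 2) <= e'.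
  have hr : h * (2 * r0) <= e' / (C + 1) by rewrite -ler_pdivlMr// mulr_gt0.
  have hr' : h * (2 * r0) * (C + 1) <= e' by rewrite -ler_pdivlMr.
  apply: le_trans hr'.
  have -> : s ^+ 2 - a ^+ 2 = h * (s + a) by rewrite /s; ring.
  rewrite mulrC; apply: ler_pM => //; [| |lra].
    by rewrite mulr_ge0 ?(ltW h0)// addr_ge0 ?ltW.
  by rewrite ler_wpM2l ?(ltW h0)//; case/andP: ss; lra.
rewrite (T_cst ra ss) (TE ss).
have /andP[as_ sr0] := ss; have q01 := q1' as_; have q01s := q1 as_.
set q := a / s in q01 q01s *.
have cu := ph_cont hu (S ss).
have c1 := @continuous_logker1 q th q01.
have cc (k : R) : continuous (fun _ : R => k) by move=> x; exact: cst_continuous.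
have cP : continuous (fun p => 1 - logker1 q (p - th)) by exact: continuous_sub.
have cD := @continuous_kden q th.
have P0 p : 0 <= 1 - logker1 q (p - th).
  rewrite logker1_poisson// opprB addrCA subrr addr0 divr_ge0 ?(ltW (kden_gt0 _ q01))//.
  by case/andP: q01 => ? ?; nra.
have PD p : (1 - logker1 q (p - th)) * kden q (p - th) = 1 - q ^+ 2.
  by rewrite logker1_poisson// opprB addrCA subrr addr0 mulfVK// gt_eqF// kden_gt0.
have cPu : continuous (fun p => (1 - logker1 q (p - th)) * (u s p - u a th)).
  by apply: continuous_mul => //; exact: continuous_sub.
have -> : circ (fun p => logker1 q (p - th) * u s p) - 2 * pi * (U0 - u a th) =
    - circ (fun p => (1 - logker1 q (p - th)) * (u s p - u a th)).
  (* With P = 1 - logker1, split logker1 u into u - P (u - u a th) - u a th P; the first and last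
     integrals are 2 pi U0 and 2 pi (u a th). *)
  have -> : (fun p => logker1 q (p - th) * u s p) =
      (fun p => u s p - ((1 - logker1 q (p - th)) * (u s p - u a th) + u a th * (1 - logker1 q (p - th)))).
    by apply/funext => p; ring.
  rewrite circB//; last first.
    by move=> p; apply: cvgD; [exact: cPu|exact: (@continuous_scale R (u a th) _ cP p)].
  rewrite circD//; last exact: continuous_scale.
  rewrite circZ// circB// circ_cst circ_logker1//.
  rewrite (circ_mean hu hB hU0 (S ss)); ring.
rewrite normrN.
apply: (@le_trans _ _ (circ (fun p => e' * (1 - logker1 q (p - th)) + C * (s ^+ 2 * (1 - q ^+ 2))))).
  apply: circ_norm_le => //.
    by move=> p; apply: cvgD; [exact: (@continuous_scale R e' _ cP p)|exact: cst_continuous].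
  move=> p; rewrite normrM ger0_norm//.
  apply: le_trans (ler_wpM2l (P0 p) (hC s p ss)) _.
  by rewrite -(PD p) -/q le_eqVlt; apply/orP; left; apply/eqP; ring.
rewrite circD//; last exact: continuous_scale.
rewrite circZ// circB// !circ_cst circ_logker1//.
have -> : s ^+ 2 * (1 - q ^+ 2) = s ^+ 2 - a ^+ 2 by rewrite /q; field.
have -> : e = 2 * pi * e' + 2 * pi * e' 
  by rewrite /e'; have : (pi : R) != 0 by [rewrite gt_eqF// pi_gt0]; move: (pi : R) => p pn; field.
rewrite mulr1 subr0 mulrC; apply: lerD => //.
by rewrite ler_wpM2l// ltW.
Qed.

End neumann.
End neumann_disc.

(** * Stereographic coordinates *)

Section stereographic_chart.
Context {R : realType}.
Implicit Types (r phi : R).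

(* hgt and chart_rad are the height and the radius of the parallel circle with
   stereographic radius r. *)
Definition hgt r : R := (1 - r ^+ 2) / (1 + r ^+ 2).
Definition chart_rad r : R := 2 * r / (1 + r ^+ 2).

Lemma chart_den r : 1 + r ^+ 2 != 0.
Proof. by rewrite gt_eqF// ltr_wpDr ?sqr_ge0. Qed.

Lemma hgt_rad r : hgt r ^+ 2 + chart_rad r ^+ 2 = 1.
Proof. by rewrite /hgt /chart_rad; field; exact: chart_den. Qed.

Lemma rad_ge0 r : 0 <= r -> 0 <= chart_rad r.
Proof. by move=> r0; rewrite /chart_rad divr_ge0 ?mulr_ge0// addr_ge0// sqr_ge0. Qed.

Lemma rad_le r : 0 <= r -> chart_rad r <= 2 * r.
Proof.
move=> r0; rewrite /chart_rad ler_pdivrMr; last by rewrite ltr_wpDr ?sqr_ge0.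
by have := sqr_ge0 r; nra.
Qed.

Lemma sub1_hgt r : 1 - hgt r = r * chart_rad r.
Proof. by rewrite /hgt /chart_rad; field; exact: chart_den. Qed.

Lemma rad_sqrt r : 0 <= r -> Num.sqrt (1 - hgt r ^+ 2) = chart_rad r.
Proof.
move=> r0; have -> : 1 - hgt r ^+ 2 = chart_rad r ^+ 2 by rewrite -(hgt_rad r); ring.
by rewrite sqrtr_sqr ger0_norm// rad_ge0.
Qed.

Lemma hgt_le1 r : hgt r <= 1.
Proof. by have := hgt_rad r; have := sqr_ge0 (chart_rad r); nra. Qed.

Lemma hgt_geN1 r : -1 <= hgt r.
Proof. by have := hgt_rad r; have := sqr_ge0 (chart_rad r); nra. Qed.

Lemma hgt_lt r r' : 0 <= r -> r < r' -> hgt r' < hgt r.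
Proof.
move=> r0 rr; have p (x : R) : 0 < 1 + x ^+ 2 by rewrite ltr_wpDr ?sqr_ge0.
rewrite /hgt ltr_pdivrMr// mulrAC ltr_pdivlMr//; nra.
Qed.

(** The stereographic radius is the tangent of half the colatitude. *)
Lemma hgt_surj t : -1 < t <= 1 -> exists2 r, 0 <= r & hgt r = t.
Proof.
move=> /andP[t1 t2]; exists (Num.sqrt ((1 - t) / (1 + t))); first exact: sqrtr_ge0.
have tn : 1 + t != 0 by rewrite gt_eqF//; lra.
rewrite /hgt sqr_sqrtr; last by rewrite divr_ge0//; lra.
have e : 1 + (1 - t) / (1 + t) = 2 / (1 + t) by field.
by rewrite e; field.
Qed.

(** [hgt] and [chart_rad] are the cosine and the sine of the colatitude theta, and r d/dr is sin
    theta d/dtheta; this explains the isolated factor 1 / r here and in [is_derive_rad]. *)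
Lemma is_derive_hgt r : r != 0 -> is_derive r 1 hgt (r^-1 * - chart_rad r ^+ 2).
Proof.
move=> r0; have dn := chart_den r.
have dV : is_derive r 1 (fun s : R => (1 + s ^+ 2)^-1) (- (1 + r ^+ 2) ^- 2 *: (2 * r)).
  apply: is_deriveV => //; apply: is_derive_eq; rewrite /GRing.scale /=; ring.
by rewrite /hgt; apply: is_derive_eq; rewrite /GRing.scale /= /chart_rad; field; rewrite r0 dn.
Qed.

Lemma is_derive_rad r : r != 0 -> is_derive r 1 chart_rad (r^-1 * (chart_rad r * hgt r)).
Proof.
move=> r0; have dn := chart_den r.
have dV : is_derive r 1 (fun s : R => (1 + s ^+ 2)^-1) (- (1 + r ^+ 2) ^- 2 *: (2 * r)).
  apply: is_deriveV => //; apply: is_derive_eq; rewrite /GRing.scale /=; ring.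
by rewrite /chart_rad; apply: is_derive_eq; rewrite /GRing.scale /= /hgt; field; rewrite r0 dn.
Qed.

Lemma is_derive_dot (g c : R -> 'rV[R]_3) (g' c' : 'rV[R]_3) (t : R) :
  (forall i, is_derive t 1 (fun s => g s 0 i) (g' 0 i)) ->
  (forall i, is_derive t 1 (fun s => c s 0 i) (c' 0 i)) ->
  is_derive t 1 (fun s => dot (g s) (c s)) (dot g' (c t) + dot (g t) c').
Proof.
move=> dg dc; under eq_fun do rewrite dotE.
have g0 := dg 0; have g1 := dg 1; have g2 := dg 2%:R.
have c0 := dc 0; have c1 := dc 1; have c2 := dc 2%:R.
by apply: is_derive_eq; rewrite !dotE /GRing.scale /=; ring.
Qed.

Lemma comb_coord (k l : R) (u v : 'rV[R]_3) i : (k *: u + l *: v) 0 i = k * u 0 i + l * v 0 i.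
Proof. by rewrite !mxE. Qed.

Section frame.
Variables (e1 e2 zeta : 'rV[R]_3).
Hypothesis fr : orthonormal_frame e1 e2 zeta.

(* chart1 = r d/dr chart, chart11 = r d/dr chart1, chartf = d/dphi chart and
   chartff = d/dphi chartf. *)
Definition wdir phi : 'rV[R]_3 := cos phi *: e1 + sin phi *: e2.
Definition wdir' phi : 'rV[R]_3 := - sin phi *: e1 + cos phi *: e2.
Definition chart r phi : 'rV[R]_3 := hgt r *: zeta + chart_rad r *: wdir phi.
Definition merid r phi : 'rV[R]_3 := - chart_rad r *: zeta + hgt r *: wdir phi.
Definition chart1 r phi : 'rV[R]_3 := chart_rad r *: merid r phi.
Definition chartf r phi : 'rV[R]_3 := chart_rad r *: wdir' phi.
Definition chart11 r phi : 'rV[R]_3 :=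
  (- (2 * chart_rad r ^+ 2 * hgt r)) *: zeta + (chart_rad r * (hgt r ^+ 2 - chart_rad r ^+ 2)) *: wdir phi.
Definition chartff r phi : 'rV[R]_3 := - chart_rad r *: wdir phi.

Let fr' : [/\ dot e1 e1 = 1, dot e2 e2 = 1 & dot zeta zeta = 1].
Proof. by case: fr => -[/OmegaE ? /OmegaE ? /OmegaE ?] _. Qed.

Lemma dot_wdir a b : dot (wdir a) (wdir b) = cos (b - a).
Proof.
have [h1 h2 h3] := fr'; case: fr => _ [h12 h13 h23].
by rewrite /wdir !dot_bilin (dotC e2 e1) h1 h2 h12 cosB; ring.
Qed.

Lemma dot_wdir' a : dot (wdir' a) (wdir' a) = 1.
Proof.
have [h1 h2 h3] := fr'; case: fr => _ [h12 h13 h23].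
by rewrite /wdir' !dot_bilin (dotC e2 e1) h1 h2 h12; apply: etrans (cos2Dsin2 a); ring.
Qed.

Lemma dot_wdir_wdir' a : dot (wdir a) (wdir' a) = 0.
Proof.
have [h1 h2 h3] := fr'; case: fr => _ [h12 h13 h23].
by rewrite /wdir /wdir' !dot_bilin (dotC e2 e1) h1 h2 h12; ring.
Qed.

Lemma dot_zeta_wdir a : dot zeta (wdir a) = 0.
Proof.
case: fr => _ [h12 h13 h23].
by rewrite /wdir !dot_bilin (dotC zeta e1) (dotC zeta e2) h13 h23; ring.
Qed.

Lemma dot_zeta_wdir' a : dot zeta (wdir' a) = 0.
Proof.
case: fr => _ [h12 h13 h23].
by rewrite /wdir' !dot_bilin (dotC zeta e1) (dotC zeta e2) h13 h23; ring.
Qed.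

Lemma wdir_unit a : dot (wdir a) (wdir a) = 1.
Proof. by rewrite dot_wdir subrr cos0. Qed.

Lemma dot_chart r phi r' phi' :
  dot (chart r phi) (chart r' phi') = hgt r * hgt r' + chart_rad r * chart_rad r' * cos (phi' - phi).
Proof.
have [h1 h2 h3] := fr'.
rewrite -dot_wdir /chart; have := dot_zeta_wdir phi; have := dot_zeta_wdir phi'.
move: (wdir phi) (wdir phi') => w w' z1 z2.
by rewrite !dot_bilin (dotC w zeta) z1 z2 h3; ring.
Qed.

Lemma chart_Omega r phi : Omega (chart r phi).
Proof. by apply/OmegaE; rewrite dot_chart subrr cos0; apply: etrans (hgt_rad r); ring. Qed.

Lemma dot_zeta_chart r phi : dot zeta (chart r phi) = hgt r.
Proof.
have [h1 h2 h3] := fr'.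
rewrite /chart; have := dot_zeta_wdir phi; move: (wdir phi) => w z1.
by rewrite !dot_bilin z1 h3; ring.
Qed.

Lemma chart_circle r phi : 0 <= r -> chart r phi = circle e1 e2 zeta (hgt r) phi.
Proof. by move=> r0; rewrite /circle rad_sqrt. Qed.

Lemma merid_frame r phi : orthonormal_frame (merid r phi) (wdir' phi) (chart r phi).
Proof.
have [h1 h2 h3] := fr'.
have z1 := dot_zeta_wdir phi; have z2 := dot_zeta_wdir' phi.
have w1 := wdir_unit phi; have w2 := dot_wdir' phi; have w3 := dot_wdir_wdir' phi.
have p := hgt_rad r.
have cO := chart_Omega r phi.
rewrite /merid /chart in cO *; move: (wdir phi) (wdir' phi) z1 z2 w1 w2 w3 cO => w w' z1 z2 w1 w2 w3 cO.
split; first split => //.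
- by apply/OmegaE; rewrite !dot_bilin (dotC w) z1 w1 h3; apply: etrans p; ring.
- exact/OmegaE.
split.
- by rewrite !dot_bilin z2 w3; ring.
- by rewrite !dot_bilin (dotC w zeta) z1 w1 h3; ring.
- by rewrite !dot_bilin (dotC w' zeta) (dotC w') z2 w3; ring.
Qed.

(** In conformal coordinates the Laplacian of the position vector of the sphere is normal to it, so
    a tangential gradient annihilates it. *)
Lemma chart_laplace r phi : chart11 r phi + chartff r phi = (- (2 * chart_rad r ^+ 2)) *: chart r phi.
Proof.
apply/rowP => i; rewrite !mxE.
have e : hgt r ^+ 2 = 1 - chart_rad r ^+ 2 by rewrite -(hgt_rad r); ring.
by rewrite e; ring.
Qed.

(** Half the squared chord. Stereographic projection turns |x - x'|^2 into 4 |z - z'|^2 / ((1 +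
    |z|^2) (1 + |z'|^2)), and |z - z'|^2 = r^2 kden (r' / r). *)
Lemma dot_chart_kden r phi r' phi' : 0 < r ->
  1 - dot (chart r' phi') (chart r phi) =
  2 * (r ^+ 2 * kden (r' / r) (phi - phi')) / ((1 + r ^+ 2) * (1 + r' ^+ 2)).
Proof.
move=> r0; have rn : r != 0 by rewrite gt_eqF.
rewrite dot_chart /hgt /chart_rad /kden.
by move: (cos _) (chart_den r) (chart_den r') => c d d'; field; rewrite rn d d'.
Qed.

Lemma is_derive_wdir phi i : is_derive phi 1 (fun s => wdir s 0 i) (wdir' phi 0 i).
Proof.
rewrite (_ : (fun s => _) = (fun s => cos s * e1 0 i + sin s * e2 0 i)); last first.
  by apply/funext => s; rewrite !mxE.
by apply: is_derive_eq; rewrite !mxE /GRing.scale /=; ring.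
Qed.

Lemma is_derive_wdir' phi i : is_derive phi 1 (fun s => wdir' s 0 i) (- wdir phi 0 i).
Proof.
rewrite (_ : (fun s => _) = (fun s => - sin s * e1 0 i + cos s * e2 0 i)); last first.
  by apply/funext => s; rewrite !mxE.
by apply: is_derive_eq; rewrite !mxE /GRing.scale /=; ring.
Qed.

Lemma is_derive_chart_f r phi i : is_derive phi 1 (fun s => chart r s 0 i) (chartf r phi 0 i).
Proof.
have dw := is_derive_wdir phi i.
rewrite (_ : (fun s => _) = (fun s => hgt r * zeta 0 i + chart_rad r * wdir s 0 i)); last first.
  by apply/funext => s; rewrite [LHS]mxE [X in X + _]mxE [X in _ + X]mxE.
by apply: is_derive_eq; rewrite [RHS]mxE /GRing.scale /=; ring.
Qed.

Lemma is_derive_chartf r phi i : is_derive phi 1 (fun s => chartf r s 0 i) (chartff r phi 0 i).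
Proof.
have dw := is_derive_wdir' phi i.
rewrite (_ : (fun s => _) = (fun s => chart_rad r * wdir' s 0 i)); last first.
  by apply/funext => s; rewrite [LHS]mxE.
by apply: is_derive_eq; rewrite [RHS]mxE /GRing.scale /=; ring.
Qed.

Lemma is_derive_chart1_f r phi i :
  is_derive phi 1 (fun s => chart1 r s 0 i) (chart_rad r * hgt r * wdir' phi 0 i).
Proof.
have dw := is_derive_wdir phi i.
rewrite (_ : (fun s => _) = (fun s => chart_rad r * (- chart_rad r * zeta 0 i + hgt r * wdir s 0 i))); last first.
  by apply/funext => s; rewrite [LHS]mxE [X in _ * X]mxE [X in X + _]mxE [X in _ + X]mxE.
by apply: is_derive_eq; rewrite /GRing.scale /=; ring.
Qed.

Lemma is_derive_chart_r r phi i : r != 0 ->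
  is_derive r 1 (fun s => chart s phi 0 i) ((r^-1 *: chart1 r phi) 0 i).
Proof.
move=> r0; have dh := is_derive_hgt r0; have dr := is_derive_rad r0.
rewrite (_ : (fun s => _) = (fun s => hgt s * zeta 0 i + chart_rad s * wdir phi 0 i)); last first.
  by apply/funext => s; rewrite [LHS]mxE [X in X + _]mxE [X in _ + X]mxE.
have -> : (r^-1 *: chart1 r phi) 0 i = r^-1 * (chart_rad r * (- chart_rad r * zeta 0 i + hgt r * wdir phi 0 i)).
  by rewrite [LHS]mxE [X in _ * X]mxE [X in _ * (_ * X)]mxE [X in _ * (_ * (X + _))]mxE [X in _ * (_ * (_ + X))]mxE.
by apply: is_derive_eq; rewrite /GRing.scale /=; ring.
Qed.

Lemma is_derive_chart1_r r phi i : r != 0 ->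
  is_derive r 1 (fun s => chart1 s phi 0 i) ((r^-1 *: chart11 r phi) 0 i).
Proof.
move=> r0; have dh := is_derive_hgt r0; have dr := is_derive_rad r0.
rewrite (_ : (fun s => _) = (fun s => chart_rad s * (- chart_rad s * zeta 0 i + hgt s * wdir phi 0 i))); last first.
  by apply/funext => s; rewrite [LHS]mxE [X in _ * X]mxE [X in X + _]mxE [X in _ + X]mxE.
have -> : (r^-1 *: chart11 r phi) 0 i = r^-1 * (- (2 * chart_rad r ^+ 2 * hgt r) * zeta 0 i + chart_rad r * (hgt r ^+ 2 - chart_rad r ^+ 2) * wdir phi 0 i).
  by rewrite [LHS]mxE /chart11 comb_coord.
by apply: is_derive_eq; rewrite /GRing.scale /=; ring.
Qed.

End frame.
End stereographic_chart.

Lemma is_derive_cvg (R : realType) (f : R -> R) (t d : R) :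
  is_derive t 1 f d -> f s @[s --> t] --> f t.
Proof. by move=> [df _]; apply: differentiable_continuous; apply/derivable1_diffP. Qed.

(** * Harmonic functions on the cap *)

Section harmonic_on_cap.
Context {R : realType}.
Implicit Types (r phi : R).
Variables (rho : R) (zeta : 'rV[R]_3).
Hypothesis hzeta : Omega zeta.
Hypothesis rho_gt0 : 0 < rho.
Hypothesis rho_lt2 : rho < 2.
Let Gam := cap rho zeta.
Variables (U : 'rV[R]_3 -> R) (G : 'rV[R]_3 -> 'rV[R]_3) (H : 'I_3 -> 'rV[R]_3 -> 'rV[R]_3).
Hypothesis cU : {within closure Gam, continuous U}.
Hypothesis dU : forall x, Gam x -> sderivable U x.
Hypothesis GE : forall x, Gam x -> G x = sgrad U x.
Hypothesis cG : forall i, {within closure Gam, continuous (fun x => G x 0 i)}.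
Hypothesis dG : forall i x, Gam x -> sderivable (fun y => G y 0 i) x.
Hypothesis HE : forall i x, Gam x -> H i x = sgrad (fun y => G y 0 i) x.
Hypothesis cH : forall i j, {within closure Gam, continuous (fun x => H i x 0 j)}.
Hypothesis bel : forall x, Gam x -> beltrami U x = 0.

Let GamO : Gam `<=` @Omega R. Proof. exact: cap_Omega. Qed.
Let GamC : Gam `<=` closure Gam. Proof. exact: subset_closure. Qed.

Lemma within_continuous_bounded (f : 'rV[R]_3 -> R) : {within closure Gam, continuous f} ->
  exists M, forall x, closure Gam x -> `|f x| <= M.
Proof.
move=> cf; have cK : compact (closure Gam) by exact: compact_closure_cap.
have := compact_bounded (continuous_compact cf cK).
move=> [M [_ hM]]; exists (`|M| + 1) => x Kx; apply: (hM (`|M| + 1)).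
  by rewrite (le_lt_trans (ler_norm M))// ltrDl.
by exists x.
Qed.

Lemma jet_bounded : exists M, forall x, closure Gam x ->
  [/\ `|U x| <= M, (forall i, `|G x 0 i| <= M) & forall i j, `|H i x 0 j| <= M].
Proof.
have [M0 h0] := within_continuous_bounded cU.
have /choice[M1 h1] : forall i, exists M, forall x, closure Gam x -> `|G x 0 i| <= M.
  by move=> i; exact: within_continuous_bounded (@cG i).
have /choice[M2 h2] : forall i : 'I_3 * 'I_3, exists M, forall x, closure Gam x -> `|H i.1 x 0 i.2| <= M.
  by move=> i; exact: within_continuous_bounded (@cH i.1 i.2).
exists (`|M0| + \sum_i `|M1 i| + \sum_i `|M2 i|) => x Kx.
have s1 : 0 <= \sum_i `|M1 i| by exact: sumr_ge0.
have s2 : 0 <= \sum_i `|M2 i| by exact: sumr_ge0.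
split.
- by apply: le_trans (h0 x Kx) _; have := ler_norm M0; lra.
- move=> i; apply: le_trans (h1 i x Kx) _; have := ler_norm (M1 i); have := normr_ge0 M0.
  have : `|M1 i| <= \sum_i `|M1 i| by rewrite (bigD1 i)//= lerDl sumr_ge0.
  lra.
- move=> i j; apply: le_trans (h2 (i, j) x Kx) _; have := ler_norm (M2 (i, j)); have := normr_ge0 M0.
  have : `|M2 (i, j)| <= \sum_i `|M2 i| by rewrite (bigD1 (i, j))//= lerDl sumr_ge0.
  lra.
Qed.

Lemma cvg_comp_closure (T : Type) (F : set_system T) {FF : Filter F} (f : T -> 'rV[R]_3) x
    (g : 'rV[R]_3 -> R) :
  f t @[t --> F] --> x -> (forall t, closure Gam (f t)) -> closure Gam x ->
  {within closure Gam, continuous g} -> g (f t) @[t --> F] --> g x.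
Proof.
move=> fx fK Kx cg.
have gx : g y @[y --> within (closure Gam) (nbhs x)] --> g x.
  by have := cg x; rewrite /continuous_at /= nbhs_subspace_in.
have fw : f t @[t --> F] --> within (closure Gam) (nbhs x).
  move=> A; rewrite /within /= => KA.
  have : \forall t \near F, closure Gam (f t) -> A (f t) := fx _ KA.
  by apply: filterS => t; apply; exact: fK.
exact: (cvg_comp _ _ fw gx).
Qed.

(** Continuity stated with Euclidean distance, because chords are computed through [dot]; Euclidean
    length dominates every coordinate and hence the sup norm. *)
Lemma closure_continuous_dist (g : 'rV[R]_3 -> R) x (e : R) : closure Gam x ->
  {within closure Gam, continuous g} -> 0 < e ->
  exists2 d, 0 < d & forall y, closure Gam y -> dot (y - x) (y - x) < d ^+ 2 -> `|g y - g x| <= e.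
Proof.
move=> Kx cg e0.
have gx : g y @[y --> within (closure Gam) (nbhs x)] --> g x.
  by have := cg x; rewrite /continuous_at /= nbhs_subspace_in.
have /cvgrPdist_le/(_ _ e0) := gx; rewrite near_withinE => /nbhs_ballP[d /= d0 hd].
exists d => // y Ky yd; rewrite distrC; apply: hd => //.
rewrite -ball_normE /ball_ /= distrC; apply: norm_lt_coord => // i.
rewrite -(ltr_pXn2r (n := 2)) ?nnegrE// ?(ltW d0)// real_normK ?num_real//.
apply: le_lt_trans yd; rewrite /dot (bigD1 i)//= -expr2 lerDl.
by apply: sumr_ge0 => j _; rewrite -expr2 sqr_ge0.
Qed.

Lemma G_tangential x : Gam x -> dot (G x) x = 0.
Proof. by move=> Gx; apply: (sgrad_tangential GamO GamC (near_cap Gx) Gx dU GE cG). Qed.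

Lemma H_tangential i x : Gam x -> dot (H i x) x = 0.
Proof.
move=> Gx; exact: (sgrad_tangential GamO GamC (near_cap Gx) Gx (@dG i) (@HE i) (@cH i)).
Qed.

Lemma H_trace x : Gam x -> \sum_i H i x 0 i = 0.
Proof.
move=> Gx; apply: etrans (bel Gx); apply: eq_bigr => i _; rewrite HE//.
have [|-> _ //] := @sgrad_local R (fun y => G y 0 i) (fun y => sgrad U y 0 i) Gam x (near_cap Gx).
by move=> y Gy; rewrite GE.
Qed.

Section chart.
Variables (e1 e2 : 'rV[R]_3).
Hypothesis fr : orthonormal_frame e1 e2 zeta.
Variable r0 : R.
Hypothesis r0_gt0 : 0 < r0.
Hypothesis hgt_r0 : hgt r0 = 1 - rho.

Let X := chart e1 e2 zeta.
Let X1 := chart1 e1 e2 zeta.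
Let Xf := chartf e1 e2.
Let X11 := chart11 e1 e2 zeta.
Let Xff := chartff e1 e2.

Lemma chart_cap r phi : 0 <= r < r0 -> Gam (X r phi).
Proof.
move=> /andP[rge rr]; apply/(capE rho zeta); split; first exact: chart_Omega fr _ _.
by rewrite (dot_zeta_chart fr) -hgt_r0 hgt_lt.
Qed.

Lemma chart_closure_cap r phi : 0 <= r <= r0 -> closure Gam (X r phi).
Proof.
move=> /andP[rge]; rewrite le_eqVlt => /predU1P[->|rr]; last first.
  by apply/GamC/chart_cap; rewrite rge.
rewrite (closure_capE hzeta rho_gt0 rho_lt2); split; first exact: chart_Omega fr _ _.
by rewrite (dot_zeta_chart fr) hgt_r0.
Qed.

Definition pu r phi := U (X r phi).
(** Written with the extension [G] instead of a derivative of [U], so that it is defined and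
    continuous on the boundary circle r = r0 as well. *)
Definition pu1 r phi := dot (G (X r phi)) (X1 r phi).
Definition puf r phi := dot (G (X r phi)) (Xf r phi).
(** Product rule for r d/dr of G . X1: the row collects the derivatives of the components of G along
    X1, and X11 is the derivative of X1. *)
Definition pu2 r phi :=
  dot (\row_i dot (H i (X r phi)) (X1 r phi)) (X1 r phi) + dot (G (X r phi)) (X11 r phi).

Let S r : 0 < r < r0 -> 0 <= r < r0. Proof. by move=> /andP[/ltW -> ->]. Qed.

Let S' r : 0 < r < r0 -> 0 <= r <= r0. Proof. by move=> /andP[/ltW -> /ltW ->]. Qed.

Let dXr r phi : r != 0 -> is_derive r 1 (fun s => X s phi) (r^-1 *: X1 r phi).
Proof. by move=> rn; apply: is_derive_row => i; exact: is_derive_chart_r. Qed.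

Let dXf r phi : is_derive phi 1 (X r) (Xf r phi).
Proof. by apply: is_derive_row => i; exact: is_derive_chart_f. Qed.

Let dUc (c : R -> 'rV[R]_3) (t : R) c' : Gam (c t) -> (forall s, Omega (c s)) -> is_derive t 1 c c' ->
  is_derive t 1 (fun s => U (c s)) (dot (G (c t)) c').
Proof.
move=> Gc cO dc.
exact: (is_derive_sphere_curve GamO GamC (near_cap Gc) Gc dU GE cG erefl cO dc).
Qed.

Let dGc i (c : R -> 'rV[R]_3) (t : R) c' : Gam (c t) -> (forall s, Omega (c s)) -> is_derive t 1 c c' ->
  is_derive t 1 (fun s => G (c s) 0 i) (dot (H i (c t)) c').
Proof.
move=> Gc cO dc.
exact: (is_derive_sphere_curve GamO GamC (near_cap Gc) Gc (@dG i) (@HE i) (@cH i) erefl cO dc).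
Qed.

Let XO r phi : Omega (X r phi). Proof. exact: chart_Omega. Qed.

Let d_u_r r phi : 0 < r < r0 -> is_derive r 1 (pu^~ phi) (pu1 r phi / r).
Proof.
move=> rr; have rn : r != 0 by case/andP: rr => /gt_eqF->.
have := @dUc (fun s => X s phi) r _ (chart_cap phi (S rr)) (fun s => XO s phi) (dXr phi rn).
by rewrite dotZr mulrC.
Qed.

Let d_u_f r phi : 0 < r < r0 -> is_derive phi 1 (pu r) (puf r phi).
Proof.
by move=> rr; apply: (@dUc (X r) phi _ (chart_cap phi (S rr)) (XO r) (dXf r phi)).
Qed.

Let d_u1_r r phi : 0 < r < r0 -> is_derive r 1 (pu1^~ phi) (pu2 r phi / r).
Proof.
move=> rr; have rn : r != 0 by case/andP: rr => /gt_eqF->.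
have dg i : is_derive r 1 (fun s => G (X s phi) 0 i)
    ((\row_i dot (H i (X r phi)) (r^-1 *: X1 r phi)) 0 i).
  rewrite mxE; exact: (@dGc i (fun s => X s phi) r _ (chart_cap phi (S rr)) (fun s => XO s phi) (dXr phi rn)).
have := is_derive_dot dg (fun i => is_derive_chart1_r e1 e2 zeta phi i rn).
congr is_derive.
have -> : \row_i dot (H i (X r phi)) (r^-1 *: X1 r phi) = r^-1 *: \row_i dot (H i (X r phi)) (X1 r phi).
  by apply/rowP => i; rewrite !mxE dotZr.
by rewrite dotZl [X in _ + X]dotZr -[LHS]mulrDr mulrC.
Qed.

Let d_uf_f r phi : 0 < r < r0 -> is_derive phi 1 (puf r)
  (dot (\row_i dot (H i (X r phi)) (Xf r phi)) (Xf r phi) + dot (G (X r phi)) (Xff r phi)).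
Proof.
move=> rr; have dg i : is_derive phi 1 (fun s => G (X r s) 0 i)
    ((\row_i dot (H i (X r phi)) (Xf r phi)) 0 i).
  rewrite mxE; exact: (@dGc i (X r) phi _ (chart_cap phi (S rr)) (XO r) (dXf r phi)).
exact: (is_derive_dot dg (fun i => is_derive_chartf e1 e2 r phi i)).
Qed.

(* Expand in the frame (meridian, parallel, normal): the second-order terms give
   chart_rad^2 times the trace of H, the first-order ones a multiple of G . x. *)
Lemma polar_laplace r phi : 0 < r < r0 ->
  dot (\row_i dot (H i (X r phi)) (Xf r phi)) (Xf r phi) + dot (G (X r phi)) (Xff r phi) = - pu2 r phi.
Proof.
move=> rr; apply/eqP; rewrite -addr_eq0; apply/eqP; have Gx := chart_cap phi (S rr).
rewrite /pu2 addrACA [X in _ + X]addrC -dotDr (chart_laplace e1 e2 zeta) [X in _ + X]dotZr.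
rewrite (G_tangential Gx) mulr0 addr0.
have := frame_trace (fun i => H i (X r phi)) (merid_frame fr r phi).
rewrite H_trace// => tr.
have {}tr := congr1 ( *%R (chart_rad r ^+ 2)) tr; rewrite /= mulr0 in tr.
apply: etrans tr; rewrite sum3E.
rewrite -/(X r phi) !H_tangential//.
have e1' i : dot (H i (X r phi)) (X1 r phi) = chart_rad r * dot (H i (X r phi)) (merid e1 e2 zeta r phi).
  by rewrite /X1 /chart1 dotZr.
have e2' i : dot (H i (X r phi)) (Xf r phi) = chart_rad r * dot (H i (X r phi)) (wdir' e1 e2 phi).
  by rewrite /Xf /chartf dotZr.
have c1 i : X1 r phi 0 i = chart_rad r * merid e1 e2 zeta r phi 0 i by rewrite [LHS]mxE.
have c2 i : Xf r phi 0 i = chart_rad r * wdir' e1 e2 phi 0 i by rewrite [LHS]mxE.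
have D (f : 'I_3 -> R) v : dot (\row_i f i) v = f 0 * v 0 0 + f 1 * v 0 1 + f 2%:R * v 0 2%:R.
  by rewrite dotE !mxE.
rewrite !D !e1' !e2' !c1 !c2; ring.
Qed.

Let cX r : continuous (X r).
Proof.
by move=> phi; apply: differentiable_continuous; apply/derivable1_diffP; case: (dXf r phi).
Qed.

Lemma continuous_comp_chart r (g : 'rV[R]_3 -> R) : 0 <= r <= r0 -> {within closure Gam, continuous g} ->
  continuous (fun phi => g (X r phi)).
Proof.
move=> rr cg phi; apply: (cvg_comp_closure _ _ _ cg); first exact: cX.
  by move=> p; exact: chart_closure_cap.
exact: chart_closure_cap.
Qed.

Lemma continuous_dot_comp (a b : R -> 'rV[R]_3) : (forall i, continuous (fun s => a s 0 i)) ->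
  (forall i, continuous (fun s => b s 0 i)) -> continuous (fun s => dot (a s) (b s)).
Proof.
move=> ca cb; under eq_fun do rewrite dotE.
move=> x; apply: cvgD; [apply: cvgD|]; by apply: cvgM; [exact: ca|exact: cb].
Qed.

Lemma Omega_coord (x : 'rV[R]_3) i : Omega x -> `|x 0 i| <= 1.
Proof.
move=> /OmegaE x1; rewrite -(ler_pXn2r (n := 2)) ?nnegrE// expr1n real_normK ?num_real//.
rewrite -x1 /dot (bigD1 i)//= expr2 lerDl; apply: sumr_ge0 => j _.
by rewrite -expr2 sqr_ge0.
Qed.

Lemma dot_bound (v w : 'rV[R]_3) (a b : R) : (forall i, `|v 0 i| <= a) -> (forall i, `|w 0 i| <= b) ->
  `|dot v w| <= 3 * a * b.
Proof.
move=> va wb; have P i : `|v 0 i * w 0 i| <= a * b by rewrite normrM; apply: ler_pM.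
rewrite dotE (_ : 3 * a * b = a * b + a * b + a * b); last ring.
by apply: le_trans (ler_normD _ _) (lerD (le_trans (ler_normD _ _) (lerD _ _)) _).
Qed.

Lemma chart1_bound r phi i : 0 <= r -> `|X1 r phi 0 i| <= chart_rad r.
Proof.
move=> rge; rewrite [X1 r phi 0 i]mxE normrM ger0_norm ?rad_ge0// ler_piMr ?rad_ge0//.
by apply: Omega_coord; have [[]] := merid_frame fr r phi.
Qed.

Lemma rad_le1 r : chart_rad r <= 1 :> R.
Proof. by have := hgt_rad r; have := sqr_ge0 (hgt r); nra. Qed.

Lemma chart11_bound r phi i : 0 <= r -> `|X11 r phi 0 i| <= 3.
Proof.
move=> rge; rewrite /X11 /chart11 comb_coord.
have s0 := rad_ge0 rge; have s1 := rad_le1 r; have t1 := hgt_le1 r; have t2 := hgt_geN1 r.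
have z1 : `|zeta 0 i| <= 1 by exact: Omega_coord.
have w1 : `|wdir e1 e2 phi 0 i| <= 1 by apply: Omega_coord; apply/OmegaE; exact: (wdir_unit fr).
have th := hgt_rad r.
apply: le_trans (ler_normD _ _) _.
rewrite normrM [X in _ + X]normrM [X in _ + X * _]normrM.
have a1 : `|- (2 * chart_rad r ^+ 2 * hgt r)| <= 2.
  rewrite ler_norml; apply/andP; split; have : chart_rad r ^+ 2 <= 1 by nra.
  - have := sqr_ge0 (chart_rad r); move: (chart_rad r ^+ 2) => q; nra.
  - have := sqr_ge0 (chart_rad r); move: (chart_rad r ^+ 2) => q; nra.
have a2 : `|chart_rad r| <= 1 by rewrite ger0_norm.
have a3 : `|hgt r ^+ 2 - chart_rad r ^+ 2| <= 1.
  rewrite ler_norml; apply/andP; split.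
    by have := sqr_ge0 (hgt r); lra.
  by have := sqr_ge0 (chart_rad r); lra.
have b1 : `|- (2 * chart_rad r ^+ 2 * hgt r)| * `|zeta 0 i| <= 2 * 1 by apply: ler_pM.
have b2 : `|chart_rad r| * `|hgt r ^+ 2 - chart_rad r ^+ 2| * `|wdir e1 e2 phi 0 i| <= 1 * 1 * 1.
  by apply: ler_pM => //; first [exact: mulr_ge0|exact: ler_pM].
lra.
Qed.

(** X1 has length [chart_rad r] <= 2 r, so r du/dr vanishes linearly at the centre; the factor 6 is
    3 from the three coordinates times this 2. *)
Lemma pu1_bound : exists B, forall r phi, 0 <= r <= r0 -> `|pu1 r phi| <= B * r.
Proof.
have [M hM] := jet_bounded; exists (6 * M) => r phi rr.
have rge : 0 <= r by case/andP: rr.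
have [_ g1 _] := hM _ (@chart_closure_cap r phi rr).
have M0 : 0 <= M by exact: le_trans (g1 0).
apply: le_trans (dot_bound g1 (fun i => chart1_bound phi i rge)) _.
by have := rad_le rge; nra.
Qed.

Lemma polar_harmonic_cap : polar_harmonic 0 r0 pu pu1 puf pu2.
Proof.
split.
- exact: d_u_r.
- exact: d_u1_r.
- exact: d_u_f.
- by move=> r phi rr; rewrite -polar_laplace//; exact: d_uf_f.
- move=> r rr; apply: continuous_dot_comp => i.
    exact: (continuous_comp_chart (S' rr) (@cG i)).
  by apply: is_derive_continuous => x; exact: is_derive_chart1_f.
- move=> r rr phi; have cX1 i : continuous (fun s => X1 r s 0 i).
    by apply: is_derive_continuous => x; exact: is_derive_chart1_f.
  apply: cvgD.
    apply: (continuous_dot_comp (a := fun s => \row_i dot (H i (X r s)) (X1 r s))) => // i.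
    under eq_fun do rewrite mxE; apply: continuous_dot_comp => // j.
    exact: (continuous_comp_chart (S' rr) (@cH i j)).
  apply: (continuous_dot_comp (b := X11 r)) => i.
    exact: (continuous_comp_chart (S' rr) (@cG i)).
  rewrite (_ : (fun s => _) = (fun s => - (2 * chart_rad r ^+ 2 * hgt r) * zeta 0 i +
     chart_rad r * (hgt r ^+ 2 - chart_rad r ^+ 2) * wdir e1 e2 s 0 i)); last first.
    by apply/funext => s; rewrite /X11 /chart11 comb_coord.
  move=> x; apply: cvgD; first exact: cvg_cst.
  apply: cvgMr; apply: (@is_derive_continuous _ _ (fun s => wdir' e1 e2 s 0 i)) => s.
  exact: is_derive_wdir.
- move=> r rr; rewrite /pu /puf /X /Xf /chart /chartf /wdir /wdir' cos_2pi sin_2pi cos0 sin0.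
  by [].
- have [M hM] := jet_bounded; exists (M + 3 * M * 1 + (3 * (3 * M * 1) * 1 + 3 * M * 3)) => r phi rr.
  have rge : 0 <= r by case/andP: rr => /ltW.
  have [g0 g1 g2] := hM _ (GamC (chart_cap phi (S rr))).
  have M0 : 0 <= M by exact: le_trans (g1 0).
  have x1 i : `|X1 r phi 0 i| <= 1 by apply: le_trans (chart1_bound phi i rge) (rad_le1 r).
  have b1 : `|pu1 r phi| <= 3 * M * 1 by exact: dot_bound.
  have b2 : `|pu2 r phi| <= 3 * (3 * M * 1) * 1 + 3 * M * 3.
    apply: le_trans (ler_normD _ _) _; apply: lerD.
      by apply: dot_bound => // i; rewrite mxE; exact: dot_bound.
    by apply: dot_bound => // i; exact: chart11_bound.
  by split; [rewrite /pu; apply: le_trans g0 _|apply: le_trans b1 _|apply: le_trans b2 _]; lra.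
Qed.

Let KX r phi : 0 <= r <= r0 -> closure Gam (X r phi). Proof. exact: chart_closure_cap. Qed.

Lemma zeta_cap : Gam zeta.
Proof.
apply/(capE rho zeta); split => //; move/OmegaE: hzeta => ->.
by rewrite ltrBlDr ltrDl.
Qed.

Lemma pu_center e : 0 < e -> exists2 d, 0 < d &
  forall r phi, 0 < r < r0 -> r < d -> `|pu r phi - U zeta| <= e.
Proof.
move=> e0; have [d d0 hd] := closure_continuous_dist (GamC zeta_cap) cU e0.
(* The squared chord from zeta is 2 (1 - hgt r) = 2 r chart_rad r <= 4 r^2. *)
exists (d / 2); first by rewrite divr_gt0.
move=> r phi rr rd; apply: hd; first exact/KX/S'.
rewrite dot_sub_Omega// dotC (dot_zeta_chart fr).
have rge : 0 <= r by case/andP: rr => /ltW.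
have := sub1_hgt r; have := rad_le rge => h1 h2.
have -> : 2 - 2 * hgt r = 2 * (r * chart_rad r) by rewrite -h2; ring.
have : r * chart_rad r <= r * (2 * r) by rewrite ler_wpM2l.
nra.
Qed.

(** The squared chord between the two points is at most 4 D, with D = r^2 kden. If it is below d^2,
    continuity gives e. Otherwise D >= d^2 / 4, and the trivial bound 2 M is at most (8 M / d^2)
    D. *)
Lemma pu_dist a th e : 0 < a < r0 -> 0 < e -> exists2 C, 0 <= C &
  forall r phi, a < r < r0 ->
    `|pu r phi - pu a th| <= e + C * (r ^+ 2 * kden (a / r) (phi - th)).
Proof.
move=> aa e0; have [d d0 hd] := closure_continuous_dist (@KX a th (S' aa)) cU e0.
have [M hM] := jet_bounded.
have M0 : 0 <= M.
  by have [h _ _] := hM _ (@KX a th (S' aa)); exact: le_trans h.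
have d2 : 0 < d ^+ 2 by exact: exprn_gt0.
exists (8 * M / d ^+ 2) => [|r phi /andP[ar rr0]]; first by rewrite divr_ge0 ?mulr_ge0// ltW.
have a_gt0 : 0 < a by case/andP: aa.
have r_gt0 := lt_trans a_gt0 ar.
have rr : 0 < r < r0 by rewrite r_gt0.
have q1 : 0 <= a / r < 1.
  by rewrite divr_ge0 ?(ltW a_gt0) ?(ltW r_gt0)//= ltr_pdivrMr// mul1r.
set D := r ^+ 2 * kden (a / r) (phi - th).
have D0 : 0 <= D by rewrite mulr_ge0 ?sqr_ge0// ltW// kden_gt0.
have E : dot (X r phi - X a th) (X r phi - X a th) <= 4 * D.
  rewrite dot_sub_Omega// (dotC (X r phi)).
  have := dot_chart_kden fr phi a th r_gt0; rewrite -/D -/(X r phi) -/(X a th) => h.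
  have -> : 2 - 2 * dot (X a th) (X r phi) = 4 * (D / ((1 + r ^+ 2) * (1 + a ^+ 2))).
    by rewrite -mulrA in h; rewrite -[_ / _]mulr1; lra.
  rewrite ler_wpM2l// ler_pdivrMr; last by rewrite mulr_gt0// ltr_wpDr ?sqr_ge0.
  by rewrite ler_peMr//; have := sqr_ge0 r; have := sqr_ge0 a; nra.
have [lt|ge] := ltP (dot (X r phi - X a th) (X r phi - X a th)) (d ^+ 2).
  apply: le_trans (hd _ (@KX r phi (S' rr)) lt) _; rewrite lerDl mulr_ge0//.
  by rewrite divr_ge0 ?mulr_ge0// ltW.
have [h1 _ _] := hM _ (@KX a th (S' aa)); have [h2 _ _] := hM _ (@KX r phi (S' rr)).
have b : `|pu r phi - pu a th| <= 2 * M.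
  by apply: le_trans (ler_normB _ _) _; rewrite /pu; lra.
apply: (le_trans b); apply: (@le_trans _ _ (8 * M / d ^+ 2 * D)); last by rewrite lerDr ltW.
rewrite mulrAC ler_pdivlMr//.
have : d ^+ 2 <= 4 * D by exact: le_trans E.
by move: (d ^+ 2) => x; nra.
Qed.

(** Staying above the midpoint of a and r0 keeps the kernels with pole at radius a uniformly bounded
    along the sequence. *)
Lemma cvg_to_radius a : 0 <= a < r0 -> exists r_ : nat -> R,
  (forall n, (r0 + a) / 2 <= r_ n < r0) /\ r_ n @[n --> \oo] --> r0.
Proof.
move=> /andP[a_ge ar]; exists (fun n => r0 - (r0 - a) / 2 * n.+1%:R^-1); split.
  move=> n; have n0 : 0 < n.+1%:R^-1 :> R by rewrite invr_gt0.
  have n1 : n.+1%:R^-1 <= 1 :> R by rewrite invf_le1// ler1n.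
  have h : 0 < (r0 - a) / 2 by lra.
  by move: (n.+1%:R^-1) n0 n1 => k n0 n1; apply/andP; split; nra.
rewrite -[X in _ --> X]subr0; apply: cvgB; first exact: cvg_cst.
rewrite -[X in _ --> X](mulr0 ((r0 - a) / 2)); apply: cvgMr.
exact: cvg_harmonic.
Qed.

Let r0r0 : 0 <= r0 <= r0. Proof. by rewrite lexx (ltW r0_gt0). Qed.
Let r0n : r0 != 0. Proof. by rewrite gt_eqF. Qed.

Lemma continuous_pu1 r : 0 <= r <= r0 -> continuous (pu1 r).
Proof.
move=> rr; apply: continuous_dot_comp => i.
  exact: (continuous_comp_chart rr (@cG i)).
by apply: is_derive_continuous => x; exact: is_derive_chart1_f.
Qed.

Lemma cvg_pu1 (r_ : nat -> R) phi : (forall n, 0 <= r_ n <= r0) -> r_ n @[n --> \oo] --> r0 ->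
  pu1 (r_ n) phi @[n --> \oo] --> pu1 r0 phi.
Proof.
move=> hr cr; apply: cvg_dot; apply: cvg_row => i.
  apply: (cvg_comp_closure _ _ _ (@cG i)); last 2 first.
  - by move=> n; exact: KX.
  - exact: KX.
  apply: cvg_row => j; apply: (@cvg_comp _ _ _ r_ (fun s => X s phi 0 j) _ _ _ cr).
  exact: (is_derive_cvg (is_derive_chart_r e1 e2 zeta phi j r0n)).
apply: (@cvg_comp _ _ _ r_ (fun s => X1 s phi 0 i) _ _ _ cr).
exact: (is_derive_cvg (is_derive_chart1_r e1 e2 zeta phi i r0n)).
Qed.

Let hB : exists B, forall r phi, 0 < r < r0 -> `|pu1 r phi| <= B * r.
Proof. by have [B hB] := pu1_bound; exists B => r phi /S'; exact: hB. Qed.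

Let pu1_bounded : exists2 B, 0 <= B & forall r phi, 0 < r < r0 -> `|pu1 r phi| <= B.
Proof.
have [B hB'] := hB; exists (`|B| * r0) => [|r phi rr]; first by rewrite mulr_ge0// ltW.
apply: le_trans (hB' r phi rr) _; case/andP: rr => r1 r2.
by apply: le_trans (ler_wpM2r (ltW r1) (ler_norm B)) _; rewrite ler_wpM2l// ltW.
Qed.

Lemma boundary_flux : circ (pu1 r0) = 0.
Proof.
have [B hB'] := hB; have [B' B0 hB''] := pu1_bounded.
have [|r_ [hr cr]] := @cvg_to_radius 0; first by rewrite lexx.
have rr n : 0 < r_ n < r0.
  by have /andP[h1 ->] := hr n; rewrite andbT; have := r0_gt0; lra.
apply: (@circ_limit _ (fun n => pu1 (r_ n)) _ B').
- by move=> n; exact/continuous_pu1/S'.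
- by move=> phi; apply: cvg_pu1 => // n; exact: S'.
- by move=> n x; exact: hB''.
- by move=> n; apply: (flux_zero polar_harmonic_cap hB').
Qed.

(** [neumann_disc] holds on the circles a < r < r0 with a right-hand side independent of r, so
    dominated convergence extends it to r = r0. *)
Lemma boundary_kernel a th : 0 < a < r0 ->
  circ (fun phi => logker (a / r0) (phi - th) * pu1 r0 phi) = 2 * pi * (U zeta - pu a th).
Proof.
move=> aa; have /andP[a_gt0 ar0] := aa.
have [B hB'] := hB; have [B' B0 hB''] := pu1_bounded.
have [|r_ [hr cr]] := @cvg_to_radius a; first by rewrite (ltW a_gt0).
have ra n : a < r_ n < r0.
  by have /andP[h1 ->] := hr n; rewrite andbT; lra.
have rr n : 0 < r_ n < r0.
  by have /andP[h1 ->] := ra n; rewrite andbT (lt_trans a_gt0).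
(* The largest value of a / r_ n, as r_ n is at least the midpoint; through [logker_bound] it yields
   the dominating constant. *)
pose q0 := a / ((r0 + a) / 2).
have q01 : q0 < 1 by rewrite /q0 ltr_pdivrMr; lra.
have qq n : 0 <= a / r_ n <= q0.
  have /andP[rn _] := rr n; have /andP[h1 _] := hr n.
  rewrite divr_ge0 ?(ltW a_gt0) ?(ltW rn)//= ler_wpM2l ?(ltW a_gt0)//.
  by rewrite lef_pV2 ?posrE//; lra.
have q1 n : 0 <= a / r_ n < 1.
  by have /andP[-> h] := qq n; rewrite (le_lt_trans h q01).
have q1' : 0 <= a / r0 < 1.
  by rewrite divr_ge0 ?(ltW a_gt0) ?(ltW r0_gt0)//= ltr_pdivrMr// mul1r.
apply: (@circ_limit _ (fun n phi => logker (a / r_ n) (phi - th) * pu1 (r_ n) phi) _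
   ((`|ln ((1 - q0) ^+ 2)| + `|ln 4|) * B')).
- move=> n; apply: continuous_mul; first exact: continuous_logker.
  exact/continuous_pu1/S'.
- move=> phi; apply: cvgM; last by apply: cvg_pu1 => // n; exact: S'.
  have ca : a / r_ n @[n --> \oo] --> a / r0.
    by apply: cvgMr; apply: cvgV.
  apply: (@cvg_comp _ _ _ (fun n => a / r_ n) (fun q => logker q (phi - th)) _ _ _ ca).
  apply: (@continuous_comp _ _ _ (fun q => kden q (phi - th)) (@ln R)).
    exact: (is_derive_cvg (is_derive_kden_q (a / r0) (phi - th))).
  by apply: continuous_ln; exact: kden_gt0.
- move=> n x; rewrite normrM; apply: ler_pM => //; [exact: logker_bound|exact: hB''].
- move=> n; apply: (neumann_disc polar_harmonic_cap hB' pu_center aa) => // e.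
  exact: pu_dist.
Qed.

Lemma chart_height t : 1 - rho < t < 1 -> exists2 r, 0 < r < r0 & hgt r = t.
Proof.
move=> /andP[ct t1]; have [|r rge rt] := @hgt_surj _ t.
  by apply/andP; split; [move: rho_lt2; lra|lra].
exists r => //; apply/andP; split.
  rewrite lt_neqAle rge andbT; apply/eqP => r0E; move: t1; rewrite -rt -r0E.
  by rewrite /hgt expr0n/= subr0 addr0 divr1 ltxx.
rewrite ltNge; apply/negP; rewrite le_eqVlt => /predU1P[r0E|r0r].
  by move: ct; rewrite -rt -hgt_r0 r0E ltxx.
by have := hgt_lt (ltW r0_gt0) r0r; rewrite rt hgt_r0; lra.
Qed.

Lemma circle_mean t : 1 - rho < t < 1 ->
  continuous (fun phi => U (circle e1 e2 zeta t phi)) /\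
  circ (fun phi => U (circle e1 e2 zeta t phi)) = 2 * pi * U zeta.
Proof.
move=> /chart_height[r rr <-]; have rge : 0 <= r by case/andP: rr => /ltW.
have -> : (fun phi => U (circle e1 e2 zeta (hgt r) phi)) = pu r.
  by apply/funext => phi; rewrite /pu /X chart_circle.
split; first exact: (ph_cont polar_harmonic_cap rr).
have [B hB'] := hB.
exact: (circ_mean polar_harmonic_cap hB' pu_center rr).
Qed.

Lemma polar_coordinates xi : Gam xi -> xi != zeta ->
  exists a th, 0 < a < r0 /\ xi = X a th.
Proof.
move=> /(capE rho zeta)[xO cx] xz.
have t1 : dot zeta xi < 1 by apply: dot_lt1 => //; rewrite eq_sym.
have [|a aa at_] := @chart_height (dot zeta xi); first by rewrite cx.
have age : 0 <= a by case/andP: aa => /ltW.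
have x1 := dot_frame xi xi fr; move/OmegaE: (xO) => xx; rewrite xx in x1.
have [|th _ [xc xs]] := @polar_angle _ (dot xi e1) (dot xi e2) _ (rad_ge0 age).
  have := hgt_rad a; rewrite at_ => h; rewrite (dotC xi zeta) in x1.
  apply: (@addrI _ (dot zeta xi ^+ 2)); apply/esym; apply: etrans h _.
  by apply: etrans x1 _; ring.
exists a, th; split => //; apply/rowP => i.
rewrite /X /chart comb_coord /wdir comb_coord at_.
have := dot_frame xi (basis3 R i) fr; rewrite dot_basis !(dotC (basis3 R i)) !dot_basis xc xs (dotC xi).
by move=> ->; ring.
Qed.

Lemma cap_boundaryE : cap_boundary e1 e2 zeta rho = X r0.
Proof.
apply/funext => phi; rewrite /X chart_circle; last exact: ltW.
by rewrite hgt_r0.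
Qed.

Lemma line_integral_cap f : line_integral (cap_boundary e1 e2 zeta rho) 0 (2 * pi) f =
  circ (fun phi => f (X r0 phi) * chart_rad r0).
Proof.
rewrite /line_integral cap_boundaryE; apply: eq_Rintegral => phi _; congr (_ * _).
rewrite derive1E; have [_ ->] := dXf r0 phi.
rewrite /Xf /chartf enormZ ger0_norm ?rad_ge0 ?(ltW r0_gt0)//.
by rewrite /enorm (dot_wdir' fr) sqrtr1 mulr1.
Qed.

Lemma boundary_chart phi : sboundary Gam (X r0 phi).
Proof.
rewrite (sboundary_capE hzeta rho_gt0 rho_lt2); split; first exact: XO.
by rewrite (dot_zeta_chart fr) hgt_r0.
Qed.

(** On the boundary circle the unit meridian vector is the outer normal. The factor [chart_rad r0]
    is the length element of the circle, so integrating [pu1] over phi integrates the normal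
    derivative over arc length. *)
Lemma pu1_boundary phi : pu1 r0 phi = chart_rad r0 * normal_derivative Gam U (X r0 phi).
Proof.
have -> : normal_derivative Gam U (X r0 phi) = dot (cap_normal rho zeta (X r0 phi)) (G (X r0 phi)).
  apply: (normal_derivativeE hzeta rho_gt0 rho_lt2 (boundary_chart phi)) => i.
  have cg : G y 0 i @[y --> within (closure Gam) (nbhs (X r0 phi))] --> G (X r0 phi) 0 i.
    by have := @cG i (X r0 phi); rewrite /continuous_at /= nbhs_subspace_in; last exact: KX.
  have {}cg : G y 0 i @[y --> within Gam (nbhs (X r0 phi))] --> G (X r0 phi) 0 i.
    apply: cvg_trans cg; apply: cvg_app => A; rewrite /within /=.
    move=> wA; have {}wA : \forall y \near X r0 phi, closure Gam y -> A y := wA.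
    suff : \forall y \near X r0 phi, Gam y -> A y by [].
    by apply: filterS wA => y KA Gy; exact/KA/GamC.
  apply: cvg_trans cg; apply: near_eq_cvg.
  by rewrite near_withinE; near=> y => Gy; rewrite GE.
rewrite /pu1 /X1 /chart1 dotZr dotC; congr (_ * dot _ _).
have s0 : chart_rad r0 != 0.
  by rewrite /chart_rad mulf_neq0 ?mulf_neq0 ?invr_eq0 ?chart_den ?pnatr_eq0.
apply/rowP => i; rewrite /merid comb_coord /cap_normal -hgt_r0 rad_sqrt ?(ltW r0_gt0)//.
have e0 : (hgt r0 *: X r0 phi - zeta) 0 i = hgt r0 * X r0 phi 0 i - zeta 0 i.
  by rewrite [LHS]mxE [X in X + _]mxE [X in _ + X]mxE.
rewrite [RHS]mxE e0 [X r0 phi 0 i]comb_coord.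
have e : hgt r0 ^+ 2 = 1 - chart_rad r0 ^+ 2 by rewrite -(hgt_rad r0); ring.
have -> : hgt r0 * (hgt r0 * zeta 0 i + chart_rad r0 * wdir e1 e2 phi 0 i) - zeta 0 i =
   hgt r0 ^+ 2 * zeta 0 i + hgt r0 * chart_rad r0 * wdir e1 e2 phi 0 i - zeta 0 i by ring.
by rewrite e; field.
Unshelve. all: by end_near. Qed.

Lemma representation_chart xi (A B : R) : Gam xi ->
  line_integral (cap_boundary e1 e2 zeta rho) 0 (2 * pi)
    (fun eta => (A * ln (1 - dot xi eta) + B) * normal_derivative Gam U eta) =
  A * (2 * pi * (U zeta - U xi)).
Proof.
move=> Gxi; rewrite line_integral_cap.
have -> : (fun phi => (A * ln (1 - dot xi (X r0 phi)) + B) *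
      normal_derivative Gam U (X r0 phi) * chart_rad r0) =
    (fun phi => (A * ln (1 - dot xi (X r0 phi)) + B) * pu1 r0 phi).
  by apply/funext => phi; rewrite pu1_boundary; ring.
have cp := continuous_pu1 r0r0.
(* For xi = zeta the kernel is constant on the boundary circle, and zero flux makes both sides
   vanish. Otherwise xi has a positive radius a. *)
have [->|xz] := eqVneq xi zeta.
  have -> : (fun phi => (A * ln (1 - dot zeta (X r0 phi)) + B) * pu1 r0 phi) =
      (fun phi => (A * ln rho + B) * pu1 r0 phi).
    apply/funext => phi; rewrite (dot_zeta_chart fr) hgt_r0.
    by have -> : 1 - (1 - rho) = rho by ring.
  by rewrite circZ// boundary_flux subrr !mulr0.
have [a [th [aa xE]]] := polar_coordinates Gxi xz.
(* By [dot_chart_kden], 1 - xi . eta = k kden on the boundary circle; ln k joins the additive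
   constant, which multiplies the zero flux. *)
pose k := 2 * r0 ^+ 2 / ((1 + r0 ^+ 2) * (1 + a ^+ 2)).
have k0 : 0 < k.
  by rewrite divr_gt0 ?mulr_gt0 ?exprn_gt0// ltr_wpDr ?sqr_ge0.
have /andP[a_gt0 ar0] := aa.
have q1 : 0 <= a / r0 < 1.
  by rewrite divr_ge0 ?(ltW a_gt0) ?(ltW r0_gt0)//= ltr_pdivrMr// mul1r.
have -> : (fun phi => (A * ln (1 - dot xi (X r0 phi)) + B) * pu1 r0 phi) =
    (fun phi => A * (logker (a / r0) (phi - th) * pu1 r0 phi) + (A * ln k + B) * pu1 r0 phi).
  apply/funext => phi; rewrite xE (dot_chart_kden fr _ _ _ r0_gt0).
  have -> : 2 * (r0 ^+ 2 * kden (a / r0) (phi - th)) / ((1 + r0 ^+ 2) * (1 + a ^+ 2)) =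
      k * kden (a / r0) (phi - th) by rewrite /k; ring.
  rewrite lnM ?posrE ?kden_gt0// /logker; ring.
have cl : continuous (fun phi => logker (a / r0) (phi - th) * pu1 r0 phi).
  by apply: continuous_mul => //; exact: continuous_logker.
rewrite circD; [|exact: continuous_scale|exact: continuous_scale].
rewrite !circZ// boundary_flux mulr0 addr0 boundary_kernel//.
by rewrite /pu -xE.
Qed.

End chart.

Lemma radius_exists : exists2 r0, 0 < r0 & hgt r0 = 1 - rho.
Proof.
have [|r rge rt] := @hgt_surj R (1 - rho).
  by apply/andP; split; move: rho_gt0 rho_lt2; lra.
exists r => //; rewrite lt_neqAle rge andbT; apply/eqP => r0E.
move: rt rho_gt0; rewrite -r0E /hgt expr0n/= subr0 addr0 divr1 => rt.
by lra.
Qed.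

Lemma cap_mean : surface_integral Gam U = 2 * pi * rho * U zeta.
Proof.
have [M hM] := jet_bounded; have [r0 r0_gt0 hr0] := radius_exists.
apply: (cap_surface_integral (M := M)) => //.
- by rewrite rho_gt0.
- by move=> x /GamC/hM[].
- move=> e1 e2 fr t tt; have [c m] := circle_mean fr r0_gt0 hr0 tt.
  by split => //; exact: continuous_integrable.
Qed.

(** By [cap_mean] the first term is U zeta, and [representation_chart] with A = 1 / (2 pi) evaluates
    the second as U zeta - U xi. *)
Lemma neumann_representation (e1 e2 xi : 'rV[R]_3) : orthonormal_frame e1 e2 zeta -> Gam xi ->
  U xi = (2 * pi * rho)^-1 * surface_integral Gam U -
    line_integral (cap_boundary e1 e2 zeta rho) 0 (2 * pi)
      (fun eta => ((2 * pi)^-1 * ln (1 - dot xi eta) +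
         (1 - rho) / (2 * pi * rho) * ln (2 - rho)) * normal_derivative Gam U eta).
Proof.
move=> fr Gxi; have [r0 r0_gt0 hr0] := radius_exists.
rewrite (representation_chart fr r0_gt0 hr0 _ _ Gxi) cap_mean.
have pn : (pi : R) != 0 by rewrite gt_eqF// pi_gt0.
have rn : rho != 0 by rewrite gt_eqF.
by move: (pi : R) pn => p pn; field; rewrite rn pn.
Qed.

End harmonic_on_cap.

Theorem theorem2p7 (R : realType) (rho : R) (zeta : 'rV[R]_3)
    (hzeta : Omega zeta) (hrho0 : 0 < rho) (hrho2 : rho < 2) :
  is_neumann_green (cap rho zeta) (cap_neumann_green rho zeta) /\
  (forall F U : 'rV[R]_3 -> R,
     {within sboundary (cap rho zeta), continuous F} ->
     Ck_closure 2 (cap rho zeta) U ->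
     (forall x, cap rho zeta x -> beltrami U x = 0) ->
     (forall eta, sboundary (cap rho zeta) eta ->
        normal_derivative (cap rho zeta) U eta = F eta) ->
     forall e1 e2 : 'rV[R]_3, orthonormal_frame e1 e2 zeta ->
     forall xi, cap rho zeta xi ->
       U xi =
         (2 * pi * rho)^-1 * surface_integral (cap rho zeta) U -
         line_integral (cap_boundary e1 e2 zeta rho) 0 (2 * pi)
           (fun eta =>
              ((2 * pi)^-1 * ln (1 - dot xi eta) +
               (1 - rho) / (2 * pi * rho) * ln (2 - rho)) * F eta)).
Proof.
split; first exact: neumann_green_cap.
move=> F U _ [cU [dU [G GE CG]]] bel FE e1 e2 fr xi Gxi.
(* The second-order extensions exist for each component of G separately; choice gathers them into
   one family. *)
have /choice[H hH] : forall i, exists Hi : 'rV[R]_3 -> 'rV[R]_3,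
    (forall x, cap rho zeta x -> Hi x = sgrad (fun y => G y 0 i) x) /\
    (forall j, {within closure (cap rho zeta), continuous (fun x => Hi x 0 j)}).
  by move=> i; have [_ [_ [Hi HE cH]]] := CG i; exists Hi; split => // j; case: (cH j).
rewrite (neumann_representation hzeta hrho0 hrho2 cU dU GE (fun i => (CG i).1) (fun i => (CG i).2.1)
  (fun i => (hH i).1) (fun i => (hH i).2) bel fr Gxi).
(* The parametrized circle lies in the boundary, where F is the normal derivative of U. *)
congr (_ - _); apply: eq_Rintegral => phi _; congr (_ * _ * _); apply: FE.
rewrite sboundary_capE//; split; last exact: dot_circle fr.
by apply: circle_Omega fr _; apply/andP; split; lra.
Qed.
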